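(* Let $\theta>0$ and let $\tilde W_n'=\frac{W_n'-\mathbb E W_n'}{n^2}$, $\tilde T_n'=\frac{T_n'-\mathbb E T_n'}{n}$ for the Hoppe tree with parameter $\theta$. Then $(\tilde W_n',\tilde T_n')^t$ converges in distribution and with second moments to a random vector $(\tilde W',\tilde T')^t$ whose law satisfies $$\begin{pmatrix}\tilde W'\\ \tilde T'\end{pmatrix}\overset{d}{=}\begin{pmatrix}(1-V)^2 & V(1-V)\\ 0 & 1-V\end{pmatrix}\begin{pmatrix}\tilde W'\\ \tilde T'\end{pmatrix}+\begin{pmatrix}V^2 & V(1-V)\\ 0 & V\end{pmatrix}\begin{pmatrix}\tilde W\\ \tilde T\end{pmatrix}+b^\ast,$$ $$b^\ast=\begin{pmatrix}\Big(\frac{\theta+5}{\theta+1}-\frac{2\theta+4}{\theta+1}V\Big)V+\mathcal E(V)+\big(\Psi(\theta+1)-\Psi(2)\big)V\\[2pt] V+\mathcal E(V)+\big(\Psi(\theta+1)-\Psi(2)\big)V\end{pmatrix},$$ where $V\sim\beta(1,\theta)$, and $(\tilde W',\tilde T')$, $(\tilde W,\tilde T)$, $V$ are independent, with $(\tilde W,\tilde T)$ having the limit law for the random recursive tree described in the context. This law of $(\tilde W',\tilde T')$ is the unique solution of this equation among centered probability distributions on $\mathbb R^2$ with finite second moments.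
   Context: Let $(J_k)_{k\ge1}$ be independent with $\Pr(J_k=0)=\frac{\theta}{\theta+k-1}$ and $\Pr(J_k=i)=\frac{1}{\theta+k-1}$ for $i\in\{1,\dots,k-1\}$. The Hoppe tree with $n$ vertices has vertex set $\{0,\dots,n-1\}$, root $0$, parent of $k\ge1$ equal to $J_k$; for $\theta=1$ it is the random recursive tree. $T_n=\sum_{k=0}^{n-1}D_k$ ($D_k$ the depth of $k$) is the total length and $W_n=\sum_{0\le i<j\le n-1}\operatorname{dist}(i,j)$ the Wiener index; primes denote quantities for the Hoppe tree with parameter $\theta$, unprimed ones for the random recursive tree. $\mathcal E(v)=v\log v+(1-v)\log(1-v)$, $\Psi$ is the digamma function, $\beta(1,\theta)$ has density $\theta(1-v)^{\theta-1}$ on $(0,1)$. Known input (Neininger 2002): for the random recursive tree, $\big(\frac{W_n-\mathbb EW_n}{n^2},\frac{T_n-\mathbb ET_n}{n}\big)$ converges in distribution and with second moments to $(\tilde W,\tilde T)$, whose law is the unique centered finite-second-moment solution of $\begin{pmatrix}\tilde W\\ \tilde T\end{pmatrix}\overset d=\begin{pmatrix}(1-U)^2&U(1-U)\\0&1-U\end{pmatrix}\begin{pmatrix}\tilde W^\ast\\ \tilde T^\ast\end{pmatrix}+\begin{pmatrix}U^2&U(1-U)\\0&U\end{pmatrix}\begin{pmatrix}\tilde W\\ \tilde T\end{pmatrix}+\begin{pmatrix}3U(1-U)+\mathcal E(U)\\ U+\mathcal E(U)\end{pmatrix}$, with $(\tilde W,\tilde T),(\tilde W^\ast,\tilde T^\ast),U$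 independent, $(\tilde W^\ast,\tilde T^\ast)\overset d=(\tilde W,\tilde T)$, $U\sim\mathcal U[0,1]$. Convergence ''with second moments'' means convergence in distribution together with convergence of all second moments. *)

(* Defs.v *)
From HB Require Import structures.
From mathcomp Require Import all_boot all_order all_algebra.
From mathcomp Require Import all_classical all_reals all_analysis.
Set Implicit Arguments. Unset Strict Implicit. Unset Printing Implicit Defensive.
Import Order.TTheory GRing.Theory Num.Theory.
Import numFieldNormedType.Exports.
Local Open Scope classical_set_scope.
(* Combinatorics of recursive trees on vertex set {0,...,n-1}.               *)
(* A tree is encoded by its parent function J : nat -> nat with J k < k for *)
(* 1 <= k <= n-1 (J k is the parent of k; vertex 0 is the root).            *)

Fixpoint depth_fuel (J : nat -> nat) (fuel k : nat) : nat :=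
  match fuel with
  | 0 => 0
  | f.+1 => if k == 0 then 0 else (depth_fuel J f (J k)).+1
  end.
(* fuel k suffices since J k < k *)
Definition depth (J : nat -> nat) (k : nat) : nat := depth_fuel J k k.

(* graph distance in the tree: since labels increase along root-to-leaf
   paths, the larger of two distinct vertices is not an ancestor of the
   smaller one, so the path goes through its parent. *)
Fixpoint dist_fuel (J : nat -> nat) (fuel i j : nat) : nat :=
  match fuel with
  | 0 => 0
  | f.+1 => if i == j then 0
            else if j < i then (dist_fuel J f (J i) j).+1
            else (dist_fuel J f i (J j)).+1
  end.
Definition tdist (J : nat -> nat) (i j : nat) : nat := dist_fuel J (i + j) i j.

Definition total_length (n : nat) (J : nat -> nat) : nat :=
  \sum_(k < n) depth J k.
Definition wiener (n : nat) (J : nat -> nat) : nat :=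
  \sum_(i < n) \sum_(j < n | i < j) tdist J i j.

Definition valid_parents (n : nat) (p : {ffun 'I_n -> 'I_n}) : bool :=
  [forall k : 'I_n, if k == 0 :> nat then p k == 0 :> nat else p k < k].

Definition parent_fun (n : nat) (p : {ffun 'I_n -> 'I_n}) (k : nat) : nat :=
  odflt 0%N (omap (fun i : 'I_n => nat_of_ord (p i)) (insub k)).

Local Open Scope ring_scope.

Section Hoppe.
Variable R : realType.

(* Probability that the Hoppe tree with parameter theta and n vertices has
   parent vector p: product over k = 1..n-1 of P(J_k = p k), where
   P(J_k = 0) = theta/(theta+k-1), P(J_k = i) = 1/(theta+k-1), 1<=i<=k-1. *)
Definition hoppe_prob (theta : R) (n : nat) (p : {ffun 'I_n -> 'I_n}) : R :=
  if valid_parents p then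
    \prod_(k < n | (0 < k)%N)
       ((if p k == 0 :> nat then theta else 1) / (theta + k%:R - 1))
  else 0.

Definition hoppeE (theta : R) (n : nat) (g : (nat -> nat) -> R) : R :=
  \sum_(p : {ffun 'I_n -> 'I_n}) hoppe_prob theta p * g (parent_fun p).

Definition hoppe_normalized (theta : R) (n : nat) (J : nat -> nat) : R * R :=
  (((wiener n J)%:R - hoppeE theta n (fun J' => (wiener n J')%:R)) / (n%:R ^+ 2),
   ((total_length n J)%:R - hoppeE theta n (fun J' => (total_length n J')%:R))
      / n%:R).

Definition hoppe_normE (theta : R) (n : nat) (f : R * R -> R) : R :=
  hoppeE theta n (fun J => f (hoppe_normalized theta n J)).

Local Open Scope ereal_scope.

Definition bounded_continuous (f : R * R -> R) : Prop :=
  continuous f /\ exists M : R, forall x, (`|f x| <= M)%R.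

Definition finite_second_moments (mu : probability (R * R)%type R) : Prop :=
  mu.-integrable setT (fun x => ((x.1) ^+ 2)%:E) /\
  mu.-integrable setT (fun x => ((x.2) ^+ 2)%:E).

Definition centered_L2 (mu : probability (R * R)%type R) : Prop :=
  finite_second_moments mu /\
  \int[mu]_x (x.1)%:E = 0 /\ \int[mu]_x (x.2)%:E = 0.

(* The laws E n (finitely supported, given as expectation functionals)
   converge in distribution and with second moments to mu. *)
Definition cvg_dist_L2 (E : nat -> (R * R -> R) -> R)
  (mu : probability (R * R)%type R) : Prop :=
  (forall f, bounded_continuous f ->
     (fun n => (E n f)%:E) @ \oo --> \int[mu]_x (f x)%:E) /\
  finite_second_moments mu /\
  (fun n => (E n (fun x => x.1 ^+ 2))%:E) @ \oo --> \int[mu]_x (x.1 ^+ 2)%:E /\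
  (fun n => (E n (fun x => x.2 ^+ 2))%:E) @ \oo --> \int[mu]_x (x.2 ^+ 2)%:E /\
  (fun n => (E n (fun x => x.1 * x.2))%:E) @ \oo --> \int[mu]_x (x.1 * x.2)%:E.

Definition Mleft (v : R) (x : R * R) : R * R :=
  ((1 - v) ^+ 2 * x.1 + v * (1 - v) * x.2, (1 - v) * x.2)%R.
Definition Mright (v : R) (x : R * R) : R * R :=
  (v ^+ 2 * x.1 + v * (1 - v) * x.2, v * x.2)%R.

(* mu is the law of  Mleft(V) X + Mright(V) Y + b(V), where X ~ mu1,
   Y ~ mu2, and V has density dens on (0,1), all independent.
   Equality in law is tested on bounded continuous functions. *)
Definition fixed_point_eq (dens : R -> R) (b : R -> R * R)
  (mu mu1 mu2 : probability (R * R)%type R) : Prop :=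
  forall f, bounded_continuous f ->
    \int[mu]_z (f z)%:E =
    \int[lebesgue_measure]_(v in `]0%R, 1%R[)
       ((dens v)%:E *
        \int[mu1]_x \int[mu2]_y
           (f (Mleft v x + Mright v y + b v)%R)%:E).

Definition entropyE (v : R) : R := (v * ln v + (1 - v) * ln (1 - v))%R.

Definition digamma (x : R) : R :=
  limn (fun n : nat => ln n%:R - \sum_(k < n.+1) (x + k%:R)^-1)%R.

Definition unif_dens (v : R) : R := 1%R.
Definition beta1_dens (theta : R) (v : R) : R := (theta * (1 - v) `^ (theta - 1))%R.

Definition b_rrt (u : R) : R * R :=
  (3 * u * (1 - u) + entropyE u, u + entropyE u)%R.
Definition b_hoppe (theta : R) (v : R) : R * R :=
  (((theta + 5) / (theta + 1) - (2 * theta + 4) / (theta + 1) * v) * v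
     + entropyE v + (digamma (theta + 1) - digamma 2) * v,
   v + entropyE v + (digamma (theta + 1) - digamma 2) * v)%R.

End Hoppe.

(* Main.v *)
Require Import Defs.
From HB Require Import structures.
From mathcomp Require Import all_boot all_order all_algebra.
From mathcomp Require Import all_classical all_reals all_analysis.
From mathcomp Require Import measurable_realfun ring lra zify.
Set Implicit Arguments. Unset Strict Implicit. Unset Printing Implicit Defensive.
Import Order.TTheory GRing.Theory Num.Theory.
Import numFieldNormedType.Exports.
Local Open Scope classical_set_scope.
Local Open Scope ring_scope.

(* Hanging the subtree of vertex 1 below the rest of the tree encodes a
   recursive tree as a binary tree, on which a growth step replaces a leaf by a
   pair of leaves.  With [s = theta + n - 1], the pair
   [(w + (theta - 1) t) / (s (s + 1)), t / s], where [w] and [t] are the centered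
   Wiener index and total length, is a martingale whose increments have
   variances of order [(log n / n)^2].  With all tree sizes realized on the unit
   interval it converges in mean square, which gives the limit law [mu], the
   second moments, and a rate uniform over Lipschitz test functions; for
   [theta = 1] this limit law is [nu].  The relative size [v] of the subtree of
   vertex 1 is a beta mixture of binomials, and given [v] the two parts of the
   tree are independent Hoppe and random recursive trees, so the fixed-point
   equation follows from Bernstein's law of large numbers.  It is affine, and
   [Mleft v] contracts the sup norm by [1 - v], whence uniqueness. *)

(** * Square-integrable random variables *)

Section probability_integral.
Context d (T : measurableType d) (R : realType) (P : probability T R).
Implicit Types (D : set T) (f g h : T -> R).

Lemma bounded_integrable D f (M : R) : measurable D -> measurable_fun D f ->
  (forall x, D x -> `|f x| <= M) -> P.-integrable D (EFin \o f).
Proof.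
move=> mD mf fM; apply: measurable_bounded_integrable => //.
  by rewrite (le_lt_trans (probability_le1 P mD)) ?ltry.
by exists M; split=> [|N MN x Dx]; [exact: num_real|exact: le_trans (fM x Dx) (ltW MN)].
Qed.

Lemma cst_integrable D (c : R) : measurable D ->
  P.-integrable D (EFin \o (fun=> c)).
Proof. by move=> mD; apply: (bounded_integrable (M := `|c|)). Qed.

Lemma integrable_EFinD D f g : measurable D ->
  P.-integrable D (EFin \o f) -> P.-integrable D (EFin \o g) ->
  P.-integrable D (EFin \o (fun x => f x + g x)).
Proof.
move=> mD intf intg; rewrite (_ : _ \o _ = (EFin \o f) \+ (EFin \o g))%E //.
exact: integrableD.
Qed.

Lemma integrable_EFinZ D (c : R) f : measurable D ->
  P.-integrable D (EFin \o f) -> P.-integrable D (EFin \o (fun x => c * f x)).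
Proof.
move=> mD intf; rewrite (_ : _ \o _ = (fun x => c%:E * (EFin \o f) x)%E) //.
exact: integrableZl.
Qed.

Lemma le_norm_RintegralB D f g h : measurable D ->
  P.-integrable D (EFin \o f) -> P.-integrable D (EFin \o g) ->
  P.-integrable D (EFin \o h) -> (forall x, D x -> `|f x - g x| <= h x) ->
  `|\int[P]_(x in D) f x - \int[P]_(x in D) g x| <= \int[P]_(x in D) h x.
Proof.
move=> mD intf intg inth fgh; rewrite -RintegralB //.
have intB := integrableB mD intf intg.
apply: (le_trans (le_normr_Rintegral mD intB)).
by apply: le_Rintegral => //; exact: integrable_norm.
Qed.

Lemma Rintegral_probability_cst (c : R) : \int[P]_x c = c.
Proof. by rewrite Rintegral_cst //= probability_setT mulr1. Qed.

Lemma norm_Rintegral_le f (M : R) : measurable_fun setT f ->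
  (forall x, `|f x| <= M) -> `|\int[P]_x f x| <= M.
Proof.
move=> mf fM; have intf : P.-integrable setT (EFin \o f).
  exact: bounded_integrable (fun x _ => fM x).
rewrite -[leRHS]Rintegral_probability_cst.
apply: (le_trans (le_normr_Rintegral measurableT intf)).
by apply: le_Rintegral; [|exact: integrable_norm|exact: cst_integrable|].
Qed.

Lemma EFin_Rintegral D f : measurable D -> P.-integrable D (EFin \o f) ->
  (\int[P]_(x in D) f x)%:E = (\int[P]_(x in D) (f x)%:E)%E.
Proof.
by move=> mD intf; rewrite /Rintegral fineK //; exact: integrable_fin_num.
Qed.

Lemma bounded_cvg_Rintegral D (f : nat -> T -> R) g (M : R) : measurable D ->
  (forall k, measurable_fun D (f k)) ->
  (forall k x, D x -> `|f k x| <= M) ->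
  (forall x, D x -> f ^~ x @ \oo --> g x) ->
  (fun k => \int[P]_(x in D) f k x) @ \oo --> \int[P]_(x in D) g x.
Proof.
move=> mD mf fM fg; apply: fine_cvg.
have mg : measurable_fun D g by exact: (measurable_fun_cvg mf).
have [] := @dominated_convergence _ T R P D mD
  (fun k x => (f k x)%:E) (fun x => (g x)%:E) (fun=> M%:E) _ _ _ _ _ => //.
- by move=> k; exact/measurable_EFinP.
- exact/measurable_EFinP.
- by apply: aeW => x Dx; apply: cvg_EFin; [exact: nearW|exact: fg].
- exact: cst_integrable.
- by apply: aeW => x k Dx; rewrite lee_fin fM.
- by move=> intg _; rewrite fineK //; exact: integrable_fin_num.
Qed.

End probability_integral.

Section L2norm.
Context d (T : measurableType d) (R : realType) (P : probability T R).
Implicit Types (f g : T -> R) (u v : nat -> T -> R).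
Local Notation L2 := (Lfun P 2%:E).

Lemma Lfun2P f : f \in L2 <->
  measurable_fun setT f /\ P.-integrable setT (EFin \o (fun x => f x ^+ 2)).
Proof.
split=> [f2|[mf /integrableP[_ f2]]].
  split; last exact: Lfun2_integrable_sqr.
  by move: f2 => /andP[/set_mem].
apply/andP; split; rewrite inE //= /finite_norm unlock poweR_lty //.
rewrite (le_lt_trans _ f2) // le_eqVlt; apply/predU1P; left.
by apply: eq_integral => x _; rewrite /= powR_mulrn // normrX.
Qed.

Lemma Lfun2_measurable f : f \in L2 -> measurable_fun setT f.
Proof. by move=> /Lfun2P[]. Qed.

Lemma Lfun2_cst (c : R) : (fun=> c) \in L2.
Proof. exact: Lfun_cst. Qed.

Lemma Lfun2D f g : f \in L2 -> g \in L2 -> (fun x => f x + g x) \in L2.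
Proof. by move=> f2 g2; rewrite -[X in X \in _]/(f \+ g) rpredD ?lee1n. Qed.

Lemma Lfun2B f g : f \in L2 -> g \in L2 -> (fun x => f x - g x) \in L2.
Proof. by move=> f2 g2; rewrite -[X in X \in _]/(f \- g) rpredB ?lee1n. Qed.

Lemma Lfun2Z (c : R) f : f \in L2 -> (fun x => c * f x) \in L2.
Proof. by move=> f2; rewrite -[X in X \in _]/(c \*o f) rpredZ ?lee1n. Qed.

Lemma Lfun2_norm f : f \in L2 -> (fun x => `|f x|) \in L2.
Proof.
move=> /Lfun2P[mf intf]; apply/Lfun2P; split; first exact: measurableT_comp.
by under [EFin \o _]eq_fun do rewrite /= -normrX ger0_norm ?sqr_ge0 //.
Qed.

Definition L2norm f : R := fine 'N[P]_2%:E[EFin \o f].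

Lemma EFin_L2norm f : f \in L2 -> (L2norm f)%:E = 'N[P]_2%:E[EFin \o f]%E.
Proof.
move=> /andP[_ /set_mem f2]; rewrite /L2norm fineK //.
by rewrite ge0_fin_numE ?Lnorm_ge0.
Qed.

Lemma L2norm_ge0 f : 0 <= L2norm f.
Proof. by rewrite fine_ge0 ?Lnorm_ge0. Qed.

Lemma L2norm_sqr f : f \in L2 -> L2norm f ^+ 2 = \int[P]_x f x ^+ 2.
Proof.
move=> f2; have [mf intf] := (Lfun2P f).1 f2.
apply: EFin_inj; rewrite EFin_Rintegral // -powR_mulrn ?L2norm_ge0 //.
rewrite -poweR_EFin EFin_L2norm // powR_Lnorm //.
by apply: eq_integral => x _; rewrite /= powR_mulrn // -normrX ger0_norm ?sqr_ge0.
Qed.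

Lemma L2normD f g : f \in L2 -> g \in L2 ->
  L2norm (fun x => f x + g x) <= L2norm f + L2norm g.
Proof.
move=> f2 g2; rewrite -lee_fin EFinD !EFin_L2norm ?Lfun2D //.
by apply: minkowski_EFin; [exact: Lfun2_measurable..|rewrite ler1n].
Qed.

Lemma L2normZ (c : R) f : f \in L2 ->
  L2norm (fun x => c * f x) = `|c| * L2norm f.
Proof.
move=> f2; apply: EFin_inj; rewrite EFinM !EFin_L2norm ?Lfun2Z //.
exact: (LnormZ (Lfun_Sub (lee1n 2) f2) c).
Qed.

Lemma L2norm_distrC f g : L2norm (fun x => f x - g x) = L2norm (fun x => g x - f x).
Proof.
by congr fine; rewrite -oppe_Lnorm; apply: eq_Lnorm => x /=; rewrite opprB.
Qed.

Lemma Rintegral_norm_mul_le f g : f \in L2 -> g \in L2 ->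
  \int[P]_x `|f x * g x| <= L2norm f * L2norm g.
Proof.
move=> f2 g2; have [mf mg] := (Lfun2_measurable f2, Lfun2_measurable g2).
have /Lfun1_integrable/integrable_norm fg1 := Lfun2_mul_Lfun1 f2 g2.
rewrite -lee_fin EFinM !EFin_L2norm // EFin_Rintegral //.
have := @hoelder _ _ _ P f g 2 2 mf mg; rewrite Lnorm1; apply=> //.
by rewrite [RHS]splitr !div1r.
Qed.

Lemma Lfun2M_integrable f g : f \in L2 -> g \in L2 ->
  P.-integrable setT (EFin \o (fun x => f x * g x)).
Proof. by move=> f2 g2; apply/Lfun1_integrable; exact: Lfun2_mul_Lfun1. Qed.

Lemma Lfun2_integrable f : f \in L2 -> P.-integrable setT (EFin \o f).
Proof.
move=> f2; apply/Lfun1_integrable; apply: Lfun_subset12 f2.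
by rewrite fin_num_measure.
Qed.

Lemma norm_RintegralM_le f g : f \in L2 -> g \in L2 ->
  `|\int[P]_x (f x * g x)| <= L2norm f * L2norm g.
Proof.
move=> f2 g2; apply: le_trans (Rintegral_norm_mul_le f2 g2).
exact: le_normr_Rintegral (Lfun2M_integrable f2 g2).
Qed.

Lemma Rintegral_norm_le f : f \in L2 -> \int[P]_x `|f x| <= L2norm f.
Proof.
move=> f2; have := Rintegral_norm_mul_le f2 (Lfun2_cst 1).
under eq_Rintegral do rewrite mulr1.
have -> : L2norm (fun=> 1) = 1.
  rewrite /L2norm (Lnorm_cst1 P) -[RHS]/(fine 1) -(poweR1r 2^-1).
  by congr (fine (_ `^ _)); exact: probability_setT.
by rewrite mulr1.
Qed.

Definition L2cvg u f : Prop := (fun n => L2norm (fun x => u n x - f x)) @ \oo --> 0.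

Lemma L2cvgZ u f (a : nat -> R) (c : R) : (forall n, u n \in L2) -> f \in L2 ->
  L2cvg u f -> a @ \oo --> c -> L2cvg (fun n x => a n * u n x) (fun x => c * f x).
Proof.
move=> u2 f2 uf ac.
apply: (@squeeze_cvgr _ _ _ _ (cst 0) (fun n =>
  `|a n| * L2norm (fun x => u n x - f x) + `|a n - c| * L2norm f)).
- apply: nearW => n; rewrite L2norm_ge0 -!L2normZ ?Lfun2B //.
  rewrite (_ : (fun x => _) = (fun x => a n * (u n x - f x) + (a n - c) * f x)).
    by apply: L2normD; rewrite Lfun2Z ?Lfun2B.
  by apply/funext => x; ring.
- exact: cvg_cst.
- rewrite -[0](_ : `|c| * 0 + `|c - c| * L2norm f = 0); last first.
    by rewrite subrr normr0 mulr0 mul0r addr0.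
  apply: cvgD; apply: cvgM => //; first exact: cvg_norm.
    by apply: cvg_norm; apply: cvgB => //; exact: cvg_cst.
  exact: cvg_cst.
Qed.

Lemma L2cvgD u v f g :
  (forall n, u n \in L2) -> f \in L2 -> (forall n, v n \in L2) -> g \in L2 ->
  L2cvg u f -> L2cvg v g ->
  L2cvg (fun n x => u n x + v n x) (fun x => f x + g x).
Proof.
move=> u2 f2 v2 g2 uf vg.
apply: (@squeeze_cvgr _ _ _ _ (cst 0) (fun n =>
  L2norm (fun x => u n x - f x) + L2norm (fun x => v n x - g x))).
- apply: nearW => n; rewrite L2norm_ge0 /=.
  rewrite (_ : (fun x => _) = (fun x => (u n x - f x) + (v n x - g x))).
    by apply: L2normD; exact: Lfun2B.
  by apply/funext => x; ring.
- exact: cvg_cst.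
- by rewrite -[0](addr0 0); exact: cvgD.
Qed.

Lemma L2cvg_Rintegral u f : (forall n, u n \in L2) -> f \in L2 -> L2cvg u f ->
  (fun n => \int[P]_x u n x) @ \oo --> \int[P]_x f x.
Proof.
move=> u2 f2 uf; apply/subr_cvg0/norm_cvg0P.
apply: (@squeeze_cvgr _ _ _ _ (cst 0) (fun n => L2norm (fun x => u n x - f x))) => //.
  apply: nearW => n; rewrite normr_ge0 -RintegralB ?Lfun2_integrable //=.
  have uf2 := Lfun2B (u2 n) f2; apply: le_trans (Rintegral_norm_le uf2).
  exact: le_normr_Rintegral (Lfun2_integrable uf2).
exact: cvg_cst.
Qed.

Lemma L2cvg_RintegralM u v f g :
  (forall n, u n \in L2) -> f \in L2 -> (forall n, v n \in L2) -> g \in L2 ->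
  L2cvg u f -> L2cvg v g ->
  (fun n => \int[P]_x (u n x * v n x)) @ \oo --> \int[P]_x (f x * g x).
Proof.
move=> u2 f2 v2 g2 uf vg; apply/subr_cvg0/norm_cvg0P.
apply: (@squeeze_cvgr _ _ _ _ (cst 0) (fun n =>
  L2norm (fun x => u n x - f x) * (L2norm (fun x => v n x - g x) + L2norm g)
  + L2norm f * L2norm (fun x => v n x - g x))).
- apply: nearW => n; rewrite normr_ge0 /=.
  have uf2 := Lfun2B (u2 n) f2; have vg2 := Lfun2B (v2 n) g2.
  rewrite -RintegralB ?Lfun2M_integrable //.
  rewrite (_ : \int[P]_x _ = \int[P]_x ((u n x - f x) * v n x)
      + \int[P]_x (f x * (v n x - g x))); last first.
    rewrite -RintegralD ?Lfun2M_integrable //.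
    by apply: eq_Rintegral => x _; ring.
  apply: (le_trans (ler_normD _ _)); apply: lerD; last exact: norm_RintegralM_le.
  apply: (le_trans (norm_RintegralM_le uf2 (v2 n))).
  rewrite ler_wpM2l ?L2norm_ge0 //.
  rewrite [X in L2norm X <= _](_ : _ = (fun x => (v n x - g x) + g x)).
    exact: L2normD.
  by apply/funext => x; rewrite subrK.
- exact: cvg_cst.
- rewrite -[0](_ : 0 * (0 + L2norm g) + L2norm f * 0 = 0); last by ring.
  apply: cvgD; apply: cvgM => //; last exact: cvg_cst.
  by apply: cvgD => //; exact: cvg_cst.
Qed.

End L2norm.

Section L2_complete.
Context d (T : measurableType d) (R : realType) (P : probability T R).
Implicit Types (g : T -> R) (u : nat -> T -> R).
Local Notation L2 := (Lfun P 2%:E).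

Lemma ae_cvgn_summable_increments u : (forall k, measurable_fun setT (u k)) ->
  (\sum_(0 <= k <oo) \int[P]_x `|u k.+1 x - u k x|%:E < +oo)%E ->
  {ae P, forall x, cvgn (u ^~ x)}.
Proof.
move=> mu; pose D k x := u k.+1 x - u k x.
have mD k : measurable_fun setT (fun x => `|D k x|%:E).
  by apply/measurable_EFinP/measurableT_comp => //; exact: measurable_funB.
pose S x : \bar R := (\sum_(0 <= k <oo) `|D k x|%:E)%E.
rewrite -integral_nneseries // => intS.
have : P.-integrable setT S.
  apply/integrableP; split; first exact: ge0_emeasurable_sum.
  by under eq_integral do rewrite gee0_abs ?nneseries_ge0 //.
move=> /(integrable_ae measurableT); apply: filterS => x /(_ I) S_fin.
have series_cvg : cvgn [normed series (D ^~ x)].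
  apply: nondecreasing_is_cvgn.
    by apply/nondecreasing_seqP => n; rewrite /normed_series_of seriesSr lerDl /=.
  exists (fine (S x)) => _ [n _ <-]; rewrite -lee_fin fineK //.
  by rewrite /normed_series_of /series /= -sumEFin; exact: nneseries_lim_ge.
have uE : u ^~ x = (fun k => u 0%N x + series (D ^~ x) k).
  by apply/funext => k; rewrite /series /= telescope_sumr // addrC subrK.
by rewrite uE; apply: is_cvgD (normed_cvg series_cvg); exact: is_cvg_cst.
Qed.

Lemma ae_cvgn_measurable_lim u : (forall k, measurable_fun setT (u k)) ->
  {ae P, forall x, cvgn (u ^~ x)} ->
  exists2 g : T -> R, measurable_fun setT g & {ae P, forall x, u ^~ x @ \oo --> g x}.
Proof.
move=> mu u_cvg; exists (fun x => fine (limn_esup (fun k => (u k x)%:E))).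
  apply: (@measurableT_comp _ _ _ _ _ _ (@fine R)) => //.
  by apply: measurable_fun_limn_esup => k; exact/measurable_EFinP.
apply: filterS u_cvg => x /cvg_ex[l ul].
have ulE : (fun k => (u k x)%:E) @ \oo --> l%:E.
  by apply: cvg_EFin => //; exact: nearW.
by rewrite (cvg_limn_einf_sup ulE).2.
Qed.

Lemma fatou_L2norm u g (c : R) : (forall k, u k \in L2) -> measurable_fun setT g ->
  {ae P, forall x, u ^~ x @ \oo --> g x} -> (forall k, L2norm P (u k) <= c) ->
  g \in L2 /\ L2norm P g <= c.
Proof.
move=> u2 mg ug uc; have c0 : 0 <= c := le_trans (L2norm_ge0 P (u 0%N)) (uc 0%N).
pose usqr k x : \bar R := (u k x ^+ 2)%:E.
have mu k : measurable_fun setT (usqr k).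
  by apply/measurable_EFinP/measurable_funX; exact: Lfun2_measurable (u2 k).
have usqr_ge0 k x : setT x -> (0 <= usqr k x)%E by move=> _; rewrite lee_fin sqr_ge0.
have g2_le : (\int[P]_x (g x ^+ 2)%:E <= (c ^+ 2)%:E)%E.
  apply: (@le_trans _ _ (\int[P]_x limn_einf (usqr ^~ x))%E).
    apply: ae_ge0_le_integral => //.
    - by move=> x _; rewrite lee_fin sqr_ge0.
    - exact/measurable_EFinP/measurable_funX.
    - move=> x _; rewrite limn_einf_lim; apply: lime_ge; first exact: is_cvg_einfs.
      by apply: nearW => k; apply: le_ereal_inf_tmp => _ [j _ <-]; exact: usqr_ge0.
    - rewrite /limn_einf; apply: measurableT_comp => //.
      by apply: measurable_fun_limn_esup => k; exact: measurableT_comp.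
    apply: filterS ug => x ux _.
    suff /cvg_limn_einf_sup[-> _] : usqr ^~ x @ \oo --> (g x ^+ 2)%:E by [].
    apply: cvg_EFin; first exact: nearW.
    by apply: (cvg_comp _ (fun y : R => y ^+ 2) ux); exact: exprn_continuous.
  apply: (le_trans (fatou _ measurableT mu usqr_ge0)).
  rewrite limn_einf_lim; apply: lime_le; first exact: is_cvg_einfs.
  apply: nearW => k; apply: ge_ereal_inf; exists (\int[P]_x usqr k x)%E.
    by exists k => /=.
  have [_ u2int] := (Lfun2P P (u k)).1 (u2 k).
  rewrite -(EFin_Rintegral measurableT u2int) -L2norm_sqr // lee_fin.
  by rewrite lerXn2r ?nnegrE ?L2norm_ge0.
have g2 : g \in L2.
  apply/Lfun2P; split=> //; apply/integrableP; split.
    exact/measurable_EFinP/measurable_funX.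
  under eq_integral do rewrite gee0_abs ?lee_fin ?sqr_ge0 //.
  exact: le_lt_trans g2_le (ltry _).
split=> //; have [_ g2int] := (Lfun2P P g).1 g2.
rewrite -(@ler_pXn2r _ 2) ?nnegrE ?L2norm_ge0 // L2norm_sqr //.
by rewrite -lee_fin EFin_Rintegral.
Qed.

Lemma L2_cauchy_rapid_subseq u :
  (forall e : R, 0 < e -> exists N, forall m n, (N <= m)%N -> (N <= n)%N ->
     L2norm P (fun x => u m x - u n x) <= e) ->
  exists2 phi : nat -> nat, (forall k, (k <= phi k)%N) &
    forall k, L2norm P (fun x => u (phi k.+1) x - u (phi k) x) <= 2^-1 ^+ k.
Proof.
move=> u_cauchy; have /choice[N uN] : forall k : nat, exists N, forall m n,
    (N <= m)%N -> (N <= n)%N -> L2norm P (fun x => u m x - u n x) <= 2^-1 ^+ k.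
  by move=> k; apply: u_cauchy; rewrite exprn_gt0.
pose phi k := (k + \sum_(i < k.+1) N i)%N.
have N_phi k : (N k <= phi k)%N by rewrite /phi big_ord_recr /= addnA leq_addl.
have phiS k : (phi k <= phi k.+1)%N.
  by rewrite /phi leq_add // [leqRHS]big_ord_recr /= leq_addr.
exists phi => k; first exact: leq_addr.
by apply: uN => //; exact: leq_trans (N_phi k) (phiS k).
Qed.

Theorem L2_complete u : (forall n, u n \in L2) ->
  (forall e : R, 0 < e -> exists N, forall m n, (N <= m)%N -> (N <= n)%N ->
     L2norm P (fun x => u m x - u n x) <= e) ->
  exists2 g, g \in L2 & L2cvg P u g.
Proof.
move=> u2 u_cauchy; have [phi phi_ge u_phi] := L2_cauchy_rapid_subseq u_cauchy.
have mu n : measurable_fun setT (u n) := Lfun2_measurable (u2 n).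
have summable :
    (\sum_(0 <= k <oo) \int[P]_x `|u (phi k.+1) x - u (phi k) x|%:E < +oo)%E.
  apply: (@le_lt_trans _ _ (\sum_(0 <= k <oo) (2^-1 ^+ k)%:E)%E).
    apply: lee_nneseries => [k _ _|k _]; first by apply: integral_ge0.
    have D2 := Lfun2B (u2 (phi k.+1)) (u2 (phi k)).
    rewrite -EFin_Rintegral //; last exact/integrable_norm/Lfun2_integrable.
    by rewrite lee_fin (le_trans (Rintegral_norm_le D2)).
  apply: (@le_lt_trans _ _ 2%:E); last exact: ltry.
  apply: lime_le; first by apply: is_cvg_nneseries => k _ _; rewrite lee_fin exprn_ge0.
  apply: nearW => n; rewrite sumEFin lee_fin.
  have := @geometric_le_lim R n 1 2^-1 ler01.
  rewrite /series /=; under eq_bigr do rewrite mul1r.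
  rewrite mul1r (_ : (1 - 2^-1)^-1 = 2); last by field.
  by apply; rewrite ?invr_gt0 // ger0_norm ?invr_ge0 // invf_lt1 // ltr1n.
have [g mg ug] := ae_cvgn_measurable_lim (fun k => mu (phi k))
  (ae_cvgn_summable_increments (fun k => mu (phi k)) summable).
have tail_le (e : R) : 0 < e -> exists N, forall n, (N <= n)%N ->
    (fun x => u n x - g x) \in L2 /\ L2norm P (fun x => u n x - g x) <= e.
  move=> e0; have [N uN] := u_cauchy e e0; exists N => n Nn.
  apply: (fatou_L2norm (u := fun k x => u n x - u (phi (k + N)%N) x)).
  - by move=> k; exact: Lfun2B.
  - exact: measurable_funB.
  - apply: filterS ug => x ux; apply: cvgB; first exact: cvg_cst.
    by rewrite (cvg_shiftn N (fun k => u (phi k) x)).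
  - by move=> k; apply: uN => //; exact: leq_trans (leq_addl _ _) (phi_ge _).
have [N /(_ N (leqnn N))[gN _]] := tail_le 1 ltr01.
exists g.
  rewrite (_ : g = fun x => u N x - (u N x - g x)); first exact: Lfun2B.
  by apply/funext => x; rewrite opprB addrC subrK.
apply/cvgrPdist_le => e e0; have [M uM] := tail_le e e0; near=> n.
rewrite sub0r normrN ger0_norm ?L2norm_ge0 //.
by apply: (uM n _).2; near: n; exact: nbhs_infty_ge.
Unshelve. all: by end_near. Qed.

End L2_complete.

(** * Bounded Lipschitz functions on the plane *)

Section borel_plane.
Variable R : realType.
Implicit Types (O : set (R * R)) (f : R * R -> R) (a c : R).

Lemma open_measurable_plane O : open O -> measurable O.
Proof.
move=> oO; pose box (i : rat * rat * nat) : set (R * R) :=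
  ball (ratr i.1.1 : R) i.2.+1%:R^-1 `*` ball (ratr i.1.2 : R) i.2.+1%:R^-1.
have -> : O = \bigcup_(i in [set i | box i `<=` O]) box i.
  apply/seteqP; split => [x Ox|x [i iO xi]]; last exact: iO.
  have /nbhs_ballP[e /= e0 xeO] : nbhs x O by exact: open_nbhs_nbhs.
  have [k _ /(_ k (leqnn k)) /= ke] :=
    near_infty_natSinv_lt (PosNum (divr_gt0 e0 (ltr0Sn R 1))).
  have near_rat (t : R) : exists q : rat, ball (ratr q : R) k.+1%:R^-1 t.
    have /rat_in_itvoo[q] : t - k.+1%:R^-1 < t + k.+1%:R^-1.
      by rewrite ltrD2l gtrN ?invr_gt0.
    by rewrite in_itv /= => tq; exists q; rewrite /ball /= ltr_distl.
  have [[q1 xq1] [q2 xq2]] := (near_rat x.1, near_rat x.2).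
  exists (q1, q2, k); last by split.
  have close (q t s : R) : ball q k.+1%:R^-1 t -> ball q k.+1%:R^-1 s -> ball t e s.
    move=> qt qs; apply: (@ball_split _ _ q); last exact: le_ball (ltW ke) _ qs.
    by apply: ball_sym; exact: le_ball (ltW ke) _ qt.
  move=> y [/= yq1 yq2]; apply: xeO.
  by split; [exact: close xq1 yq1|exact: close xq2 yq2].
rewrite bigcup_mkcond; apply: countable_bigcupT_measurable => [|i].
  exact: countableP.
by case: ifPn => // _; apply: measurableX; exact: measurable_ball.
Qed.

Lemma continuous_measurable_plane f : continuous f -> measurable_fun setT f.
Proof.
move=> /continuousP cf; apply: (measurability _ (RGenOpens.measurableE R)).
move=> _ [_ [a [b ->] <-]]; rewrite setTI; apply: open_measurable_plane.
exact/cf/interval_open.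
Qed.

Definition quadrant a c : set (R * R) := `]a, +oo[ `*` `]c, +oo[.

Lemma bigcup_rays : \bigcup_k `]- k%:R, +oo[%classic = setT :> set R.
Proof.
apply/seteqP; split=> // x _; exists (Num.truncn `|x|).+1 => //=.
rewrite in_itv /= andbT ltrNl (le_lt_trans _ (truncnS_gt _)) //.
by rewrite -normrN ler_norm.
Qed.

Lemma measurable_quadrants :
  @measurable _ (R * R)%type = <<s [set A | exists a c, A = quadrant a c] >>.
Proof.
set quadrants := [set A | _]; apply/seteqP; split; last first.
  apply: smallest_sub; first exact: sigma_algebra_measurable.
  by move=> _ [a [c ->]]; exact: measurableX.
rewrite measurable_prod_measurableType; apply: smallest_sub.
  exact: smallest_sigma_algebra.
pose T := g_sigma_algebraType quadrants.
have measurable_union (F : nat -> set (R * R)) :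
    (forall k, quadrants (F k)) -> @measurable _ T (\bigcup_k F k).
  by move=> qF; apply: bigcupT_measurable => k; exact: sub_sigma_algebra.
have mfst : measurable_fun setT (fst : T -> R).
  apply: (measurability _ (RGenOInfty.measurableE R)).
  move=> _ [_ [a ->] <-]; rewrite setTI -setXT -bigcup_rays setX_bigcupr.
  by apply: measurable_union => k; exists a, (- k%:R).
have msnd : measurable_fun setT (snd : T -> R).
  apply: (measurability _ (RGenOInfty.measurableE R)).
  move=> _ [_ [a ->] <-]; rewrite setTI -setTX -bigcup_rays setX_bigcupl.
  by apply: measurable_union => k; exists (- k%:R), a.
move=> _ [A mA [B mB <-]].
rewrite [_ `*` _](_ : _ = (setT `&` fst @^-1` A) `&` (setT `&` snd @^-1` B) :> set T).
  by apply: (@measurableI _ T); [exact: mfst|exact: msnd].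
by rewrite !setTI.
Qed.

Lemma eq_probability_quadrants (P Q : probability (R * R)%type R) :
  (forall a c, P (quadrant a c) = Q (quadrant a c)) ->
  forall A, measurable A -> P A = Q A.
Proof.
move=> PQ A mA; apply: (measure_unique [set A | exists a c, A = quadrant a c]
   (fun k => quadrant (- k%:R) (- k%:R))) => //.
- exact: measurable_quadrants.
- move=> _ _ [a [c ->]] [a' [c' ->]]; exists (Num.max a a'), (Num.max c c').
  rewrite /quadrant -setXI; congr (_ `*` _);
    by apply/seteqP; split => x /=; rewrite !in_itv /= !andbT gt_max => /andP.
- by move=> k; exists (- k%:R), (- k%:R).
- have above (t : R) : exists k : nat, - k%:R < t.
    have : [set: R] t by []; rewrite -bigcup_rays => -[k _ /=].
    by rewrite in_itv /= andbT => kt; exists k.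
  apply/seteqP; split=> // -[x y] _; have [[k kx] [l ly]] := (above x, above y).
  exists (maxn k l) => //; split; rewrite /= in_itv /= andbT.
    by rewrite (le_lt_trans _ kx) // lerN2 ler_nat leq_maxl.
  by rewrite (le_lt_trans _ ly) // lerN2 ler_nat leq_maxr.
- by move=> _ [a [c ->]]; exact: PQ.
- move=> k; rewrite (le_lt_trans (probability_le1 _ _)) ?ltry //.
  exact: measurableX.
Qed.

End borel_plane.

Section lipschitz.
Variables (R : realType) (V : normedModType R).
Implicit Types (h : V -> R) (L : R).

Lemma lipschitzP L h :
  L.-lipschitz h <-> forall x y, `|h x - h y| <= L * `|x - y|.
Proof. by split=> [hL x y|hL [x y] _]; [exact: (hL (x, y))|exact: hL]. Qed.

Lemma lipschitz_le L L' h : L <= L' -> L.-lipschitz h -> L'.-lipschitz h.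
Proof.
move=> LL' /lipschitzP hL; apply/lipschitzP => x y.
by rewrite (le_trans (hL x y)) // ler_wpM2r.
Qed.

Lemma lipschitz_continuous L h : L.-lipschitz h -> continuous h.
Proof.
move=> /lipschitzP hL x; apply/cvgrPdist_le => e e0.
have /cvgrPdist_le/(_ e e0) : (fun y => L * `|x - y|) y @[y --> x] --> (0 : R).
  rewrite -[X in _ --> X](_ : L * `|x - x| = 0); last by rewrite subrr normr0 mulr0.
  apply: cvgM; first exact: cvg_cst.
  by apply: cvg_norm; apply: cvgB; [exact: cvg_cst|exact: cvg_id].
apply: filterS => y; rewrite sub0r normrN => Le.
by apply: (le_trans (hL x y)); apply: le_trans Le; exact: ler_norm.
Qed.

End lipschitz.

(* The Pasch-Hausdorff envelope: the largest [k]-Lipschitz minorant of [f]. *)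
Definition lipschitz_envelope (R : realType) (V : normedModType R) (f : V -> R)
  (k : nat) (x : V) : R := inf [set f y + k%:R * `|x - y| | y in setT].

Section lipschitz_envelope.
Variables (R : realType) (V : normedModType R) (f : V -> R) (M : R).
Hypothesis f_bounded : forall x, `|f x| <= M.
Local Notation envelope := (lipschitz_envelope f).

Let envelope_lbound k x : lbound [set f y + k%:R * `|x - y| | y in setT] (- M).
Proof.
move=> _ [y _ <-]; have := f_bounded y; rewrite ler_norml => /andP[fy _].
by rewrite (le_trans fy) // lerDl mulr_ge0.
Qed.

Lemma envelope_le_at k x y : envelope k x <= f y + k%:R * `|x - y|.
Proof. by apply: ge_inf; [exists (- M); exact: envelope_lbound|exists y]. Qed.

Lemma le_envelope k x (c : R) : (forall y, c <= f y + k%:R * `|x - y|) ->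
  c <= envelope k x.
Proof.
move=> c_le; apply: lb_le_inf; first by exists (f x + k%:R * `|x - x|), x.
by move=> _ [y _ <-].
Qed.

Lemma envelope_le k x : envelope k x <= f x.
Proof. by have := envelope_le_at k x x; rewrite subrr normr0 mulr0 addr0. Qed.

Lemma envelope_bounded k x : `|envelope k x| <= M.
Proof.
rewrite ler_norml; apply/andP; split.
  by apply: le_envelope => y; apply: (envelope_lbound (k := k) (x := x)); exists y.
exact: le_trans (envelope_le k x) (le_trans (ler_norm _) (f_bounded x)).
Qed.

Lemma envelope_lipschitz k : k%:R.-lipschitz (envelope k).
Proof.
have envelope_diff x y : envelope k x - envelope k y <= k%:R * `|x - y|.
  rewrite lerBlDr -lerBlDl; apply: le_envelope => z.
  rewrite lerBlDl (le_trans (envelope_le_at k x z)) // addrCA lerD2l -mulrDr.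
  by rewrite ler_wpM2l // ler_distD.
apply/lipschitzP => x y; rewrite ler_norml envelope_diff andbT lerNl opprB.
by rewrite distrC envelope_diff.
Qed.

Lemma cvg_envelope : lower_semicontinuous (EFin \o f) ->
  forall x, envelope ^~ x @ \oo --> f x.
Proof.
move=> lsc_f x; apply/cvgrPdist_le => e e0.
have [|U /nbhs_ballP[eta /= eta0 xU] f_near] := lsc_f x (f x - e).
  by rewrite lte_fin gtrBl.
near=> k.
rewrite ger0_norm ?subr_ge0 ?envelope_le // lerBlDr addrC -lerBlDr.
apply: le_envelope => y; have [y_near|y_far] := ltP `|x - y| eta.
  have /xU/f_near : ball x eta y by rewrite -ball_normE.
  by rewrite lte_fin => /ltW/le_trans; apply; rewrite lerDl mulr_ge0.
have kM : 2 * M <= k%:R * `|x - y|.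
  apply: (@le_trans _ _ (k%:R * eta)); last by rewrite ler_wpM2l.
  by rewrite -ler_pdivrMr //; near: k; exact: nbhs_infty_ger.
have := f_bounded x; have := f_bounded y; rewrite !ler_norml; lra.
Unshelve. all: by end_near. Qed.

End lipschitz_envelope.

Lemma continuous_lower_semicontinuous (R : realType) (V : topologicalType)
  (f : V -> R) : continuous f -> lower_semicontinuous (EFin \o f).
Proof.
move=> cf; apply/lower_semicontinuousP => a.
rewrite (_ : [set x | _] = f @^-1` `]a, +oo[).
  by apply: open_comp => [x _|]; [exact: cf|exact: interval_open].
by apply/funext => x; rewrite /= in_itv /= andbT lte_fin.
Qed.

Lemma indic_lower_semicontinuous (R : realType) (V : topologicalType)
  (O : set V) : open O -> lower_semicontinuous (EFin \o (\1_O : V -> R)).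
Proof.
move=> oO x a; rewrite /= lte_fin indicE.
have [xO aO|xO aO] := boolP (x \in O); last first.
  exists setT; first exact: filterT.
  by move=> y _; rewrite /= lte_fin (lt_le_trans aO) // indicE (negbTE xO) ler0n.
exists O; first by apply: open_nbhs_nbhs; split=> //; rewrite inE in xO.
by move=> y Oy; rewrite /= lte_fin indicE mem_set.
Qed.

Section bounded_lipschitz.
Variable R : realType.
Implicit Types (f h : R * R -> R) (L M : R) (P Q : probability (R * R)%type R).

Definition bounded_lipschitz L f : Prop :=
  L.-lipschitz f /\ exists M, forall x, `|f x| <= M.

Lemma bounded_lipschitzW L f : bounded_lipschitz L f -> bounded_continuous f.
Proof. by move=> [fL fM]; split=> //; exact: lipschitz_continuous fL. Qed.

Lemma bounded_continuous_integrable P f : bounded_continuous f ->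
  P.-integrable setT (EFin \o f).
Proof.
move=> [cf [M fM]]; apply: (@bounded_integrable _ _ _ P setT f M) => //.
exact: continuous_measurable_plane.
Qed.

Lemma lipschitz_ge0 L h : L.-lipschitz h -> 0 <= L.
Proof.
move=> /lipschitzP/(_ (1, 1) (0, 0)); rewrite prod_normE /= !subr0 normr1 maxxx mulr1.
exact: le_trans.
Qed.

Lemma lipschitz_measurable L f : L.-lipschitz f -> measurable_fun setT f.
Proof. by move=> /lipschitz_continuous; exact: continuous_measurable_plane. Qed.

Lemma envelope_bounded_lipschitz f M k : (forall x, `|f x| <= M) ->
  bounded_lipschitz k%:R (lipschitz_envelope f k).
Proof.
move=> fM; split; first exact: envelope_lipschitz fM k.
by exists M => x; exact: envelope_bounded.
Qed.

Lemma cvg_Rintegral_envelope P f M : (forall x, `|f x| <= M) ->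
  lower_semicontinuous (EFin \o f) ->
  (fun k => \int[P]_x lipschitz_envelope f k x) @ \oo --> \int[P]_x f x.
Proof.
move=> fM lsc_f; apply: (@bounded_cvg_Rintegral _ _ _ P setT _ f M) => //.
- by move=> k; apply: lipschitz_measurable; exact: envelope_lipschitz fM k.
- by move=> k x _; exact: envelope_bounded.
- by move=> x _; exact: cvg_envelope fM lsc_f x.
Qed.

Lemma eq_probability_lipschitz P Q :
  (forall L h, bounded_lipschitz L h -> \int[P]_x h x = \int[Q]_x h x) ->
  forall A, measurable A -> P A = Q A.
Proof.
move=> PQ; apply: eq_probability_quadrants => a c.
set O := quadrant a c; have mO : measurable O by exact: measurableX.
have oO : open O.
  rewrite (_ : O = fst @^-1` `]a, +oo[ `&` snd @^-1` `]c, +oo[) //.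
  by apply: openI; apply: open_comp; rewrite ?interval_open // => x _;
    [exact: cvg_fst|exact: cvg_snd].
have indic_le1 (x : R * R) : `|\1_O x| <= 1 :> R.
  by rewrite indicE; case: (_ \in _); rewrite ?normr1 ?normr0.
have lsc_O := @indic_lower_semicontinuous R _ O oO.
have PQ_envelope k : \int[P]_x lipschitz_envelope \1_O k x
    = \int[Q]_x lipschitz_envelope \1_O k x.
  exact: PQ (envelope_bounded_lipschitz k indic_le1).
have := cvg_Rintegral_envelope (P := P) indic_le1 lsc_O.
rewrite (funext PQ_envelope) => cvgP.
have cvgQ := cvg_Rintegral_envelope (P := Q) indic_le1 lsc_O.
have PQ_indic : \int[P]_x \1_O x = \int[Q]_x \1_O x :> R.
  exact: cvg_unique cvgP cvgQ.
have RintegralE P' : (\int[P']_x \1_O x)%:E = P' O.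
  rewrite EFin_Rintegral //; first by rewrite integral_indic ?setIT.
  exact: (@bounded_integrable _ _ _ P' setT _ 1).
by rewrite -!RintegralE PQ_indic.
Qed.

Lemma portmanteau P (E : nat -> (R * R -> R) -> R) :
  (forall n f g, (forall x, f x <= g x) -> E n f <= E n g) ->
  (forall n f, E n (fun x => - f x) = - E n f) ->
  (forall L h, bounded_lipschitz L h -> E ^~ h @ \oo --> \int[P]_x h x) ->
  forall f, bounded_continuous f -> E ^~ f @ \oo --> \int[P]_x f x.
Proof.
move=> E_mono E_opp E_lip.
have liminf_ge f (e : R) : bounded_continuous f -> 0 < e ->
    \forall n \near \oo, \int[P]_x f x - e <= E n f.
  move=> [cf [M fM]] e0; have e20 : 0 < e / 2 by rewrite divr_gt0.
  have lsc_f := continuous_lower_semicontinuous cf.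
  have /cvgrPdist_le/(_ _ e20)[k _ /(_ k (leqnn k)) f_envelope] :=
    cvg_Rintegral_envelope (P := P) fM lsc_f.
  have /cvgrPdist_le/(_ _ e20) := E_lip _ _ (envelope_bounded_lipschitz k fM).
  apply: filterS => n; have := E_mono n _ _ (envelope_le fM k).
  by move: f_envelope; rewrite /= !ler_distl; lra.
move=> f bcf; have [cf [M fM]] := bcf; apply/cvgrPdist_le => e e0.
have bcNf : bounded_continuous (fun x => - f x).
  by split=> [x|]; [apply: cvgN; exact: cf|exists M => x; rewrite normrN].
apply: filterS2 (liminf_ge _ _ bcf e0) (liminf_ge _ _ bcNf e0) => n.
have -> : \int[P]_x (- f x) = - \int[P]_x f x.
  rewrite -mulN1r -RintegralZl //; last exact: bounded_continuous_integrable.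
  by under [RHS]eq_Rintegral do rewrite mulN1r.
by rewrite E_opp ler_distl => Ef ENf; move: Ef ENf; lra.
Qed.

End bounded_lipschitz.

(** * Probability laws with a density *)

Section density.
Context d (T : measurableType d) (R : realType).
Variables (m : {sigma_finite_measure set T -> \bar R}) (w : T -> R).

Definition density_prob of measurable_fun setT w & (forall x, 0 <= w x) &
    (\int[m]_x (w x)%:E = 1)%E : set T -> \bar R :=
  fun A => (\int[m]_(x in A) (w x)%:E)%E.

Hypotheses (mw : measurable_fun setT w) (w_ge0 : forall x, 0 <= w x).
Hypothesis w1 : (\int[m]_x (w x)%:E = 1)%E.
Local Notation P := (density_prob mw w_ge0 w1).

Let density0 : P set0 = 0%E.
Proof. exact: integral_set0. Qed.

Let density_ge0 A : (0 <= P A)%E.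
Proof. by apply: integral_ge0 => x _; rewrite lee_fin. Qed.

Let density_sigma_additive : semi_sigma_additive P.
Proof.
move=> F mF tF mUF; rewrite /density_prob; apply: cvg_toP.
  apply: ereal_nondecreasing_is_cvgn => i j ij.
  by apply: lee_sum_nneg_natr => // k _ _; exact: density_ge0.
rewrite ge0_integral_bigcup //=; last by move=> x _; rewrite lee_fin.
exact/measurable_funTS/measurable_EFinP.
Qed.

HB.instance Definition _ := isMeasure.Build _ _ _ P
  density0 density_ge0 density_sigma_additive.

Let density_setT : P [set: T] = 1%E.
Proof. exact: w1. Qed.

HB.instance Definition _ := @Measure_isProbability.Build _ _ R P density_setT.

Lemma dominates_density_prob : P `<< m.
Proof.
apply/null_content_dominatesP => A mA mA0; apply: null_set_integral => //.
exact/measurable_funTS/measurable_EFinP.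
Qed.

Lemma integral_density_prob D (f : T -> \bar R) : measurable D ->
  P.-integrable D f ->
  (\int[P]_(x in D) f x = \int[m]_(x in D) (f x * (w x)%:E))%E.
Proof.
move=> mD intf; have P_dom := dominates_density_prob.
rewrite -(Radon_Nikodym_change_of_variables P_dom) //.
have mf := measurable_int _ intf.
have mwE : measurable_fun setT (EFin \o w) by exact/measurable_EFinP.
apply: ae_eq_integral => //.
- apply: emeasurable_funM => //; apply: (measurable_int m).
  apply: (integrableS _ _ (@subsetT _ D)) => //.
  by apply: Radon_Nikodym_integrable; exact: dominates_density_prob.
- by apply: emeasurable_funM => //; exact: measurable_funTS.
apply: ae_eqe_mul2l; rewrite Radon_NikodymE //.
case: cid => /= h [_ inth h_density].
apply: integral_ae_eq => //; first exact: integrableS inth.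
- exact: measurable_funTS.
- by move=> E ED mE; rewrite -h_density.
Qed.

End density.

(** * The beta law and Bernstein operators *)

Section improper_integral.
Variable R : realType.
Local Notation leb := (@lebesgue_measure R).

Lemma ge0_cvg_integral_itvco (f : R -> R) (a b : R) (r : nat -> R) :
  measurable_fun `[a, b[ f -> (forall x, a <= x < b -> 0 <= f x) ->
  {homo r : n k / (n <= k)%N >-> n <= k} -> (forall n, r n < b) ->
  r @ \oo --> b ->
  (fun n => \int[leb]_(x in `[a, r n]) (f x)%:E)%E @ \oo -->
  (\int[leb]_(x in `[a, b[) (f x)%:E)%E.
Proof.
move=> mf f_ge0 r_mono r_b cvg_r.
have cover : \bigcup_n `[a, r n]%classic = `[a, b[%classic :> set R.
  apply/seteqP; split => x /=.
    by move=> [n _] /=; rewrite !in_itv /= => /andP[-> /le_lt_trans]; apply.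
  rewrite in_itv /= => /andP[ax xb].
  have /cvgrPdist_le/(_ (b - x)) := cvg_r; rewrite subr_gt0 => /(_ xb)[n _].
  move=> /(_ n (leqnn n)) /= xr; exists n => //=; rewrite in_itv /= ax /=.
  by move: xr; rewrite ger0_norm ?lerD2l ?lerN2 // subr_ge0 ltW.
have itv_mono : nondecreasing_seq (fun n => `[a, r n]%classic : set R).
  apply/nondecreasing_seqP => n; rewrite subsetEset => x /=.
  by rewrite !in_itv /= => /andP[-> /le_trans] -> //; exact: r_mono.
have itv_sub n : `[a, r n] `<=` `[a, b[ by rewrite -cover => x xn; exists n.
have mfn n : measurable_fun `[a, r n] (EFin \o f).
  by apply/measurable_EFinP; exact: measurable_funS mf.
have fn_ge0 n x : `[a, r n]%classic x -> (0 <= (EFin \o f) x)%E.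
  by move=> /itv_sub /=; rewrite in_itv /= lee_fin; exact: f_ge0.
have := @ge0_nondecreasing_set_cvg_integral _ _ R _ _ lebesgue_measure itv_mono
  (fun=> measurable_itv _) mfn fn_ge0.
by rewrite cover.
Qed.

Lemma ge0_continuous_FTC2_itvco (f F : R -> R) (a b l : R) : a < b ->
  (forall x, a <= x < b -> 0 <= f x) ->
  (forall x, a <= x < b -> {for x, continuous f}) ->
  (forall x, a <= x < b -> is_derive x 1 F (f x)) ->
  F x @[x --> b^'-] --> l ->
  (\int[leb]_(x in `[a, b[) (f x)%:E = (l - F a)%:E)%E.
Proof.
move=> ab f_ge0 cf dF Fl; have ba0 : 0 < b - a by rewrite subr_gt0.
pose r n := b - (b - a) * n.+2%:R^-1.
have r_b n : r n < b by rewrite gtrBl mulr_gt0 ?invr_gt0.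
have a_r n : a < r n.
  by rewrite ltrBrDr -ltrBrDl gtr_pMr // invf_lt1 // ltr1n.
have cvg_r : r @ \oo --> b.
  rewrite -[X in _ --> X]subr0 -[X in _ --> _ - X](mulr0 (b - a)).
  apply: cvgB; first exact: cvg_cst.
  apply: cvgM; first exact: cvg_cst.
  by rewrite (cvg_shiftS (@harmonic R)); exact: cvg_harmonic.
have derF x : a <= x < b -> derivable F x 1 by move=> /dF dFx; exact: ex_derive.
have cF x : a <= x < b -> {for x, continuous F}.
  by move=> /derF dFx; apply/differentiable_continuous/derivable1_diffP.
have FTC n : (\int[leb]_(x in `[a, r n]) (f x)%:E)%E = (F (r n) - F a)%:E.
  have lt_b x : x <= r n -> x < b by move=> xr; exact: le_lt_trans xr (r_b n).
  rewrite (@continuous_FTC2 _ f F) //.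
  - apply: continuous_in_subspaceT => x; rewrite inE /= in_itv /= => /andP[ax xr].
    by apply: cf; rewrite ax lt_b.
  - split; last by apply/cvg_at_left_filter/cF; rewrite ltW //= r_b.
      move=> x; rewrite in_itv /= => /andP[ax xr].
      by apply: derF; rewrite (ltW ax) lt_b // ltW.
    by apply/cvg_at_right_filter/cF; rewrite lexx.
  - move=> x; rewrite in_itv /= => /andP[ax xr]; rewrite derive1E.
    by apply: derive_val; apply: dF; rewrite (ltW ax) lt_b // ltW.
have r_mono : {homo r : n k / (n <= k)%N >-> n <= k}.
  by move=> n k nk; rewrite lerB // ler_pM2l // lef_pV2 ?posrE // ler_nat.
have mf : measurable_fun `[a, b[ f.
  apply: subspace_continuous_measurable_fun => //.
  by apply: continuous_in_subspaceT => x; rewrite inE /= in_itv /=; exact: cf.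
have := ge0_cvg_integral_itvco mf f_ge0 r_mono r_b cvg_r; rewrite (funext FTC).
move=> /cvg_unique; apply=> //; apply: cvg_EFin; first exact: nearW.
by apply: cvgB; [apply: (cvg_at_leftP _ _ _).1 Fl _ _|exact: cvg_cst].
Qed.

Lemma is_derive_onem_powR (c v : R) : 0 < c -> v < 1 ->
  is_derive v 1 (fun x : R => - ((1 - x) `^ c) / c) ((1 - v) `^ (c - 1)).
Proof.
move=> c0 v1; have v0 : 1 - v \in `]0, +oo[ by rewrite in_itv /= andbT subr_gt0.
have d_powR : is_derive (1 - v) 1 (@powR R ^~ c) (c * (1 - v) `^ (c - 1)).
  apply: DeriveDef; first exact: derivable_powR.
  by rewrite -derive1E powR_derive1.
have d_onem : is_derive v 1 (fun x : R => 1 - x) (-1).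
  have := is_deriveB (is_derive_cst (1 : R) v 1) (is_derive_id v 1).
  by rewrite sub0r.
have -> : (1 - v) `^ (c - 1) = (- c^-1) *: (c * (1 - v) `^ (c - 1) * -1).
  by rewrite /GRing.scale /=; field; rewrite gt_eqF.
rewrite (_ : (fun x : R => _) = (- c^-1) \*: ((@powR R ^~ c) \o (fun x => 1 - x))).
  by apply: is_deriveZ; exact: is_derive1_comp.
by apply/funext => x; rewrite /= mulNr mulrC -mulNr.
Qed.

Lemma integral_onem_powR (c : R) : 0 < c ->
  (\int[leb]_(v in `]0%R, 1%R[) ((1 - v) `^ (c - 1))%:E = (c^-1)%:E)%E.
Proof.
move=> c0; rewrite integral_itv_obnd_cbnd; last first.
  apply: measurable_funTS; apply/measurable_EFinP.
  by apply: (measurableT_comp (measurable_powR _)); exact: measurable_funB.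
pose F (x : R) := - ((1 - x) `^ c) / c.
have dF (x : R) : 0 <= x < 1 -> is_derive x 1 F ((1 - x) `^ (c - 1)).
  by move=> /andP[_ x1]; exact: is_derive_onem_powR.
have cf (x : R) : 0 <= x < 1 -> {for x, continuous (fun v : R => (1 - v) `^ (c - 1))}.
  move=> /andP[_ x1].
  apply: (@continuous_comp _ _ _ (fun y : R => 1 - y) (@powR R ^~ (c - 1))).
    by apply: cvgB; [exact: cvg_cst|exact: cvg_id].
  apply: differentiable_continuous; apply/derivable1_diffP.
  by apply: derivable_powR; rewrite in_itv /= andbT subr_gt0.
have F1 : F x @[x --> 1^'-] --> 0.
  rewrite -[X in _ --> X](_ : - 0 / c = 0); last by rewrite oppr0 mul0r.
  apply: cvgM; last exact: cvg_cst.
  apply: cvgN; apply/cvg_at_leftP => u [u1 cvg_u].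
  have /cvg_at_rightP := powR_cvg0 c0; apply; split=> [n|].
    by rewrite subr_gt0.
  by rewrite -[X in _ --> X](subrr 1); apply: cvgB => //; exact: cvg_cst.
rewrite (ge0_continuous_FTC2_itvco ltr01 (fun x _ => powR_ge0 _ _) cf dF F1).
by rewrite /F subr0 powR1 mulN1r sub0r opprK.
Qed.

End improper_integral.

Section beta1_law.
Variables (R : realType) (theta : R).
Hypothesis theta_gt0 : 0 < theta.
Local Notation leb := (@lebesgue_measure R).
Local Notation I01 := (`]0, 1[%classic : set R).
Local Notation w := (beta1_dens theta).

Let measurable_dens : measurable_fun setT (w \_ I01).
Proof.
apply/(measurable_restrict _ _ _) => //; rewrite setTI; apply: measurable_funTS.
apply: measurable_funM => //; apply: (measurableT_comp (measurable_powR _)).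
exact: measurable_funB.
Qed.

Let dens_ge0 v : 0 <= (w \_ I01) v.
Proof. by rewrite patchE; case: ifP => // _; rewrite mulr_ge0 ?powR_ge0 ?ltW. Qed.

Lemma integral_beta1_dens_onemX b :
  (\int[leb]_(v in I01) (w v * (1 - v) ^+ b)%:E = (theta / (theta + b%:R))%:E)%E.
Proof.
have tb : 0 < theta + b%:R by rewrite ltr_wpDr.
transitivity (\int[leb]_(v in I01) (theta%:E * ((1 - v) `^ (theta + b%:R - 1))%:E))%E.
  apply: eq_integral => v; rewrite inE /= in_itv /= => /andP[_ v1].
  have onem_gt0 : 0 < 1 - v by rewrite subr_gt0.
  rewrite -EFinM /beta1_dens -mulrA -powR_mulrn ?(ltW onem_gt0) // -powRD.
    by rewrite addrAC.
  by rewrite (gt_eqF onem_gt0) implybT.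
rewrite ge0_integralZl //; first by rewrite integral_onem_powR.
- apply: measurable_funTS; apply/measurable_EFinP.
  by apply: (measurableT_comp (measurable_powR _)); exact: measurable_funB.
- by move=> v _; rewrite lee_fin powR_ge0.
- by rewrite lee_fin ltW.
Qed.

Let dens_mass : (\int[leb]_v ((w \_ I01) v)%:E = 1)%E.
Proof.
rewrite -[X in X = _]/(\int[leb]_v (EFin \o (w \_ I01)) v)%E -restrict_EFin.
rewrite -integral_mkcond.
transitivity (\int[leb]_(v in I01) (w v * (1 - v) ^+ 0)%:E)%E.
  by apply: eq_integral => v _; rewrite expr0 mulr1.
by rewrite integral_beta1_dens_onemX addr0 divff ?gt_eqF.
Qed.

Definition beta1_law : probability (measurableTypeR R) R :=
  @density_prob _ (measurableTypeR R) R lebesgue_measure (w \_ I01)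
    measurable_dens dens_ge0 dens_mass.

Lemma integral_beta1_law (f : R -> \bar R) : beta1_law.-integrable I01 f ->
  (\int[beta1_law]_(v in I01) f v = \int[leb]_(v in I01) ((w v)%:E * f v))%E.
Proof.
move=> intf; rewrite integral_density_prob //; apply: eq_integral => v vI.
by rewrite patchE vI muleC.
Qed.

Lemma beta1_law_setT_itv (f : R -> \bar R) : beta1_law.-integrable setT f ->
  (\int[beta1_law]_v f v = \int[beta1_law]_(v in I01) f v)%E.
Proof.
have mI : measurable (~` I01 : set (measurableTypeR R)) by exact: measurableC.
move=> intf; rewrite (negligible_integral mI _ intf) //; first by rewrite setTD setCK.
rewrite /beta1_law /= /density_prob integral0_eq // => v vI.
by rewrite patchE memNset.
Qed.

Lemma XMonemXE a b (v : R) : XMonemX a b v = v ^+ a * (1 - v) ^+ b.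
Proof. by []. Qed.

Lemma XMonemX_itv_le1 a b v : I01 v -> `|XMonemX a b v| <= 1 :> R.
Proof.
move=> /= vI; have v01 : v \in `[0, 1] by apply: subset_itv_oo_cc.
by rewrite ger0_norm ?XMonemX_ge0 ?XMonemX_le1.
Qed.

Lemma XMonemX_integrable a b : beta1_law.-integrable I01 (EFin \o XMonemX a b).
Proof.
apply: (@bounded_integrable _ _ _ beta1_law I01 _ 1) => //.
  exact: measurable_XMonemX.
exact: XMonemX_itv_le1.
Qed.

Definition beta1_moment (a b : nat) : R := \int[beta1_law]_(v in I01) XMonemX a b v.

Lemma beta1_moment0n b : beta1_moment 0 b = theta / (theta + b%:R).
Proof.
apply: EFin_inj; rewrite EFin_Rintegral //; last exact: XMonemX_integrable.
rewrite integral_beta1_law; last exact: XMonemX_integrable.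
under eq_integral do rewrite XMonemX0n -EFinM.
exact: integral_beta1_dens_onemX.
Qed.

Lemma beta1_moment_split a b :
  beta1_moment a b = beta1_moment a.+1 b + beta1_moment a b.+1.
Proof.
rewrite -RintegralD //; try exact: XMonemX_integrable.
by apply: eq_Rintegral => v _; rewrite !XMonemXE !exprS; ring.
Qed.

Lemma beta1_momentS a b : (theta + (a + b).+1%:R) * beta1_moment a.+1 b =
  a.+1%:R * beta1_moment a b.
Proof.
elim: a b => [|a IH] b.
  have := beta1_moment_split 0 b; rewrite !beta1_moment0n add0n -natr1 => split0.
  have -> : beta1_moment 1 b = theta / (theta + b%:R) - theta / (theta + (b%:R + 1)).
    by rewrite split0 addrK.
  have := ler0n R b; have := theta_gt0; set x := b%:R => t0 x0.
  by field; rewrite !gt_eqF //=; lra.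
have := IH b; have := IH b.+1.
have := beta1_moment_split a.+1 b; have := beta1_moment_split a b.
rewrite addnS !addSn -!natr1 !natrD.
set m20 := beta1_moment a.+2 b; set m10 := beta1_moment a.+1 b.
set m00 := beta1_moment a b; set m11 := beta1_moment a.+1 b.+1.
set m01 := beta1_moment a b.+1; set x := a%:R; set y := b%:R.
move=> split_a split_Sa rec_Sb rec_b.
have -> : m20 = m10 - m11 by rewrite split_Sa addrK.
have rec_m11 : (theta + (x + y + 1 + 1)) * m11 = (x + 1) * (m00 - m10).
  by rewrite rec_Sb split_a; ring.
rewrite mulrBr rec_m11; nra.
Qed.

End beta1_law.

Lemma sum_pascal (R : pzSemiRingType) (N : nat) (x : nat -> R) :
  \sum_(j < N.+2) 'C(N.+1, j)%:R * x j =
  \sum_(j < N.+1) 'C(N, j)%:R * (x j + x j.+1).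
Proof.
rewrite big_ord_recl bin0 mul1r.
under eq_bigr => i _ do rewrite /= /bump leq0n add1n binS natrD mulrDl.
rewrite big_split /= big_ord_recr /= bin_small // mul0r addr0 addrA.
under [RHS]eq_bigr => i _ do rewrite mulrDr.
rewrite [RHS]big_split /=; congr (_ + _).
by rewrite [RHS]big_ord_recl /= bin0 mul1r.
Qed.

Section bernstein.
Variable R : realType.
Implicit Types (v c : R) (g h : nat -> R).

Definition bernstein (N : nat) g v : R :=
  \sum_(j < N.+1) 'C(N, j)%:R * (XMonemX j (N - j) v * g j).

Lemma bernsteinS N g v : bernstein N.+1 g v =
  (1 - v) * bernstein N g v + v * bernstein N (fun j => g j.+1) v.
Proof.
rewrite /bernstein (sum_pascal N (fun j => XMonemX j (N.+1 - j) v * g j)).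
rewrite !big_distrr -big_split /=; apply: eq_bigr => j _.
rewrite subSS subSn; last by rewrite -ltnS.
by rewrite !XMonemXE !exprS; ring.
Qed.

Lemma bernstein0 g v : bernstein 0 g v = g 0%N.
Proof. by rewrite /bernstein big_ord1 bin0 XMonemX00 !mul1r. Qed.

Lemma bernstein_cst N c v : bernstein N (fun=> c) v = c.
Proof. by elim: N => [|N IH]; rewrite ?bernstein0 // bernsteinS IH; ring. Qed.

Lemma bernsteinD N g h v :
  bernstein N (fun j => g j + h j) v = bernstein N g v + bernstein N h v.
Proof. by rewrite /bernstein -big_split; apply: eq_bigr => j _; rewrite /= !mulrDr. Qed.

Lemma bernsteinZ N c g v : bernstein N (fun j => c * g j) v = c * bernstein N g v.
Proof. by rewrite /bernstein big_distrr; apply: eq_bigr => j _; rewrite /=; ring. Qed.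

Lemma bernstein_sqr N c v : bernstein N (fun j => (j%:R - c) ^+ 2) v =
  N%:R * (v * (1 - v)) + (N%:R * v - c) ^+ 2.
Proof.
elim: N c => [|N IH] c; first by rewrite bernstein0; ring.
rewrite bernsteinS IH.
have -> : (fun j : nat => (j.+1%:R - c) ^+ 2) = (fun j : nat => (j%:R - (c - 1)) ^+ 2).
  by apply/funext => j; rewrite -natr1; ring.
by rewrite IH -natr1; ring.
Qed.

Lemma le_bernstein N g h v : 0 <= v <= 1 ->
  (forall j, (j <= N)%N -> g j <= h j) -> bernstein N g v <= bernstein N h v.
Proof.
move=> v01 gh; apply: ler_sum => j _; rewrite ler_wpM2l // ler_wpM2l //.
  by rewrite XMonemX_ge0 ?in_itv.
by rewrite gh // -ltnS.
Qed.

Lemma le_norm_bernstein N g h v : 0 <= v <= 1 ->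
  (forall j, (j <= N)%N -> `|g j| <= h j) -> `|bernstein N g v| <= bernstein N h v.
Proof.
move=> v01 gh; rewrite ler_norml -mulN1r -bernsteinZ.
by apply/andP; split; apply: le_bernstein => // j /gh; rewrite ler_norml; lra.
Qed.

Lemma measurable_bernstein N g : measurable_fun setT (bernstein N g).
Proof.
apply: measurable_sum => j; apply: measurable_funM => //.
by apply: measurable_funM => //; exact: measurable_XMonemX.
Qed.

(* The weak law of large numbers for binomial variables, by Chebyshev. *)
Lemma cvg_bernstein (g x : nat -> nat -> R) v (G M : R) : 0 <= v <= 1 ->
  (fun N => bernstein N (fun j => (x N j - v) ^+ 2) v) @ \oo --> 0 ->
  (forall N j, (j <= N)%N -> `|g N j - G| <= M) ->
  (forall e, 0 < e -> exists2 eta, 0 < eta & \forall N \near \oo,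
     forall j, (j <= N)%N -> `|x N j - v| <= eta -> `|g N j - G| <= e) ->
  (fun N => bernstein N (g N) v) @ \oo --> G.
Proof.
move=> v01 var0 gM g_local; apply/cvgrPdist_le => e e0.
have M0 : 0 <= M := le_trans (normr_ge0 _) (gM 0%N 0%N (leqnn _)).
have e20 : 0 < e / 2 by rewrite divr_gt0.
have [eta eta0 near_v] := g_local _ e20.
pose C := M / eta ^+ 2; have C0 : 0 <= C by rewrite divr_ge0 ?sqr_ge0.
have /cvgrPdist_le/(_ _ e20) : (fun N =>
    C * bernstein N (fun j => (x N j - v) ^+ 2) v) @ \oo --> 0.
  by rewrite -(mulr0 C); apply: cvgM => //; exact: cvg_cst.
apply: filterS2 near_v => N near_vN; rewrite sub0r normrN => var_le.
have chebyshev j : (j <= N)%N -> `|g N j - G| <= e / 2 + C * (x N j - v) ^+ 2.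
  move=> jN; have [xv|xv] := leP `|x N j - v| eta.
    by rewrite (le_trans (near_vN j jN xv)) // lerDl mulr_ge0 ?sqr_ge0.
  rewrite (le_trans (gM N j jN)) // -[leLHS]add0r lerD ?(ltW e20) //.
  rewrite -[(x N j - v) ^+ 2]real_normK ?num_real // /C mulrAC.
  rewrite ler_pdivlMr ?exprn_gt0 // ler_wpM2l // lerXn2r ?nnegrE ?(ltW eta0) //.
  exact: ltW.
rewrite distrC -[G](bernstein_cst N _ v) -mulN1r -bernsteinZ -bernsteinD.
apply: (@le_trans _ _ (bernstein N (fun j => e / 2 + C * (x N j - v) ^+ 2) v)).
  by apply: le_norm_bernstein => // j jN; rewrite mulN1r chebyshev.
rewrite bernsteinD bernsteinZ bernstein_cst [leRHS]splitr lerD2l.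
exact: le_trans (ler_norm _) var_le.
Qed.

End bernstein.

(** * Finite Markov chains realized on the unit interval *)

Section step_function.
Variables (R : realType) (A : eqType) (a0 : A).
Implicit Types (s : seq (R * A)) (c u : R) (F : A -> R).

Definition mass s : R := \sum_(p <- s) p.1.
Definition weights_ge0 s : bool := all (fun p => 0 <= p.1) s.

(* The value at [u] of the step function that starts at [c] and has
   consecutive steps [(length, value)]. *)
Fixpoint stepf s c u : A :=
  match s with
  | [::] => a0
  | p :: s' => if u < c + p.1 then p.2 else stepf s' (c + p.1) u
  end.

Lemma mass_cons p s : mass (p :: s) = p.1 + mass s.
Proof. exact: big_cons. Qed.

Lemma mass_ge0 s : weights_ge0 s -> 0 <= mass s.
Proof.
by move=> /allP s_ge0; rewrite /mass big_seq; apply: sumr_ge0 => p /s_ge0.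
Qed.

Lemma measurable_stepf F s c : measurable_fun setT (fun u => F (stepf s c u)).
Proof.
elim: s c => [|p s IH] c /=; first exact: measurable_cst.
rewrite (_ : (fun u => _) =
   (fun u => if u < c + p.1 then F p.2 else F (stepf s (c + p.1) u))).
  by apply: measurable_fun_ifT => //; exact: measurable_fun_ltr.
by apply/funext => u; case: ifP.
Qed.

Lemma integral_stepf F s c : weights_ge0 s ->
  (\int[lebesgue_measure]_(u in `[c, (c + mass s)%R[) (F (stepf s c u))%:E
   = (\sum_(p <- s) p.1 * F p.2)%R%:E)%E.
Proof.
elim: s c => [|p s IH] c.
  by rewrite /mass !big_nil addr0 set_itvco0 integral_set0.
move=> /andP[p0 s0]; rewrite mass_cons big_cons addrA.
rewrite (@itv_bndbnd_setU _ _ _ (BLeft (c + p.1))); last 2 first.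
  by rewrite bnd_simp lerDl.
  by rewrite bnd_simp lerDl mass_ge0.
rewrite integral_setU //=; last 2 first.
- apply/measurable_EFinP; apply: measurable_funTS.
  exact: (measurable_stepf F (p :: s) c).
- apply/disj_setPS => u [] /=; rewrite !in_itv /= => /andP[_ up] /andP[pu _].
  by move: up; rewrite ltNge pu.
rewrite EFinD; congr (_ + _)%E.
  rewrite (eq_integral (cst (F p.2)%:E)); last first.
    by move=> u; rewrite inE /= in_itv /= => /andP[_ ->].
  rewrite integral_cst //= lebesgue_measure_itv /= lte_fin ltrDl EFinM muleC.
  have [p_gt0|p_le0] := ltP; first by rewrite -EFinD addrAC subrr add0r.
  by rewrite (_ : p.1 = 0) //; apply/eqP; rewrite eq_le p_le0.
rewrite -(IH (c + p.1)) //; apply: eq_integral => u.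
by rewrite inE /= in_itv /= => /andP[pu _]; rewrite ltNge pu.
Qed.

Lemma stepf_cat s1 s2 c u : weights_ge0 s1 -> c <= u ->
  stepf (s1 ++ s2) c u =
  if u < c + mass s1 then stepf s1 c u else stepf s2 (c + mass s1) u.
Proof.
elim: s1 c => [|p s IH] c /=; first by rewrite /mass big_nil addr0 ltNge => _ ->.
move=> /andP[p0 s0] cu; rewrite mass_cons addrA.
case: (ltP u (c + p.1)) => [up|pu]; last by rewrite IH.
by rewrite (lt_le_trans up) // lerDl mass_ge0.
Qed.

Lemma mem_stepf s c u : c <= u < c + mass s -> stepf s c u \in map snd s.
Proof.
elim: s c => [|p s IH] c /=.
  by rewrite /mass big_nil addr0 => /andP[cu]; rewrite ltNge cu.
rewrite mass_cons addrA; case: (ltP u (c + p.1)) => [_ _|pu /andP[_ us]].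
  by rewrite mem_head.
by rewrite in_cons IH ?orbT // pu.
Qed.

Definition expand (k : A -> seq (R * A)) s : seq (R * A) :=
  flatten [seq [seq (p.1 * q.1, q.2) | q <- k p.2] | p <- s].

(* Expanding subdivides each step, so a projection recovering the parent of an
   expanded value recovers the original step function. *)
Lemma stepf_expand (k : A -> seq (R * A)) (parent : A -> A) s c u :
  weights_ge0 s ->
  (forall a, all (fun q => (0 <= q.1) && (parent q.2 == a)) (k a)) ->
  (forall a, mass (k a) = 1) ->
  c <= u < c + mass s -> parent (stepf (expand k s) c u) = stepf s c u.
Proof.
move=> + k_parent k_mass; elim: s c => [|p s IH] c /=.
  by move=> _; rewrite /mass big_nil addr0 => /andP[cu]; rewrite ltNge cu.
move=> /andP[p0 s0]; rewrite mass_cons => /andP[cu us].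
set children := [seq (p.1 * q.1, q.2) | q <- k p.2].
have children_mass : mass children = p.1.
  by rewrite /mass big_map /= -big_distrr /= -/(mass _) k_mass mulr1.
have children_ge0 : weights_ge0 children.
  rewrite /weights_ge0 all_map; apply/allP => q /= qk; rewrite mulr_ge0 //.
  by have /allP/(_ _ qk)/andP[] := k_parent p.2.
rewrite /expand /= stepf_cat // children_mass.
case: ltP => [up|pu]; last by rewrite IH // pu -addrA.
have := @mem_stepf children c u; rewrite children_mass cu up => /(_ isT).
move=> /mapP[x /mapP[q qk ->] ->].
by have /allP/(_ _ qk)/andP[_ /eqP] := k_parent p.2.
Qed.

End step_function.

Section markov_chain.
Variables (R : realType) (A : eqType) (k : A -> seq (R * A)) (a0 : A).
Implicit Types (F G : A -> R) (N : nat) (m : nat -> A -> R).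

Definition transition F a : R := \sum_(q <- k a) q.1 * F q.2.

(* Weighted paths of the chain, most recent state first. *)
Fixpoint histories N : seq (R * seq A) :=
  match N with
  | 0 => [:: (1, [:: a0])]
  | n.+1 => expand (fun h => [seq (q.1, q.2 :: h) | q <- k (head a0 h)]) (histories n)
  end.

Fixpoint states N : seq A :=
  match N with
  | 0 => [:: a0]
  | n.+1 => flatten [seq map snd (k a) | a <- states n]
  end.

Definition expect N F : R := \sum_(p <- histories N) p.1 * F (head a0 p.2).

Definition realization N (u : R) : seq A := stepf [::] (histories N) 0 u.
Definition chain N (u : R) : A := head a0 (realization N u).

Definition unif01 : probability (measurableTypeR R) R := uniform_prob (@ltr01 R).

Lemma big_historiesS N (G : A -> seq A -> R) :
  \sum_(p <- histories N.+1) p.1 * G (head a0 p.2) (behead p.2) =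
  \sum_(p <- histories N) p.1 * transition (fun a => G a p.2) (head a0 p.2).
Proof.
rewrite /= /expand big_flatten big_map; apply: eq_bigr => p _.
by rewrite !big_map big_distrr; apply: eq_bigr => q _; rewrite /= mulrA.
Qed.

Lemma expect0 F : expect 0 F = F a0.
Proof. by rewrite /expect big_seq1 mul1r. Qed.

Lemma expectS N F : expect N.+1 F = expect N (transition F).
Proof. exact: (big_historiesS N (fun a _ => F a)). Qed.

Lemma expectD N F G : expect N (fun a => F a + G a) = expect N F + expect N G.
Proof. by rewrite /expect -big_split; apply: eq_bigr => p _; rewrite mulrDr. Qed.

Lemma expectZ N (c : R) F : expect N (fun a => c * F a) = c * expect N F.
Proof. by rewrite /expect big_distrr; apply: eq_bigr => p _; rewrite mulrCA. Qed.

Lemma expectN N F : expect N (fun a => - F a) = - expect N F.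
Proof. by rewrite -mulN1r -expectZ; apply: eq_bigr => p _; rewrite mulN1r. Qed.

Lemma expectB N F G : expect N (fun a => F a - G a) = expect N F - expect N G.
Proof. by rewrite expectD expectN. Qed.

Lemma histories_states N p : p \in histories N -> head a0 p.2 \in states N.
Proof.
elim: N p => [|N IH] p /=; first by rewrite !inE => /eqP ->.
move=> /flatten_mapP[x /IH x_state] /mapP[y /mapP[q qk ->] ->] /=.
by apply/flatten_mapP; exists (head a0 x.2) => //; apply/mapP; exists q.
Qed.

Lemma eq_expect N F G : {in states N, F =1 G} -> expect N F = expect N G.
Proof.
move=> FG; rewrite /expect big_seq [RHS]big_seq; apply: eq_bigr => p pN.
by rewrite FG // histories_states.
Qed.

Lemma transitionD F G a :
  transition (fun a' => F a' + G a') a = transition F a + transition G a.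
Proof. by rewrite /transition -big_split; apply: eq_bigr => q _; rewrite mulrDr. Qed.

Lemma transitionZ (c : R) F a :
  transition (fun a' => c * F a') a = c * transition F a.
Proof. by rewrite /transition big_distrr; apply: eq_bigr => q _; rewrite mulrCA. Qed.

Hypothesis k_ge0 : forall a, weights_ge0 (k a).
Hypothesis k_mass : forall a, mass (k a) = 1.

Lemma transition_cst (c : R) a : transition (fun=> c) a = c.
Proof. by rewrite /transition -big_distrl /= -/(mass _) k_mass mul1r. Qed.

Lemma histories_ge0 N : weights_ge0 (histories N).
Proof.
elim: N => [|N IH] /=; first by rewrite /weights_ge0 /= ler01.
apply/allP => _ /flatten_mapP[p pN] /mapP[q /mapP[r rk ->] ->] /=.
have /allP k_weights := k_ge0 (head a0 p.2); have /allP h_weights := IH.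
by rewrite mulr_ge0 ?(h_weights _ pN) ?(k_weights _ rk).
Qed.

Lemma expect_cst N (c : R) : expect N (fun=> c) = c.
Proof.
elim: N => [|N IH]; rewrite ?expect0 // expectS -[RHS]IH.
by apply: eq_bigr => p _; rewrite transition_cst.
Qed.

Lemma histories_mass N : mass (histories N) = 1.
Proof. by rewrite -(expect_cst N 1); apply: eq_bigr => p _; rewrite mulr1. Qed.

Lemma le_expect N F G : {in states N, forall a, F a <= G a} ->
  expect N F <= expect N G.
Proof.
move=> FG; rewrite /expect big_seq [leRHS]big_seq; apply: ler_sum => p pN.
rewrite ler_wpM2l ?FG ?histories_states //.
by have /allP h_weights := histories_ge0 N; exact: h_weights.
Qed.

Lemma le_norm_expect N F : `|expect N F| <= expect N (fun a => `|F a|).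
Proof.
rewrite ler_norml -expectN; apply/andP; split; apply: le_expect => a _.
  by rewrite lerNl -normrN ler_norm.
exact: ler_norm.
Qed.

Lemma norm_expect_le N F (M : R) : (forall a, `|F a| <= M) -> `|expect N F| <= M.
Proof.
move=> FM; apply: (le_trans (le_norm_expect N F)).
by rewrite -[leRHS](expect_cst N); apply: le_expect.
Qed.

Lemma integral_unif01 (f : R -> \bar R) : measurable_fun setT f ->
  (\int[unif01]_x f x = \int[lebesgue_measure]_(x in `[0%R, 1%R[) f x)%E.
Proof.
move=> mf; have ge0_case (g : R -> \bar R) : measurable_fun setT g ->
    (forall x, (0 <= g x)%E) ->
    (\int[unif01]_x g x = \int[lebesgue_measure]_(x in `[0%R, 1%R[) g x)%E.
  move=> mg g0; rewrite integral_uniform // subr0 invr1 mul1e.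
  by rewrite [RHS]integral_itv_bndo_bndc //; exact: measurable_funS mg.
rewrite integralE [RHS]integralE !ge0_case //.
- exact: measurable_funeneg.
- exact: measurable_funepos.
Qed.

Lemma measurable_realization (G : seq A -> R) N :
  measurable_fun setT (fun u => G (realization N u)).
Proof. exact: measurable_stepf. Qed.

Lemma integral_realization (G : seq A -> R) N :
  (\int[unif01]_u (G (realization N u))%:E =
   (\sum_(p <- histories N) p.1 * G p.2)%R%:E)%E.
Proof.
rewrite integral_unif01; last first.
  by apply/measurable_EFinP; exact: (measurable_realization G N).
rewrite -(integral_stepf [::] G 0 (histories_ge0 N)).
by rewrite histories_mass add0r.
Qed.

Lemma drop_realization N i u : 0 <= u < 1 ->
  drop i (realization (N + i) u) = realization N u.
Proof.
move=> u01; elim: i => [|i IH]; first by rewrite addn0 drop0.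
rewrite -IH -addn1 -drop_drop drop1 addnA addn1; congr drop.
apply: stepf_expand; first exact: histories_ge0.
- move=> h; apply/allP => _ /mapP[q qk ->] /=; rewrite eqxx andbT.
  by have /allP k_weights := k_ge0 (head a0 h); exact: k_weights.
- by move=> h; rewrite /mass big_map -/(mass _) k_mass.
- by rewrite histories_mass add0r.
Qed.

Lemma chain_Lfun2 F N : (fun u => F (chain N u)) \in Lfun unif01 2%:E.
Proof.
apply/Lfun2P; split; first exact: (measurable_realization (fun h => F (head a0 h))).
apply/integrableP; split.
  apply/measurable_EFinP.
  exact: (measurable_realization (fun h => F (head a0 h) ^+ 2)).
under eq_integral do rewrite gee0_abs ?lee_fin ?sqr_ge0 //.
by rewrite (integral_realization (fun h => F (head a0 h) ^+ 2)) ltry.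
Qed.

Lemma Rintegral_chain F N : \int[unif01]_u F (chain N u) = expect N F.
Proof.
by rewrite /Rintegral (integral_realization (fun h => F (head a0 h))).
Qed.

Definition increment_sqr m N : A -> R :=
  fun a => transition (fun a' => (m N.+1 a' - m N a) ^+ 2) a.

Section martingale.
Variable m : nat -> A -> R.
Hypothesis m_martingale :
  forall N, {in states N, forall a, transition (m N.+1) a = m N a}.

Lemma transition_sqrB N a (y : R) : a \in states N ->
  transition (fun a' => (m N.+1 a' - y) ^+ 2) a =
  (m N a - y) ^+ 2 + increment_sqr m N a.
Proof.
move=> aN; set x := m N a; have mean : transition (m N.+1) a = x by exact: m_martingale.
rewrite /increment_sqr -/x (_ : (x - y) ^+ 2 = 2 * (x - y) * transition (m N.+1) a
    + transition (fun=> y ^+ 2 - x ^+ 2) a); last first.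
  by rewrite mean transition_cst; ring.
rewrite /transition big_distrr -!big_split /=.
by apply: eq_bigr => q _; ring.
Qed.

Lemma increment_sqr_le N a (y : R) : a \in states N ->
  increment_sqr m N a <= transition (fun a' => (m N.+1 a' - y) ^+ 2) a.
Proof. by move=> aN; rewrite transition_sqrB // lerDr sqr_ge0. Qed.

Lemma martingale_L2_dist N i :
  L2norm unif01 (fun u => m (N + i)%N (chain (N + i) u) - m N (chain N u)) ^+ 2 =
  \sum_(j < i) expect (N + j) (increment_sqr m (N + j)).
Proof.
rewrite L2norm_sqr ?Lfun2B ?chain_Lfun2 //.
pose G i h := (m (N + i)%N (head a0 h) - m N (head a0 (drop i h))) ^+ 2.
rewrite (_ : \int[_]_u _ = \int[unif01]_u G i (realization (N + i) u)); last first.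
  rewrite /Rintegral !integral_unif01.
  - congr fine; apply: eq_integral => u; rewrite inE /= in_itv /= => u01.
    by rewrite /G drop_realization.
  - apply/measurable_EFinP; exact: (measurable_realization (G i)).
  - apply/measurable_EFinP/measurable_funX.
    by apply: measurable_funB; exact: Lfun2_measurable (chain_Lfun2 _ _).
rewrite /Rintegral integral_realization /=.
elim: i => [|i IH].
  by rewrite big_ord0 big1 // => p _; rewrite /G addn0 drop0 subrr expr0n mulr0.
rewrite big_ord_recr /= -IH addnS.
transitivity (\sum_(p <- histories (N + i).+1) p.1 *
    (m (N + i).+1 (head a0 p.2) - m N (head a0 (drop i (behead p.2)))) ^+ 2).
  by apply: eq_bigr => p _; rewrite /G addnS -drop1 drop_drop addn1.
rewrite (big_historiesS _
  (fun a h => (m (N + i).+1 a - m N (head a0 (drop i h))) ^+ 2)).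
rewrite -big_split big_seq [RHS]big_seq; apply: eq_bigr => p /histories_states pN.
by rewrite transition_sqrB // mulrDr.
Qed.

Lemma martingale_L2_cvg (D : nat -> R) : (forall N, 0 <= D N) ->
  (forall N, expect N (increment_sqr m N) <= D N - D N.+1) ->
  exists2 g, g \in Lfun unif01 2%:E &
    L2cvg unif01 (fun N u => m N (chain N u)) g.
Proof.
move=> D_ge0 incr_le; apply: L2_complete => [n|e e0]; first exact: chain_Lfun2.
have incr_ge0 N : 0 <= expect N (increment_sqr m N).
  rewrite -(expect_cst N 0); apply: le_expect => a _; rewrite /increment_sqr.
  rewrite -(transition_cst 0 a) /transition big_seq [leRHS]big_seq.
  apply: ler_sum => q qk; rewrite ler_wpM2l ?sqr_ge0 //.
  by have /allP k_weights := k_ge0 a; exact: k_weights.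
have /cvg_ex[l Dl] : cvgn D.
  apply: nonincreasing_is_cvgn.
    apply/nonincreasing_seqP => N.
    by rewrite -subr_ge0 (le_trans (incr_ge0 N)) // incr_le.
  by exists 0 => _ [N _ <-].
have e20 : 0 < e ^+ 2 / 2 by rewrite divr_gt0 ?exprn_gt0.
have /cvgrPdist_le/(_ _ e20)[N _ near_l] := Dl; exists N.
have dist_le n i : (N <= n)%N ->
    L2norm unif01 (fun u => m (n + i)%N (chain (n + i) u) - m n (chain n u)) <= e.
  move=> Nn; rewrite -(@ler_pXn2r _ 2) ?nnegrE ?L2norm_ge0 ?(ltW e0) //.
  rewrite martingale_L2_dist.
  apply: (@le_trans _ _ (D n - D (n + i)%N)).
    elim: i => [|i IH]; first by rewrite big_ord0 addn0 subrr.
    by rewrite big_ord_recr /= addnS (le_trans (lerD IH (incr_le _))) // addrA subrK.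
  have := near_l n Nn; have := near_l _ (leq_trans Nn (leq_addr i n)).
  by rewrite /= !ler_distl; lra.
move=> n' n Nn' Nn; have [nn'|/ltnW n'n] := leqP n n'.
  by rewrite -(subnKC nn'); exact: dist_le.
by rewrite L2norm_distrC -(subnKC n'n); exact: dist_le.
Qed.

End martingale.

End markov_chain.

(** * Recursive trees as binary trees *)

(* [Leaf l] is the one-vertex tree; [Join r s] is the tree [r] with the tree
   [s] hung below its root as the oldest child.  A new child of the vertex [j]
   then always replaces the leaf [j] by a [Join] of two leaves. *)
Inductive btree := Leaf of nat | Join of btree & btree.

HB.instance Definition _ := gen_eqMixin btree.

Fixpoint vertices (b : btree) : seq nat :=
  match b with Leaf l => [:: l] | Join r s => vertices r ++ vertices s end.

Fixpoint root_vertex (b : btree) : nat :=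
  match b with Leaf l => l | Join r _ => root_vertex r end.

Fixpoint nverts (b : btree) : nat :=
  match b with Leaf _ => 1 | Join r s => (nverts r + nverts s)%N end.

Fixpoint path_length (b : btree) : nat :=
  match b with
  | Leaf _ => 0
  | Join r s => (path_length r + path_length s + nverts s)%N
  end.

Fixpoint sqdepth_sum (b : btree) : nat :=
  match b with
  | Leaf _ => 0
  | Join r s => (sqdepth_sum r + sqdepth_sum s
                 + (path_length s + path_length s) + nverts s)%N
  end.

Fixpoint wiener_index (b : btree) : nat :=
  match b with
  | Leaf _ => 0
  | Join r s => (wiener_index r + wiener_index s + nverts r * path_length s
                 + nverts s * path_length r + nverts r * nverts s)%N
  end.

Fixpoint depth_in (b : btree) (i : nat) : nat :=
  match b with
  | Leaf _ => 0
  | Join r s => if i \in vertices r then depth_in r i else (depth_in s i).+1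
  end.

Fixpoint dist_in (b : btree) (i j : nat) : nat :=
  match b with
  | Leaf _ => 0
  | Join r s =>
    if i \in vertices r then
      if j \in vertices r then dist_in r i j else (depth_in r i + depth_in s j).+1
    else
      if j \in vertices r then (depth_in r j + depth_in s i).+1 else dist_in s i j
  end.

Fixpoint add_child (b : btree) (j n : nat) : btree :=
  match b with
  | Leaf l => if l == j then Join (Leaf l) (Leaf n) else Leaf l
  | Join r s => Join (add_child r j n) (add_child s j n)
  end.

Fixpoint unlabel (b : btree) : btree :=
  match b with Leaf _ => Leaf 0 | Join r s => Join (unlabel r) (unlabel s) end.

Lemma nvertsE b : nverts b = size (vertices b).
Proof. by elim: b => //= r -> s ->; rewrite size_cat. Qed.

Lemma nverts_gt0 b : (0 < nverts b)%N.
Proof. by elim: b => //= r Hr s _; rewrite addn_gt0 Hr. Qed.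

Lemma nverts_unlabel b : nverts (unlabel b) = nverts b.
Proof. by elim: b => //= r -> s ->. Qed.

Lemma path_length_unlabel b : path_length (unlabel b) = path_length b.
Proof. by elim: b => //= r -> s ->; rewrite nverts_unlabel. Qed.

Lemma wiener_index_unlabel b : wiener_index (unlabel b) = wiener_index b.
Proof.
by elim: b => //= r -> s ->; rewrite !nverts_unlabel !path_length_unlabel.
Qed.

Lemma root_vertex_in b : root_vertex b \in vertices b.
Proof. by elim: b => [l|r IHr s _] /=; rewrite ?mem_seq1 // mem_cat IHr. Qed.

Lemma root_vertex_add_child b j n : root_vertex (add_child b j n) = root_vertex b.
Proof. by elim: b => [l|r IHr s _] //=; case: (l == j). Qed.

Lemma dist_in_sym b i j : dist_in b i j = dist_in b j i.
Proof. by elim: b => //= r -> s ->; do 2 case: (_ \in _). Qed.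

Lemma dist_in_refl b i : dist_in b i i = 0%N.
Proof. by elim: b => //= r -> s ->; case: (_ \in _). Qed.

Lemma add_child_notin b j n : j \notin vertices b -> add_child b j n = b.
Proof.
elim: b => [l|r IHr s IHs] /=; first by rewrite mem_seq1 eq_sym => /negbTE ->.
by rewrite mem_cat negb_or => /andP[/IHr -> /IHs ->].
Qed.

Variant add_child_join_spec r s j n : btree -> Prop :=
| AddChildLeft of j \in vertices r & j \notin vertices s :
    add_child_join_spec r s j n (Join (add_child r j n) s)
| AddChildRight of j \notin vertices r & j \in vertices s :
    add_child_join_spec r s j n (Join r (add_child s j n)).

Lemma add_child_joinP r s j n :
  uniq (vertices (Join r s)) -> j \in vertices (Join r s) ->
  add_child_join_spec r s j n (add_child (Join r s) j n).
Proof.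
rewrite /= cat_uniq mem_cat => /and3P[_ /hasPn disj _] /orP[jr|js].
  have js : j \notin vertices s by apply/negP => /disj; rewrite jr.
  by rewrite (add_child_notin n js); exact: AddChildLeft.
have jr : j \notin vertices r := disj _ js.
by rewrite (add_child_notin n jr); exact: AddChildRight.
Qed.

Lemma uniq_vertices_join r s : uniq (vertices (Join r s)) ->
  uniq (vertices r) /\ uniq (vertices s).
Proof. by rewrite /= cat_uniq => /and3P[]. Qed.

Lemma notin_vertices_join r s n : (n \notin vertices (Join r s)) =
  (n \notin vertices r) && (n \notin vertices s).
Proof. by rewrite mem_cat negb_or. Qed.

Lemma perm_vertices_add_child b j n : uniq (vertices b) -> j \in vertices b ->
  perm_eq (vertices (add_child b j n)) (n :: vertices b).
Proof.
elim: b => [l|r IHr s IHs] b_uniq jb.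
  by move: jb; rewrite /= mem_seq1 => /eqP ->; rewrite eqxx (perm_catC [:: l] [:: n]).
have [r_uniq s_uniq] := uniq_vertices_join b_uniq.
case: (add_child_joinP n b_uniq jb) => jr js /=.
  by rewrite -cat_cons perm_cat2r IHr.
rewrite -cat1s perm_sym (perm_catCA [:: n] (vertices r) (vertices s)).
by rewrite perm_cat2l perm_sym IHs.
Qed.

Lemma nverts_add_child b j n : uniq (vertices b) -> j \in vertices b ->
  nverts (add_child b j n) = (nverts b).+1.
Proof.
by move=> bu jb; rewrite !nvertsE (perm_size (perm_vertices_add_child n bu jb)).
Qed.

Lemma mem_vertices_add_child b j n i : uniq (vertices b) -> j \in vertices b ->
  (i \in vertices (add_child b j n)) = (i == n) || (i \in vertices b).
Proof. by move=> bu jb; rewrite (perm_mem (perm_vertices_add_child n bu jb)). Qed.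

Lemma depth_in_add_child b j n i : uniq (vertices b) -> j \in vertices b ->
  n \notin vertices b -> i \in n :: vertices b ->
  depth_in (add_child b j n) i = if i == n then (depth_in b j).+1 else depth_in b i.
Proof.
elim: b i => [l|r IHr s IHs] i b_uniq jb.
  move: jb; rewrite /= !inE => /eqP -> nl; rewrite eqxx /= inE.
  by case: eqP => [->|_ /eqP ->]; rewrite ?eqxx // (negbTE nl).
have [r_uniq s_uniq] := uniq_vertices_join b_uniq.
rewrite notin_vertices_join in_cons mem_cat => /andP[nr ns].
case: (add_child_joinP n b_uniq jb) => jr js /=.
  rewrite mem_vertices_add_child // jr; case: eqP => [->|/eqP ni] /= irs.
    by rewrite IHr ?mem_head // eqxx.
  by case: ifP => // ir; rewrite IHr ?in_cons ?ir ?orbT // (negbTE ni).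
rewrite (negbTE jr); case: eqP => [->|/eqP ni] /= irs.
  by rewrite (negbTE nr) IHs ?mem_head // eqxx.
by case: ifP irs => //= _ is_; rewrite IHs ?in_cons ?is_ ?orbT // (negbTE ni).
Qed.

Lemma dist_in_add_child b j n i k : uniq (vertices b) -> j \in vertices b ->
  n \notin vertices b -> i \in vertices b -> k \in n :: vertices b ->
  dist_in (add_child b j n) i k =
  if k == n then (dist_in b i j).+1 else dist_in b i k.
Proof.
elim: b i k => [l|r IHr s IHs] i k b_uniq jb.
  move: jb; rewrite /= !inE => /eqP -> nl /eqP ->; rewrite eqxx /= !inE eqxx.
  by case: eqP => [->|_ /eqP ->]; rewrite ?eqxx // (negbTE nl).
have [r_uniq s_uniq] := uniq_vertices_join b_uniq.
move=> nb ib; have ni : i != n by apply: contraNneq nb => <-.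
move: nb ib; rewrite notin_vertices_join in_cons !mem_cat => /andP[nr ns].
have depth_r := depth_in_add_child r_uniq _ nr.
have depth_s := depth_in_add_child s_uniq _ ns.
case: (add_child_joinP n b_uniq jb) => jr js /=.
  rewrite !mem_vertices_add_child // (negbTE ni) jr /=.
  case: (boolP (i \in vertices r)) => /= [ir _|ir is_].
    case: eqP => [->|/eqP nk] /= krs; first by rewrite IHr ?mem_head ?eqxx.
    case: ifP => kr; first by rewrite IHr ?in_cons ?kr ?orbT // (negbTE nk).
    by rewrite depth_r ?in_cons ?ir ?orbT // (negbTE ni).
  case: eqP => [->|/eqP nk] /= krs; first by rewrite depth_r ?mem_head // eqxx.
  by case: ifP => // kr; rewrite depth_r ?in_cons ?kr ?orbT // (negbTE nk).
rewrite (negbTE jr); case: (boolP (i \in vertices r)) => /= [ir _|ir is_].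
  case: eqP => [->|/eqP nk] /= krs.
    by rewrite (negbTE nr) depth_s ?mem_head // eqxx addnS.
  by case: ifP krs => //= _ ks; rewrite depth_s ?in_cons ?ks ?orbT // (negbTE nk).
case: eqP => [->|/eqP nk] /= krs; first by rewrite (negbTE nr) IHs ?mem_head ?eqxx.
case: ifP krs => /= _ ks; last by rewrite IHs ?in_cons ?ks ?orbT // (negbTE nk).
by rewrite depth_s ?in_cons ?is_ ?orbT // (negbTE ni).
Qed.

Lemma path_lengthE b : uniq (vertices b) ->
  path_length b = (\sum_(i <- vertices b) depth_in b i)%N.
Proof.
elim: b => [l|r IHr s IHs] /=; first by rewrite big_seq1.
rewrite cat_uniq => /and3P[r_uniq /hasPn disj s_uniq].
rewrite big_cat /= -addnA; congr (_ + _)%N.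
  by rewrite IHr // !big_seq; apply: eq_bigr => i ->.
rewrite IHs // nvertsE -sum1_size -big_split !big_seq /=.
by apply: eq_bigr => i /disj /negbTE ->; rewrite addn1.
Qed.

Lemma path_length_add_child b j n : uniq (vertices b) -> j \in vertices b ->
  path_length (add_child b j n) = (path_length b + (depth_in b j).+1)%N.
Proof.
elim: b => [l|r IHr s IHs] b_uniq jb.
  by move: jb; rewrite /= inE => /eqP ->; rewrite eqxx.
have [r_uniq s_uniq] := uniq_vertices_join b_uniq.
case: (add_child_joinP n b_uniq jb) => jr js /=.
  by rewrite jr IHr //; lia.
by rewrite (negbTE jr) IHs // nverts_add_child //; lia.
Qed.

Lemma sum_dist_in_join r s j : uniq (vertices (Join r s)) ->
  (\sum_(i <- vertices (Join r s)) (dist_in (Join r s) i j).+1 =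
   if j \in vertices r then
     \sum_(i <- vertices r) (dist_in r i j).+1
     + (nverts s * (depth_in r j).+2 + path_length s)
   else nverts r * (depth_in s j).+2 + path_length r
        + \sum_(i <- vertices s) (dist_in s i j).+1)%N.
Proof.
move=> b_uniq; have [r_uniq s_uniq] := uniq_vertices_join b_uniq.
have := b_uniq; rewrite /= cat_uniq => /and3P[_ /hasPn disj _].
have sum_depth b c : uniq (vertices b) -> (nverts b * c.+2 + path_length b =
    \sum_(i <- vertices b) (c + depth_in b i).+2)%N.
  move=> bu; rewrite (path_lengthE bu) nvertsE -sum1_size big_distrl -big_split /=.
  by apply: eq_bigr => i _; lia.
rewrite big_cat !sum_depth //; case: ifP => jr; congr (_ + _)%N.
- by rewrite !big_seq; apply: eq_bigr => i ->.
- by rewrite !big_seq; apply: eq_bigr => i /disj /negbTE ->.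
- by rewrite !big_seq; apply: eq_bigr => i ->; rewrite addnC.
- by rewrite !big_seq; apply: eq_bigr => i /disj /negbTE ->.
Qed.

Lemma wiener_index_add_child b j n : uniq (vertices b) -> j \in vertices b ->
  wiener_index (add_child b j n) =
  (wiener_index b + \sum_(i <- vertices b) (dist_in b i j).+1)%N.
Proof.
elim: b => [l|r IHr s IHs] b_uniq jb.
  by move: jb; rewrite /= inE => /eqP ->; rewrite eqxx big_seq1.
have [r_uniq s_uniq] := uniq_vertices_join b_uniq.
rewrite sum_dist_in_join //; case: (add_child_joinP n b_uniq jb) => jr js /=.
  by rewrite jr IHr // path_length_add_child // nverts_add_child //; lia.
by rewrite (negbTE jr) IHs // path_length_add_child // nverts_add_child //; lia.
Qed.

Fixpoint tree_of (J : nat -> nat) (n : nat) : btree :=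
  match n with
  | 0 => Leaf 0
  | m.+1 => add_child (tree_of J m) (J m.+1) m.+1
  end.

Definition parents_below (n : nat) (J : nat -> nat) : Prop :=
  forall k, (0 < k <= n)%N -> (J k < k)%N.

Section tree_of.
Variables (J : nat -> nat) (n : nat).
Hypothesis J_lt : parents_below n J.

Lemma root_vertex_tree_of m : root_vertex (tree_of J m) = 0%N.
Proof. by elim: m => //= m <-; rewrite root_vertex_add_child. Qed.

Lemma perm_vertices_tree_of m : (m <= n)%N ->
  perm_eq (vertices (tree_of J m)) (iota 0 m.+1).
Proof.
elim: m => // m IH mn; have perm_m := IH (ltnW mn).
have m_uniq : uniq (vertices (tree_of J m)) by rewrite (perm_uniq perm_m) iota_uniq.
have Jm : J m.+1 \in vertices (tree_of J m).
  by rewrite (perm_mem perm_m) mem_iota /= J_lt.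
rewrite -[m.+2]addn1 iotaD cats1 perm_sym perm_rcons perm_sym.
by rewrite (permPl (perm_vertices_add_child _ m_uniq Jm)) perm_cons.
Qed.

Lemma uniq_tree_of m : (m <= n)%N -> uniq (vertices (tree_of J m)).
Proof. by move=> mn; rewrite (perm_uniq (perm_vertices_tree_of mn)) iota_uniq. Qed.

Lemma mem_tree_of m i : (m <= n)%N -> (i \in vertices (tree_of J m)) = (i <= m)%N.
Proof. by move=> mn; rewrite (perm_mem (perm_vertices_tree_of mn)) mem_iota. Qed.

Lemma depth_fuelE f k : (k <= f)%N -> (k <= n)%N -> depth_fuel J f k = depth J k.
Proof.
rewrite /depth; elim/ltn_ind: k f => k IH [|f]; first by case: k {IH}.
case: k IH => // k IH kf kn /=.
have Jk : (J k.+1 < k.+1)%N by rewrite J_lt.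
by rewrite (IH _ Jk f) ?(IH _ Jk k) //; lia.
Qed.

Lemma depthS k : (k < n)%N -> depth J k.+1 = (depth J (J k.+1)).+1.
Proof.
by move=> kn; rewrite {1}/depth /= depth_fuelE //; have := @J_lt k.+1; lia.
Qed.

Lemma dist_fuelE f i j : (i + j <= f)%N -> (i <= n)%N -> (j <= n)%N ->
  dist_fuel J f i j = tdist J i j.
Proof.
rewrite /tdist; move Es : (i + j)%N => s.
elim/ltn_ind: s f i j Es => s IH [|f] i j Es; first by case: s {IH} Es.
move=> sf i_n j_n; case: s IH Es sf => [|s] IH Es sf.
  by have [-> ->] : i = 0%N /\ j = 0%N by lia.
rewrite /=; case: eqP => // /eqP ij; case: ltnP => ji.
  have Ji : (J i < i)%N by apply: J_lt; lia.
  by rewrite (IH (J i + j)%N _ f) ?(IH (J i + j)%N _ s) //; lia.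
have Jj : (J j < j)%N by apply: J_lt; lia.
by rewrite (IH (i + J j)%N _ f) ?(IH (i + J j)%N _ s) //; lia.
Qed.

Lemma tdistS i k : (i <= k)%N -> (k < n)%N ->
  tdist J i k.+1 = (tdist J i (J k.+1)).+1.
Proof.
move=> ik kn; rewrite {1}/tdist addnS /=.
have Jk : (J k.+1 < k.+1)%N by rewrite J_lt.
have -> : (i == k.+1) = false by apply/negbTE; lia.
have -> : (k.+1 < i)%N = false by apply/negbTE; lia.
by rewrite dist_fuelE //; lia.
Qed.

Lemma tdist_refl i : tdist J i i = 0%N.
Proof. by case: i => [|i] //=; rewrite /tdist addnS /= eqxx. Qed.

Lemma tdist_sym i j : tdist J i j = tdist J j i.
Proof.
rewrite /tdist [(j + i)%N]addnC; move: (i + j)%N => f.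
elim: f i j => // f IH i j /=; rewrite eq_sym.
by case: ltngtP => // _; rewrite IH.
Qed.

Lemma depth_in_tree_of m i : (m <= n)%N -> (i <= m)%N ->
  depth_in (tree_of J m) i = depth J i.
Proof.
elim: m i => [|m IH] i mn im; first by have -> : i = 0%N by lia.
have Jm : (J m.+1 < m.+1)%N by rewrite J_lt.
rewrite /= depth_in_add_child ?in_cons ?mem_tree_of ?uniq_tree_of ?ltnn ?(ltnW mn) //;
  last by rewrite -leq_eqVlt.
case: eqP => [->|]; first by rewrite depthS // IH // ltnW.
by move=> ?; rewrite IH //; lia.
Qed.

Lemma dist_in_tree_of m i j : (m <= n)%N -> (i <= m)%N -> (j <= m)%N ->
  dist_in (tree_of J m) i j = tdist J i j.
Proof.
elim: m i j => [|m IH] i j mn im jm.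
  by have [-> ->] : i = 0%N /\ j = 0%N by lia.
wlog ij : i j im jm / (i <= j)%N.
  by move=> wlog_ij; have [/wlog_ij->//|/ltnW/wlog_ij] := leqP i j;
    rewrite dist_in_sym tdist_sym => ->.
have Jm : (J m.+1 < m.+1)%N by rewrite J_lt.
have [->|ij_neq] := eqVneq i j; first by rewrite dist_in_refl tdist_refl.
have {}im : (i <= m)%N by lia.
rewrite /= dist_in_add_child ?in_cons ?mem_tree_of ?uniq_tree_of ?ltnn ?(ltnW mn) //;
  last by rewrite -leq_eqVlt.
case: eqP => [->|?]; first by rewrite tdistS // IH // ltnW.
by rewrite IH //; lia.
Qed.

Lemma big_vertices_tree_of m (F : nat -> nat) : (m <= n)%N ->
  (\sum_(i <- vertices (tree_of J m)) F i = \sum_(i < m.+1) F i)%N.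
Proof.
move=> mn; rewrite (perm_big _ (perm_vertices_tree_of mn)).
by rewrite -[iota 0 m.+1]/(index_iota 0 m.+1) big_mkord.
Qed.

Lemma total_length_tree_of m : (m <= n)%N ->
  total_length m.+1 J = path_length (tree_of J m).
Proof.
move=> mn; rewrite path_lengthE ?uniq_tree_of // big_vertices_tree_of //.
by apply: eq_bigr => i _; rewrite depth_in_tree_of // -ltnS.
Qed.

Lemma wiener_tree_of m : (m <= n)%N -> wiener m.+1 J = wiener_index (tree_of J m).
Proof.
elim: m => [|m IH] mn; first by rewrite /wiener big_ord1 big1 // => i; case: i => -[].
have Jm : (J m.+1 < m.+1)%N by rewrite J_lt.
rewrite /= wiener_index_add_child ?mem_tree_of ?uniq_tree_of ?(ltnW mn) //.
rewrite -(IH (ltnW mn)) big_vertices_tree_of ?(ltnW mn) // /wiener big_ord_recr /=.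
rewrite [X in (_ + X)%N]big1 ?addn0; last first.
  by move=> i; rewrite ltnNge -ltnS ltn_ord.
rewrite -big_split; apply: eq_bigr => i _ /=.
rewrite [LHS]big_mkcond big_ord_recr /= -big_mkcond ltn_ord; congr (_ + _)%N.
have im : (i <= m)%N by rewrite -ltnS.
by rewrite tdistS // dist_in_tree_of // ltnW.
Qed.

End tree_of.

(** * The growth of Hoppe trees *)

Section growth.
Variable R : realType.
Implicit Types (theta c : R) (b : btree) (F G : btree -> R).

Fixpoint growths theta b : seq (R * btree) :=
  match b with
  | Leaf l => [:: (theta, Join (Leaf l) (Leaf 0))]
  | Join r s => [seq (q.1, Join q.2 s) | q <- growths theta r]
                ++ [seq (q.1, Join r q.2) | q <- growths 1 s]
  end.

Inductive grows : btree -> btree -> Prop :=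
| GrowsLeaf l : grows (Leaf l) (Join (Leaf l) (Leaf 0))
| GrowsLeft r r' s of grows r r' : grows (Join r s) (Join r' s)
| GrowsRight r s s' of grows s s' : grows (Join r s) (Join r s').

Definition growth_sum theta F b : R := \sum_(q <- growths theta b) q.1 * F q.2.

Definition growth_rate theta b : R := theta + (nverts b)%:R - 1.

Definition growth_kernel theta b : seq (R * btree) :=
  [seq (q.1 / growth_rate theta b, q.2) | q <- growths theta b].

Lemma grows_nverts b b' : grows b b' -> nverts b' = (nverts b).+1.
Proof. by elim => //= r r' s _ -> //; rewrite addnS. Qed.

Lemma growths_grows theta b q : q \in growths theta b -> grows b q.2.
Proof.
elim: b theta q => [l|r IHr s IHs] theta q /=.
  by rewrite mem_seq1 => /eqP ->; constructor.
by rewrite mem_cat => /orP[] /mapP[p pb ->]; constructor; [exact: IHr pb|exact: IHs pb].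
Qed.

Lemma growths_ge0 theta b : 0 <= theta -> weights_ge0 (growths theta b).
Proof.
elim: b theta => [l|r IHr s IHs] theta t0; first by rewrite /weights_ge0 /= t0.
by rewrite /weights_ge0 all_cat !all_map; apply/andP; split; [exact: IHr|exact: IHs].
Qed.

Lemma growth_sum_leaf theta F l :
  growth_sum theta F (Leaf l) = theta * F (Join (Leaf l) (Leaf 0)).
Proof. by rewrite /growth_sum big_seq1. Qed.

Lemma growth_sum_join theta F r s : growth_sum theta F (Join r s) =
  growth_sum theta (fun r' => F (Join r' s)) r
  + growth_sum 1 (fun s' => F (Join r s')) s.
Proof. by rewrite /growth_sum big_cat !big_map. Qed.

Lemma eq_growth_sum theta F G b : (forall b', grows b b' -> F b' = G b') ->
  growth_sum theta F b = growth_sum theta G b.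
Proof.
move=> FG; rewrite /growth_sum !big_seq; apply: eq_bigr => q qb.
by rewrite FG //; exact: growths_grows qb.
Qed.

Lemma le_growth_sum theta F G b : 0 <= theta ->
  (forall b', grows b b' -> F b' <= G b') ->
  growth_sum theta F b <= growth_sum theta G b.
Proof.
move=> t0 FG; rewrite /growth_sum !big_seq; apply: ler_sum => q qb.
have /allP/(_ _ qb) q0 := growths_ge0 b t0.
by rewrite ler_wpM2l // FG //; exact: growths_grows qb.
Qed.

Lemma growth_sumD theta F G b : growth_sum theta (fun b' => F b' + G b') b =
  growth_sum theta F b + growth_sum theta G b.
Proof. by rewrite -big_split; apply: eq_bigr => q _; rewrite mulrDr. Qed.

Lemma growth_sumZ theta c F b :
  growth_sum theta (fun b' => c * F b') b = c * growth_sum theta F b.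
Proof. by rewrite /growth_sum big_distrr; apply: eq_bigr => q _; rewrite mulrCA. Qed.

Lemma growth_sum_cst theta c b :
  growth_sum theta (fun=> c) b = growth_rate theta b * c.
Proof.
rewrite /growth_rate; elim: b theta => [l|r IHr s IHs] theta.
  by rewrite growth_sum_leaf /= addrK.
by rewrite growth_sum_join IHr IHs /= natrD; ring.
Qed.

Lemma transition_growth theta F b :
  transition (growth_kernel theta) F b = growth_sum theta F b / growth_rate theta b.
Proof.
rewrite /transition big_map /growth_sum big_distrl /=.
by apply: eq_bigr => q _; rewrite mulrAC.
Qed.

Section kernel.
Variable theta : R.
Hypothesis theta_gt0 : 0 < theta.

Lemma growth_rate_gt0 b : 0 < growth_rate theta b.
Proof.
by rewrite /growth_rate -addrA ltr_pwDl // subr_ge0 ler1n nverts_gt0.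
Qed.

Lemma growth_kernel_ge0 b : weights_ge0 (growth_kernel theta b).
Proof.
apply/allP => _ /mapP[q qb ->] /=.
have /allP/(_ _ qb) q0 := growths_ge0 b (ltW theta_gt0).
by rewrite divr_ge0 // ltW // growth_rate_gt0.
Qed.

Lemma growth_kernel_mass b : mass (growth_kernel theta b) = 1.
Proof.
have := transition_growth theta (fun=> 1) b.
rewrite growth_sum_cst mulr1 divff ?gt_eqF ?growth_rate_gt0 // => <-.
by apply: eq_bigr => q _; rewrite mulr1.
Qed.

End kernel.

End growth.

(* The expectation over Hoppe trees with [N + 1] vertices. *)
Notation hoppe_expect theta := (expect (growth_kernel theta) (Leaf 0)).

Section hoppe_expect.
Variables (R : realType) (theta : R).
Hypothesis theta_gt0 : 0 < theta.
Implicit Types (F G : btree -> R) (N : nat) (c : R).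
Local Notation E := (hoppe_expect theta).

Lemma nverts_states N b :
  b \in states (growth_kernel theta) (Leaf 0) N -> nverts b = N.+1.
Proof.
elim: N b => [|N IH] b /=; first by rewrite mem_seq1 => /eqP ->.
move=> /flatten_mapP[b' /IH b'N] /mapP[_ /mapP[q qb' ->] ->] /=.
by rewrite (grows_nverts (growths_grows qb')) b'N.
Qed.

Lemma growth_rateN b N : nverts b = N.+1 -> growth_rate theta b = theta + N%:R.
Proof. by move=> bN; rewrite /growth_rate bN -natr1 addrA addrK. Qed.

Lemma eq_hoppe_expect N F G : (forall b, nverts b = N.+1 -> F b = G b) ->
  E N F = E N G.
Proof. by move=> FG; apply: eq_expect => b /nverts_states; exact: FG. Qed.

Lemma le_hoppe_expect N F G : (forall b, nverts b = N.+1 -> F b <= G b) ->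
  E N F <= E N G.
Proof.
move=> FG; apply: le_expect => [b|b /nverts_states]; last exact: FG.
exact: growth_kernel_ge0.
Qed.

Lemma hoppe_expect_cst N c : E N (fun=> c) = c.
Proof. exact/expect_cst/growth_kernel_mass. Qed.

Lemma hoppe_expectS N F : E N.+1 F = E N (growth_sum theta F) / (theta + N%:R).
Proof.
rewrite expectS mulrC -expectZ; apply: eq_hoppe_expect => b bN.
by rewrite transition_growth (growth_rateN bN) mulrC.
Qed.

Lemma hoppe_expect_growth_sum N F :
  E N (growth_sum theta F) = (theta + N%:R) * E N.+1 F.
Proof. by rewrite hoppe_expectS mulrC divfK // gt_eqF // ltr_wpDr. Qed.

Lemma growth_sum_expect (theta' : R) N (F : btree -> btree -> R) r :
  growth_sum theta' (fun r' => E N (F r')) r =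
  E N (fun s => growth_sum theta' (fun r' => F r' s) r).
Proof.
rewrite /growth_sum /expect; under eq_bigr do rewrite big_distrr /=.
rewrite exchange_big; apply: eq_bigr => p _; rewrite big_distrr /=.
by apply: eq_bigr => q _; rewrite mulrCA.
Qed.

End hoppe_expect.

Section hoppe_law.
Variables (R : realType) (theta : R).
Hypothesis theta_gt0 : 0 < theta.

Lemma growth_sum_unlabel F b n : uniq (vertices b) ->
  growth_sum theta F (unlabel b) = \sum_(j <- vertices b)
    (if j == root_vertex b then theta else 1) * F (unlabel (add_child b j n)).
Proof.
elim: b theta F => [l|r IHr s IHs] t F /=.
  by rewrite growth_sum_leaf big_seq1 eqxx.
rewrite cat_uniq => /and3P[r_uniq /hasPn disj s_uniq].
rewrite growth_sum_join IHr // IHs // big_cat !big_seq /=; congr (_ + _).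
  apply: eq_bigr => j jr; rewrite (@add_child_notin s) //.
  by apply/negP => /disj /=; rewrite jr.
apply: eq_bigr => j js; have jr := disj _ js.
rewrite (@add_child_notin r) //= if_same ifF //.
by apply: contraNF jr => /eqP -> /=; exact: root_vertex_in.
Qed.

Definition set_parent (J : nat -> nat) (n j : nat) : nat -> nat :=
  fun k => if k == n then j else J k.

Lemma tree_of_set_parent J n j m : (m < n)%N ->
  tree_of (set_parent J n j) m = tree_of J m.
Proof.
elim: m => //= m IH mn; rewrite IH ?(ltnW mn) // /set_parent ifF //.
by apply/negbTE; rewrite neq_ltn mn.
Qed.

Section parent_vectors.
Variable n : nat.
Local Notation parents m := {ffun 'I_m -> 'I_m}.

Definition extend_parents (x : parents n.+1 * 'I_n.+1) : parents n.+2 :=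
  [ffun k : 'I_n.+2 => inord (if (k < n.+1)%N then x.1 (inord k) : nat else x.2)].

Definition restrict_parents (p : parents n.+2) : parents n.+1 * 'I_n.+1 :=
  ([ffun k : 'I_n.+1 => inord (p (inord k))], inord (p ord_max)).

Lemma extend_parentsE x (k : 'I_n.+2) : extend_parents x k =
  (if (k < n.+1)%N then x.1 (inord k) : nat else x.2) :> nat.
Proof. by rewrite ffunE inordK //; case: ifP => _; exact: ltnW (ltn_ord _). Qed.

Lemma extend_parents_inord x (k : 'I_n.+1) :
  extend_parents x (inord k) = x.1 k :> nat.
Proof.
have k_lt : (k < n.+2)%N := ltnW (ltn_ord k).
by rewrite extend_parentsE (inordK k_lt) ltn_ord inord_val.
Qed.

Lemma extend_parents_max x : extend_parents x ord_max = x.2 :> nat.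
Proof. by rewrite extend_parentsE ltnn. Qed.

Lemma extend_parentsK : cancel extend_parents restrict_parents.
Proof.
case=> p j; rewrite /restrict_parents extend_parents_max inord_val.
by congr (_, _); apply/ffunP => k; rewrite ffunE extend_parents_inord inord_val.
Qed.

Lemma restrict_parentsK (p : parents n.+2) :
  valid_parents p -> extend_parents (restrict_parents p) = p.
Proof.
move=> /forallP p_valid; apply/ffunP => k; apply/ord_inj; rewrite extend_parentsE.
have := p_valid k; case: (ltnP k n.+1) => [kn|nk].
  have inord_k : (inord k : 'I_n.+1) = k :> nat by rewrite inordK.
  rewrite ffunE inord_k inord_val.
  case: eqP => [_ /eqP ->|_ pk]; rewrite inordK //; exact: ltn_trans pk kn.
have -> : k = ord_max by apply/ord_inj/anti_leq; rewrite nk -ltnS ltn_ord.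
by move=> /= pk; rewrite inordK.
Qed.

Lemma valid_extend_parents x : valid_parents (extend_parents x) = valid_parents x.1.
Proof.
apply/forallP/forallP => x_valid k.
  have := x_valid (inord k); rewrite extend_parents_inord inordK //.
  exact: ltnW (ltn_ord k).
have := ltn_ord k; rewrite ltnS leq_eqVlt => /predU1P[kn|kn].
  by rewrite extend_parentsE kn ltnn /=.
by have := x_valid (inord k); rewrite extend_parentsE kn inordK.
Qed.

Lemma parent_fun_extend x :
  parent_fun (extend_parents x) = set_parent (parent_fun x.1) n.+1 x.2.
Proof.
apply/funext => k; rewrite /parent_fun /set_parent.
case: insubP => [i _ <-|] /=.
  rewrite extend_parentsE; case: eqP => [->|/eqP i_n]; first by rewrite ltnn.
  have i_lt : (i < n.+1)%N by have := ltn_ord i; lia.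
  rewrite i_lt; case: insubP => [j _ <-|]; last by rewrite i_lt.
  by rewrite /= inord_val.
rewrite -leqNgt => kn; rewrite gtn_eqF //.
by case: insubP => // j; lia.
Qed.

Lemma parents_below_valid (p : parents n.+1) :
  valid_parents p -> parents_below n (parent_fun p).
Proof.
move=> /forallP p_valid k /andP[k0 kn]; rewrite /parent_fun.
case: insubP => [i _ ik|]; last by rewrite ltnS kn.
by have := p_valid i; rewrite ik /= gtn_eqF.
Qed.

End parent_vectors.

Lemma eq_hoppeE n (g h : (nat -> nat) -> R) :
  (forall J, parents_below n J -> g J = h J) ->
  hoppeE theta n.+1 g = hoppeE theta n.+1 h.
Proof.
move=> gh; apply: eq_bigr => p _; rewrite /hoppe_prob.
case: ifP => [p_valid|_]; last by rewrite !mul0r.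
by rewrite gh //; exact: parents_below_valid.
Qed.

Lemma hoppeE_valid n (g : (nat -> nat) -> R) : hoppeE theta n g =
  \sum_(p : {ffun 'I_n -> 'I_n} | valid_parents p)
     hoppe_prob theta p * g (parent_fun p).
Proof.
rewrite [RHS]big_mkcond; apply: eq_bigr => p _; rewrite /hoppe_prob.
by case: ifP; rewrite ?mul0r.
Qed.

Lemma hoppeE1 (g : (nat -> nat) -> R) : hoppeE theta 1 g = g (fun=> 0%N).
Proof.
have parentsE (p : {ffun 'I_1 -> 'I_1}) : p = [ffun=> ord0].
  by apply/ffunP => i; rewrite ffunE; apply/ord_inj; case: (p i) => -[].
rewrite /hoppeE (big_pred1 [ffun=> ord0]) => [|p]; last by rewrite /= (parentsE p) eqxx.
rewrite /hoppe_prob ifT; last by apply/forallP => k; rewrite ffunE ord1.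
rewrite big_pred0 ?mul1r => [|k]; last by rewrite ord1.
congr g; apply/funext => k; rewrite /parent_fun.
by case: insubP => //= i _ _; rewrite ffunE.
Qed.

Lemma hoppeES n (g : (nat -> nat) -> R) : hoppeE theta n.+2 g =
  hoppeE theta n.+1 (fun J => \sum_(j < n.+1)
    (if j == 0 :> nat then theta else 1) / (theta + n%:R) * g (set_parent J n.+1 j)).
Proof.
rewrite !hoppeE_valid.
rewrite (reindex_onto (@extend_parents n) (@restrict_parents n)) /=; last first.
  exact: restrict_parentsK.
under eq_bigl => x do rewrite extend_parentsK eqxx andbT valid_extend_parents.
under [RHS]eq_bigr do rewrite big_distrr /=.
rewrite pair_big_dep /=; apply: eq_big => [x|[p j] /= p_valid]; first by rewrite andbT.
rewrite parent_fun_extend /= mulrA; congr (_ * _).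
rewrite /hoppe_prob valid_extend_parents /= p_valid big_mkcond big_ord_recr /=.
congr (_ * _); last by rewrite extend_parents_max -natr1 addrA addrK.
rewrite [RHS]big_mkcond; apply: eq_bigr => i _ /=.
by rewrite extend_parentsE /= ltn_ord inord_val.
Qed.

Lemma hoppeE_tree_of n F :
  hoppeE theta n.+1 (fun J => F (unlabel (tree_of J n))) = hoppe_expect theta n F.
Proof.
elim: n F => [|n IH] F; first by rewrite hoppeE1 expect0.
rewrite hoppeES hoppe_expectS // mulrC -expectZ -IH; apply: eq_hoppeE => J J_below.
rewrite (growth_sum_unlabel _ n.+1) ?(uniq_tree_of J_below) //.
rewrite (perm_big _ (perm_vertices_tree_of J_below (leqnn n))).
rewrite -[iota 0 n.+1]/(index_iota 0 n.+1) big_mkord big_distrr /=.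
apply: eq_bigr => j _; rewrite root_vertex_tree_of mulrA [_^-1 * _]mulrC.
by rewrite /set_parent eqxx tree_of_set_parent.
Qed.

Lemma hoppeE_wiener_length n (f : R -> R -> R) :
  hoppeE theta n.+1 (fun J => f (wiener n.+1 J)%:R (total_length n.+1 J)%:R) =
  hoppe_expect theta n (fun b => f (wiener_index b)%:R (path_length b)%:R).
Proof.
rewrite -hoppeE_tree_of; apply: eq_hoppeE => J J_below.
rewrite wiener_index_unlabel path_length_unlabel.
by rewrite (wiener_tree_of J_below) // (total_length_tree_of J_below).
Qed.

End hoppe_law.

(** * Moments and martingales *)

Lemma grows_path_length b b' : grows b b' -> (path_length b <= path_length b')%N.
Proof. by elim => //= [r r' s _|r s s' /grows_nverts ->] IH; lia. Qed.

Lemma grows_wiener_index b b' : grows b b' -> (wiener_index b <= wiener_index b')%N.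
Proof.
elim => //= [r r' s g|r s s' g] IH; have := grows_nverts g;
  have := grows_path_length g => T_mono ->.
  have : (nverts s * path_length r <= nverts s * path_length r')%N by rewrite leq_mul.
  by lia.
have : (nverts r * path_length s <= nverts r * path_length s')%N by rewrite leq_mul.
by lia.
Qed.

Section one_step.
Variable R : realType.
Implicit Types (theta : R) (b : btree).
Local Notation n b := ((nverts b)%:R : R).
Local Notation T b := ((path_length b)%:R : R).
Local Notation W b := ((wiener_index b)%:R : R).
Local Notation Q b := ((sqdepth_sum b)%:R : R).

(* [dist i j <= depth i + depth j], summed over [i]. *)
Lemma grows_wiener_index_le b b' : grows b b' ->
  W b' - W b <= T b + n b * (T b' - T b).
Proof.
elim => [l|r r' s g|r s s' g] /=; first by lra.
  by rewrite (grows_nverts g) !natrD !natrM -?natr1; lra.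
have := nverts_gt0 r; have := nverts_gt0 s.
by rewrite (grows_nverts g) !natrD !natrM -?natr1 -!(ltr_nat R); lra.
Qed.

Lemma path_length_sqr_le b : T b ^+ 2 <= n b * Q b.
Proof.
elim: b => [l|r IHr s IHs] /=; first by lra.
have := nverts_gt0 r; have := nverts_gt0 s.
rewrite !natrD -!(ltr_nat R); move: IHr IHs.
set t := T r; set t' := T s; set x := n r; set y := n s.
set q := Q r; set q' := Q s => IHr IHs y0 x0.
suff : 2 * t * (t' + y) <= x * (q' + 2 * t' + y) + y * q by nra.
rewrite -(ler_pM2l (mulr_gt0 x0 y0)).
have left_sqr : y ^+ 2 * t ^+ 2 <= y ^+ 2 * (x * q) by rewrite ler_wpM2l ?sqr_ge0.
have right_sqr : x ^+ 2 * (t' + y) ^+ 2 <= x ^+ 2 * (y * (q' + 2 * t' + y)).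
  by rewrite ler_wpM2l ?sqr_ge0 //; nra.
have := sqr_ge0 (x * (t' + y) - y * t); nra.
Qed.

Lemma growth_sum_path_length theta b :
  growth_sum theta (fun b' => T b') b = growth_rate theta b * (T b + 1) + T b.
Proof.
rewrite /growth_rate; elim: b theta => [l|r IHr s IHs] theta.
  by rewrite growth_sum_leaf /=; ring.
rewrite growth_sum_join.
under [growth_sum theta _ _]eq_growth_sum => r' g do rewrite /= !natrD -addrA.
under [growth_sum 1 _ _]eq_growth_sum => s' g do
  rewrite /= (grows_nverts g) !natrD -addrA addrCA.
by rewrite !growth_sumD !growth_sum_cst IHr IHs /growth_rate /= !natrD -natr1; ring.
Qed.

Lemma growth_sum_wiener_index theta b : growth_sum theta (fun b' => W b') b =
  growth_rate theta b * (W b + n b) + 2 * W b + (theta - 1) * T b.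
Proof.
rewrite /growth_rate; elim: b theta => [l|r IHr s IHs] theta.
  by rewrite growth_sum_leaf /=; ring.
rewrite growth_sum_join.
under [growth_sum theta _ _]eq_growth_sum => r' g.
  rewrite /= (grows_nverts g) (_ : _%:R = W r' + (n s * T r' +
    (W s + (n r + 1) * T s + (n r + 1) * n s))); last first.
    by rewrite !natrD !natrM -?natr1; ring.
  over.
under [growth_sum 1 _ _]eq_growth_sum => s' g.
  rewrite /= (grows_nverts g) (_ : _%:R = W s' + (n r * T s' +
    (W r + (n s + 1) * T r + (n s + 1) * n r))); last first.
    by rewrite !natrD !natrM -?natr1; ring.
  over.
rewrite !growth_sumD !growth_sumZ !growth_sum_cst !growth_sum_path_length IHr IHs.
by rewrite /growth_rate /= !natrD !natrM; ring.
Qed.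

Lemma growth_sum_sqr_path_length theta b :
  growth_sum theta (fun b' => (T b' - T b) ^+ 2) b =
  Q b + 2 * T b + growth_rate theta b.
Proof.
rewrite /growth_rate; elim: b theta => [l|r IHr s IHs] theta.
  by rewrite growth_sum_leaf /=; ring.
rewrite growth_sum_join.
under [growth_sum theta _ _]eq_growth_sum => r' g.
  rewrite /= (_ : _ ^+ 2 = (T r' - T r) ^+ 2); last by rewrite !natrD; ring.
  over.
under [growth_sum 1 _ _]eq_growth_sum => s' g.
  rewrite /= (grows_nverts g) (_ : _ ^+ 2 = (T s' - T s) ^+ 2 +
    (2 * T s' + (1 - 2 * T s))); last by rewrite !natrD -?natr1; ring.
  over.
rewrite !growth_sumD !growth_sumZ !growth_sum_cst !growth_sum_path_length IHr IHs.
by rewrite /growth_rate /= !natrD; ring.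
Qed.

Lemma growth_sum_sqdepth_sum theta b : growth_sum theta (fun b' => Q b') b =
  growth_rate theta b * (Q b + 1) + Q b + 2 * T b.
Proof.
rewrite /growth_rate; elim: b theta => [l|r IHr s IHs] theta.
  by rewrite growth_sum_leaf /=; ring.
rewrite growth_sum_join.
under [growth_sum theta _ _]eq_growth_sum => r' g do rewrite /= !natrD -2!addrA.
under [growth_sum 1 _ _]eq_growth_sum => s' g.
  rewrite /= (grows_nverts g) (_ : _%:R = Q s' +
    (2 * T s' + (Q r + n s + 1))); last by rewrite !natrD -?natr1; ring.
  over.
rewrite !growth_sumD !growth_sumZ !growth_sum_cst !growth_sum_path_length IHr IHs.
by rewrite /growth_rate /= !natrD; ring.
Qed.

End one_step.

Section moments.
Variables (R : realType) (theta : R).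
Hypothesis theta_gt0 : 0 < theta.
Implicit Types (b : btree) (N : nat).
Local Notation T b := ((path_length b)%:R : R).
Local Notation W b := ((wiener_index b)%:R : R).
Local Notation Q b := ((sqdepth_sum b)%:R : R).
Local Notation E := (hoppe_expect theta).
Local Notation kernel := (growth_kernel theta).

Definition theta_harmonic N : R := \sum_(i < N) (theta + i.+1%:R)^-1.
Local Notation H := theta_harmonic.

Lemma theta_harmonicS N : H N.+1 = H N + (theta + N.+1%:R)^-1.
Proof. by rewrite /theta_harmonic big_ord_recr. Qed.

Lemma theta_harmonic_ge0 N : 0 <= H N.
Proof.
by apply: sumr_ge0 => i _; rewrite invr_ge0 addr_ge0 // ltW.
Qed.

Lemma addr_theta_gt0 N : 0 < theta + N%:R.
Proof. by rewrite ltr_wpDr. Qed.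

(* The multiple of [T] turns the Wiener index into an eigenvector, modulo
   constants, of the growth step. *)
Definition adjusted_wiener b : R := W b + (theta - 1) * T b.

Definition mean_path_length N : R := (theta + N%:R) * H N.
Definition mean_adjusted_wiener N : R := (theta + N%:R) * (theta + N.+1%:R) *
  (H N - 2 / (theta + 1) + 2 / (theta + N.+1%:R)).
Definition mean_wiener_index N : R :=
  mean_adjusted_wiener N - (theta - 1) * mean_path_length N.

Lemma expect_path_length N : E N (fun b => T b) = mean_path_length N.
Proof.
elim: N => [|N IH].
  by rewrite expect0 /mean_path_length /theta_harmonic big_ord0 mulr0.
rewrite hoppe_expectS (_ : E N _ = E N (fun b =>
    (theta + N.+1%:R) * T b + (theta + N%:R))); last first.
  apply: eq_hoppe_expect => b bN; rewrite growth_sum_path_length (growth_rateN _ bN).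
  by rewrite -natr1; ring.
rewrite expectD expectZ !hoppe_expect_cst // IH /mean_path_length theta_harmonicS.
have := addr_theta_gt0 N; have := addr_theta_gt0 N.+1; rewrite -natr1.
by move: (N%:R) => x *; field; rewrite ?gt_eqF //=; lra.
Qed.

Lemma growth_sum_adjusted_wiener N b : nverts b = N.+1 ->
  growth_sum theta adjusted_wiener b =
  (theta + N%:R + 2) * adjusted_wiener b + (theta + N%:R) ^+ 2.
Proof.
move=> bN; rewrite growth_sumD growth_sumZ growth_sum_path_length.
by rewrite growth_sum_wiener_index (growth_rateN _ bN) bN -natr1 /adjusted_wiener; ring.
Qed.

Lemma expect_adjusted_wiener N : E N adjusted_wiener = mean_adjusted_wiener N.
Proof.
elim: N => [|N IH].
  rewrite expect0 /mean_adjusted_wiener /theta_harmonic big_ord0 /adjusted_wiener /=.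
  by rewrite sub0r addNr !mulr0 addr0.
rewrite hoppe_expectS (_ : E N _ = E N (fun b =>
    (theta + N%:R + 2) * adjusted_wiener b + (theta + N%:R) ^+ 2)); last first.
  by apply: eq_hoppe_expect => b bN; exact: growth_sum_adjusted_wiener.
rewrite expectD expectZ !hoppe_expect_cst // IH /mean_adjusted_wiener theta_harmonicS.
have := theta_gt0; have := addr_theta_gt0 N; have := ler0n R N; rewrite -?natr1.
by move: (N%:R) => x *; field; rewrite ?gt_eqF //=; lra.
Qed.

Lemma expect_wiener_index N : E N (fun b => W b) = mean_wiener_index N.
Proof.
by rewrite /mean_wiener_index -expect_adjusted_wiener -expect_path_length
  /adjusted_wiener expectD expectZ addrK.
Qed.

Lemma expect_sqdepth_sum_le N :
  E N (fun b => Q b) <= (theta + N%:R) * (1 + H N) ^+ 2.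
Proof.
elim: N => [|N IH].
  by rewrite expect0 mulr_ge0 ?sqr_ge0 // addr0 ltW.
rewrite hoppe_expectS (_ : E N _ = E N (fun b =>
    (theta + N.+1%:R) * Q b + (2 * T b + (theta + N%:R)))); last first.
  apply: eq_hoppe_expect => b bN; rewrite growth_sum_sqdepth_sum (growth_rateN _ bN).
  by rewrite -natr1; ring.
rewrite !expectD !expectZ !hoppe_expect_cst // expect_path_length.
rewrite /mean_path_length theta_harmonicS -[N.+1%:R]natr1.
rewrite ler_pdivrMr ?addr_theta_gt0 //.
have t0 := theta_gt0.
have := ler0n R N; have := theta_harmonic_ge0 N; have := addr_theta_gt0 N.
move: IH; move: (N%:R) (H N) (E N _) => x h q IH s0 h0 x0.
apply: (@le_trans _ _ ((theta + (x + 1)) * ((theta + x) * (1 + h) ^+ 2)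
    + (2 * ((theta + x) * h) + (theta + x)))).
  by rewrite lerD2r ler_wpM2l //; lra.
rewrite -subr_ge0 [X in 0 <= X](_ : _ =
    (theta + x) * (1 + (theta + (x + 1))^-1)); last by field; rewrite gt_eqF //; lra.
by rewrite mulr_ge0 ?addr_ge0 ?invr_ge0 //; lra.
Qed.

Lemma expect_increment_sqr_path_length_le N :
  E N (increment_sqr kernel (fun=> fun b => T b) N) <= 2 * (1 + H N) ^+ 2.
Proof.
rewrite (_ : E N _ = E N (fun b => (theta + N%:R)^-1 * Q b
    + (2 / (theta + N%:R) * T b + 1))); last first.
  apply: eq_hoppe_expect => b bN; have := addr_theta_gt0 N.
  rewrite /increment_sqr transition_growth growth_sum_sqr_path_length.
  by rewrite (growth_rateN _ bN); move: (N%:R) => x s0; field; rewrite gt_eqF.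
rewrite !expectD !expectZ !hoppe_expect_cst // expect_path_length /mean_path_length.
have := expect_sqdepth_sum_le N; rewrite -ler_pdivrMl ?addr_theta_gt0 //.
rewrite [2 / _ * _](_ : _ = 2 * H N); last by field; rewrite gt_eqF ?addr_theta_gt0.
by have := sqr_ge0 (H N); nra.
Qed.

Definition length_martingale N b : R :=
  (T b - mean_path_length N) / (theta + N%:R).
Definition wiener_martingale N b : R :=
  (adjusted_wiener b - mean_adjusted_wiener N)
  / ((theta + N%:R) * (theta + N.+1%:R)).

Lemma length_martingaleP N :
  {in states kernel (Leaf 0) N, forall b,
     transition kernel (length_martingale N.+1) b = length_martingale N b}.
Proof.
move=> b /nverts_states bN; rewrite transition_growth (growth_rateN _ bN).
have -> : growth_sum theta (length_martingale N.+1) b = (theta + N.+1%:R)^-1 *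
    (growth_sum theta (fun b => T b) b
     + growth_sum theta (fun=> - mean_path_length N.+1) b).
  by rewrite -growth_sumD -growth_sumZ; apply: eq_growth_sum => b' _; rewrite mulrC.
rewrite growth_sum_path_length growth_sum_cst (growth_rateN _ bN).
rewrite /length_martingale /mean_path_length theta_harmonicS -?natr1.
have := theta_gt0; have := addr_theta_gt0 N; have := ler0n R N.
by move: (N%:R) => x *; field; rewrite ?gt_eqF //=; lra.
Qed.

Lemma wiener_martingaleP N :
  {in states kernel (Leaf 0) N, forall b,
     transition kernel (wiener_martingale N.+1) b = wiener_martingale N b}.
Proof.
move=> b /nverts_states bN; rewrite transition_growth (growth_rateN _ bN).
have -> : growth_sum theta (wiener_martingale N.+1) b =
    ((theta + N.+1%:R) * (theta + N.+2%:R))^-1 *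
    (growth_sum theta adjusted_wiener b
     + growth_sum theta (fun=> - mean_adjusted_wiener N.+1) b).
  by rewrite -growth_sumD -growth_sumZ; apply: eq_growth_sum => b' _; rewrite mulrC.
rewrite (growth_sum_adjusted_wiener bN) growth_sum_cst (growth_rateN _ bN).
rewrite /wiener_martingale /mean_adjusted_wiener theta_harmonicS -?natr1.
have := theta_gt0; have := addr_theta_gt0 N; have := ler0n R N.
by move: (N%:R) => x *; field; rewrite ?gt_eqF //=; lra.
Qed.

(* The tail of the variances of the martingale increments telescopes. *)
Definition variance_tail N : R := (4 + H N) ^+ 2 / (theta + N.+1%:R).

Lemma variance_tail_ge0 N : 0 <= variance_tail N.
Proof. by rewrite divr_ge0 ?sqr_ge0 ?ltW ?addr_theta_gt0. Qed.

Lemma variance_tail_step N : (1 + H N) ^+ 2 / (theta + N.+1%:R) ^+ 2 <=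
  8 * (variance_tail N - variance_tail N.+1).
Proof.
rewrite /variance_tail theta_harmonicS -[N.+2%:R]natr1.
have m1 : 1 <= theta + N.+1%:R.
  by rewrite -natr1; have := theta_gt0; have := ler0n R N; lra.
have := theta_harmonic_ge0 N; move: m1; set h := H N; rewrite [theta + (_ + 1)]addrA.
set m := theta + N.+1%:R => m1 h0.
have m0 : 0 < m by lra.
rewrite -subr_ge0.
have -> : 8 * ((4 + h) ^+ 2 / m - (4 + (h + m^-1)) ^+ 2 / (m + 1)) -
  (1 + h) ^+ 2 / m ^+ 2 = (8 * m * ((4 + h) ^+ 2 - 2 * (4 + h) - m^-1)
    - (m + 1) * (1 + h) ^+ 2) / (m ^+ 2 * (m + 1)).
  by field; rewrite ?gt_eqF //=; lra.
apply: divr_ge0; last by rewrite mulr_ge0 ?sqr_ge0 //; lra.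
have mV : m^-1 <= 1 by rewrite invf_le1.
have : 8 * m * ((4 + h) ^+ 2 - 2 * (4 + h) - 1) <=
       8 * m * ((4 + h) ^+ 2 - 2 * (4 + h) - m^-1).
  by rewrite ler_wpM2l //; lra.
by nra.
Qed.

Lemma expect_increment_sqr_length_martingale_le N :
  E N (increment_sqr kernel length_martingale N) <=
  144 * (variance_tail N - variance_tail N.+1).
Proof.
have m0 := addr_theta_gt0 N.+1; set m := theta + N.+1%:R in m0.
apply: (@le_trans _ _ (m ^- 2 * E N (increment_sqr kernel (fun=> fun b => T b) N))).
  rewrite -expectZ; apply: le_expect => [b|b bN]; first exact: growth_kernel_ge0.
  apply: (le_trans (increment_sqr_le (growth_kernel_mass theta_gt0) length_martingaleP
    ((T b - mean_path_length N.+1) / m) bN)).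
  rewrite /increment_sqr -transitionZ le_eqVlt; apply/predU1P; left.
  by apply: eq_bigr => q _; rewrite /length_martingale -/m; field; rewrite gt_eqF.
apply: (@le_trans _ _ (m ^- 2 * (2 * (1 + H N) ^+ 2))).
  by rewrite ler_wpM2l ?invr_ge0 ?sqr_ge0 // expect_increment_sqr_path_length_le.
have : 0 <= (1 + H N) ^+ 2 / m ^+ 2 by rewrite divr_ge0 ?sqr_ge0.
by have := variance_tail_step N; rewrite mulrCA [_^-1 * _]mulrC -/m; lra.
Qed.

Lemma adjusted_wiener_increment_sqr_le N b b' : nverts b = N.+1 -> grows b b' ->
  (adjusted_wiener b' - adjusted_wiener b) ^+ 2 <=
  2 * (theta + N.+1%:R) * Q b + 8 * (theta + N.+1%:R) ^+ 2 * (T b' - T b) ^+ 2.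
Proof.
move=> bN g; have := path_length_sqr_le R b; have := grows_wiener_index_le R g.
have := grows_path_length g; have := grows_wiener_index g; rewrite -!(ler_nat R) bN.
have t0 := theta_gt0; have := addr_theta_gt0 N.+1; set m := theta + N.+1%:R => m0.
move=> W_mono T_mono W_le T2_le; have := ler0n R (path_length b) => T0.
have nm : N.+1%:R <= m by rewrite /m; lra.
have tm : `|theta - 1| <= m by rewrite /m -natr1 ler_norml; have := ler0n R N; lra.
set dT := T b' - T b in W_le *; set dW := W b' - W b in W_le.
have dT0 : 0 <= dT by rewrite /dT; lra.
have dW0 : 0 <= dW by rewrite /dW; lra.
rewrite (_ : adjusted_wiener b' - _ = dW + (theta - 1) * dT); last first.
  by rewrite /adjusted_wiener /dW /dT; ring.
have diff_le : `|dW + (theta - 1) * dT| <= T b + 2 * m * dT.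
  apply: (le_trans (ler_normD _ _)).
  rewrite (ger0_norm dW0) normrM (ger0_norm dT0).
  have : N.+1%:R * dT <= m * dT by rewrite ler_wpM2r.
  have : `|theta - 1| * dT <= m * dT by rewrite ler_wpM2r.
  by lra.
rewrite -real_normK ?num_real //.
apply: (@le_trans _ _ ((T b + 2 * m * dT) ^+ 2)).
  by rewrite ler_sqr ?nnegrE // ?(le_trans _ diff_le).
have : N.+1%:R * Q b <= m * Q b by rewrite ler_wpM2r.
by have := sqr_ge0 (T b - 2 * m * dT); nra.
Qed.

Lemma increment_sqr_wiener_martingale_le N b : b \in states kernel (Leaf 0) N ->
  increment_sqr kernel wiener_martingale N b <=
  ((theta + N.+1%:R) * (theta + N.+2%:R)) ^- 2 *
  (2 * (theta + N.+1%:R) * Q b + 8 * (theta + N.+1%:R) ^+ 2 *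
   increment_sqr kernel (fun=> fun b => T b) N b).
Proof.
move=> bN; have m0 := addr_theta_gt0 N.+1; have m'0 := addr_theta_gt0 N.+2.
set m := theta + N.+1%:R in m0 *; set m' := theta + N.+2%:R in m'0 *.
apply: (le_trans (increment_sqr_le (growth_kernel_mass theta_gt0) wiener_martingaleP
  ((adjusted_wiener b - mean_adjusted_wiener N.+1) / (m * m')) bN)).
rewrite /increment_sqr.
rewrite -[2 * m * Q b](transition_cst (growth_kernel_mass theta_gt0) _ b).
rewrite -!transitionZ -transitionD -transitionZ !transition_growth.
rewrite ler_pM2r ?invr_gt0 ?growth_rate_gt0 //.
apply: le_growth_sum => [|b' g]; first exact: ltW.
rewrite [leLHS](_ : _ = (m * m') ^- 2 * (adjusted_wiener b' - adjusted_wiener b) ^+ 2).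
  rewrite ler_wpM2l ?invr_ge0 ?sqr_ge0 //.
  exact: adjusted_wiener_increment_sqr_le (nverts_states bN) g.
by rewrite /wiener_martingale -/m -/m'; field; rewrite !gt_eqF.
Qed.

Lemma expect_increment_sqr_wiener_martingale_le N :
  E N (increment_sqr kernel wiener_martingale N) <=
  144 * (variance_tail N - variance_tail N.+1).
Proof.
have m0 := addr_theta_gt0 N.+1; have m'0 := addr_theta_gt0 N.+2.
have := @increment_sqr_wiener_martingale_le N.
set m := theta + N.+1%:R in m0 *; set m' := theta + N.+2%:R in m'0 * => incr_le.
apply: (le_trans (le_expect (growth_kernel_ge0 theta_gt0) incr_le)).
rewrite expectZ expectD !expectZ.
have mm' : m <= m' by rewrite lerD2l ler_nat.
apply: (@le_trans _ _ ((m * m') ^- 2 *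
    (2 * m * (m * (1 + H N) ^+ 2) + 8 * m ^+ 2 * (2 * (1 + H N) ^+ 2)))).
  rewrite ler_wpM2l ?invr_ge0 ?sqr_ge0 //; apply: lerD.
    rewrite ler_wpM2l ?mulr_ge0 ?(ltW m0) // (le_trans (expect_sqdepth_sum_le N)) //.
    by rewrite ler_wpM2r ?sqr_ge0 // lerD2l ler_nat.
  rewrite ler_wpM2l ?mulr_ge0 ?(ltW m0) //.
  exact: expect_increment_sqr_path_length_le.
apply: (@le_trans _ _ (18 * ((1 + H N) ^+ 2 / m ^+ 2))).
  rewrite [leLHS](_ : _ = 18 * ((1 + H N) ^+ 2 / m' ^+ 2)); last first.
    by field; rewrite !gt_eqF.
  rewrite ler_pM2l // ler_wpM2l ?sqr_ge0 // lef_pV2 ?posrE ?exprn_gt0 //.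
  by rewrite ler_pXn2r ?nnegrE ?(ltW m0) ?(ltW m'0).
by have := variance_tail_step N; rewrite -/m; lra.
Qed.

End moments.

(** * The limit law *)

Section pair_law.
Context d (T : measurableType d) (R : realType) (P : probability T R).
Variables X Y : T -> R.
Hypotheses (X2 : X \in Lfun P 2%:E) (Y2 : Y \in Lfun P 2%:E).
Implicit Types (h : R * R -> R).

Let measurable_pair : measurable_fun setT (fun t => (X t, Y t)).
Proof.
exact: measurable_fun_pair (Lfun2_measurable X2) (Lfun2_measurable Y2).
Qed.

Definition pair_law : probability (R * R)%type R :=
  distribution P (mfun_Sub (mem_set measurable_pair)).

Lemma integrable_pair_law h : measurable_fun setT h ->
  P.-integrable setT (EFin \o (fun t => h (X t, Y t))) ->
  pair_law.-integrable setT (EFin \o h).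
Proof.
by move=> mh inth; apply: integrable_pushforward => //; exact/measurable_EFinP.
Qed.

Lemma integral_pair_law h : measurable_fun setT h ->
  P.-integrable setT (EFin \o (fun t => h (X t, Y t))) ->
  (\int[pair_law]_x (h x)%:E = (\int[P]_t h (X t, Y t))%:E)%E.
Proof.
move=> mh inth; rewrite EFin_Rintegral // integral_distribution //.
exact/measurable_EFinP.
Qed.

Lemma lipschitz_pair_integrable L h : L.-lipschitz h ->
  P.-integrable setT (EFin \o (fun t => h (X t, Y t))).
Proof.
move=> hL; have mh := lipschitz_measurable hL.
have intB : P.-integrable setT
    (EFin \o (fun t => `|h (0, 0)| + L * (`|X t| + `|Y t|))).
  by apply: Lfun2_integrable; rewrite Lfun2D ?Lfun2Z ?Lfun2D ?Lfun2_norm ?Lfun2_cst.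
apply: le_integrable intB => //.
  by apply/measurable_EFinP; exact: (measurableT_comp mh measurable_pair).
move=> t _; rewrite /= lee_fin [leRHS]ger0_norm; last first.
  by rewrite addr_ge0 ?mulr_ge0 ?addr_ge0 // (lipschitz_ge0 hL).
have /lipschitzP/(_ (X t, Y t) (0, 0)) := hL; rewrite prod_normE /= !subr0 => h_le.
have := lerB_dist (h (X t, Y t)) (h (0, 0)).
have : L * Num.max `|X t| `|Y t| <= L * (`|X t| + `|Y t|).
  by rewrite ler_wpM2l ?(lipschitz_ge0 hL) // ge_max lerDl lerDr !normr_ge0.
by lra.
Qed.

End pair_law.

Section limit_law.
Variables (R : realType) (theta : R).
Hypothesis theta_gt0 : 0 < theta.
Implicit Types (b : btree) (N : nat) (h : R * R -> R).
Local Notation E := (hoppe_expect theta).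
Local Notation L2 := (Lfun (unif01 R) 2%:E).
Local Notation tree := (chain (growth_kernel theta) (Leaf 0)).

Definition normalized_wiener N b : R :=
  ((wiener_index b)%:R - mean_wiener_index theta N) / N.+1%:R ^+ 2.
Definition normalized_length N b : R :=
  ((path_length b)%:R - mean_path_length theta N) / N.+1%:R.
Definition normalized N b : R * R := (normalized_wiener N b, normalized_length N b).

Lemma hoppe_normE_expect N f :
  hoppe_normE theta N.+1 f = E N (fun b => f (normalized N b)).
Proof.
rewrite /hoppe_normE /hoppe_normalized.
rewrite (hoppeE_wiener_length theta_gt0 N (fun w _ => w)).
rewrite (hoppeE_wiener_length theta_gt0 N (fun _ t => t)).
rewrite expect_wiener_index // expect_path_length //.
exact: (hoppeE_wiener_length theta_gt0 N (fun w t => f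
  ((w - mean_wiener_index theta N) / N.+1%:R ^+ 2,
   (t - mean_path_length theta N) / N.+1%:R))).
Qed.

Lemma expect_normalized_wiener N : E N (normalized_wiener N) = 0.
Proof.
under eq_hoppe_expect do rewrite /normalized_wiener mulrC.
by rewrite expectZ expectB expect_wiener_index // hoppe_expect_cst // subrr mulr0.
Qed.

Lemma expect_normalized_length N : E N (normalized_length N) = 0.
Proof.
under eq_hoppe_expect do rewrite /normalized_length mulrC.
by rewrite expectZ expectB expect_path_length // hoppe_expect_cst // subrr mulr0.
Qed.

Lemma tree_Lfun2 (F : btree -> R) N : (fun u => F (tree N u)) \in L2.
Proof.
exact: chain_Lfun2 (growth_kernel_ge0 theta_gt0) (growth_kernel_mass theta_gt0) F N.
Qed.

Lemma Rintegral_tree (F : btree -> R) N : \int[unif01 R]_u F (tree N u) = E N F.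
Proof.
exact: Rintegral_chain (growth_kernel_ge0 theta_gt0) (growth_kernel_mass theta_gt0) F N.
Qed.

Lemma tree_martingale_L2cvg (m : nat -> btree -> R) :
  (forall N, {in states (growth_kernel theta) (Leaf 0) N, forall b,
     transition (growth_kernel theta) (m N.+1) b = m N b}) ->
  (forall N, E N (increment_sqr (growth_kernel theta) m N) <=
     144 * (variance_tail theta N - variance_tail theta N.+1)) ->
  exists2 g, g \in L2 & L2cvg (unif01 R) (fun N u => m N (tree N u)) g.
Proof.
move=> mart incr; have := martingale_L2_cvg (growth_kernel_ge0 theta_gt0)
  (growth_kernel_mass theta_gt0) mart (D := fun N => 144 * variance_tail theta N).
apply=> N; first by rewrite mulr_ge0 // variance_tail_ge0.
by rewrite -mulrBr incr.
Qed.

Definition size_ratio N : R := (theta + N%:R) / N.+1%:R.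

Lemma cvg_size_ratio : size_ratio @ \oo --> (1 : R).
Proof.
rewrite (_ : size_ratio = fun N => 1 + (theta - 1) * harmonic N); last first.
  apply/funext => N; rewrite /size_ratio /harmonic /= -[N.+1%:R]natr1.
  by have := ler0n R N; move: (N%:R) => x x0; field; rewrite gt_eqF //; lra.
rewrite -[X in _ --> X](_ : 1 + (theta - 1) * 0 = 1); last by rewrite mulr0 addr0.
apply: cvgD; first exact: cvg_cst.
by apply: cvgM; [exact: cvg_cst|exact: cvg_harmonic].
Qed.

Lemma normalized_length_martingale N b :
  normalized_length N b = size_ratio N * length_martingale theta N b.
Proof.
rewrite /normalized_length /length_martingale /size_ratio -natr1.
have t0 := theta_gt0; have := ler0n R N; move: (mean_path_length _ _) (N%:R) => t x x0.
by field; rewrite !gt_eqF //; lra.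
Qed.

Lemma normalized_wiener_martingale N b : normalized_wiener N b =
  size_ratio N * (size_ratio N + harmonic N) * wiener_martingale theta N b
  + - (theta - 1) * (size_ratio N * harmonic N) * length_martingale theta N b.
Proof.
rewrite /normalized_wiener /wiener_martingale /length_martingale /size_ratio.
rewrite /mean_wiener_index /adjusted_wiener /harmonic /= -[N.+1%:R]natr1.
have t0 := theta_gt0; have := ler0n R N.
move: (mean_path_length _ _) (mean_adjusted_wiener _ _) (N%:R) => t w x x0.
by field; rewrite !gt_eqF //; lra.
Qed.

Lemma normalized_length_L2cvg : exists2 Y, Y \in L2 &
  L2cvg (unif01 R) (fun N u => normalized_length N (tree N u)) Y.
Proof.
have [g g2 mg] := tree_martingale_L2cvg (length_martingaleP theta_gt0)
  (expect_increment_sqr_length_martingale_le theta_gt0).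
exists (fun u => 1 * g u); first exact: Lfun2Z.
rewrite (_ : (fun N u => _) = fun N u =>
    size_ratio N * length_martingale theta N (tree N u)); last first.
  by apply/funext => N; apply/funext => u; rewrite normalized_length_martingale.
by apply: L2cvgZ cvg_size_ratio => // N; exact: tree_Lfun2.
Qed.

Lemma normalized_wiener_L2cvg : exists2 X, X \in L2 &
  L2cvg (unif01 R) (fun N u => normalized_wiener N (tree N u)) X.
Proof.
have [g g2 mg] := tree_martingale_L2cvg (length_martingaleP theta_gt0)
  (expect_increment_sqr_length_martingale_le theta_gt0).
have [k k2 mk] := tree_martingale_L2cvg (wiener_martingaleP theta_gt0)
  (expect_increment_sqr_wiener_martingale_le theta_gt0).
have harmonic0 : harmonic @ \oo --> (0 : R) := cvg_harmonic.
have wiener_factor :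
    (fun N => size_ratio N * (size_ratio N + harmonic N)) @ \oo --> (1 * (1 + 0) : R).
  by apply: cvgM cvg_size_ratio _; apply: cvgD cvg_size_ratio harmonic0.
have length_factor : (fun N => - (theta - 1) * (size_ratio N * harmonic N)) @ \oo -->
    (- (theta - 1) * (1 * 0) : R).
  by apply: cvgM; [exact: cvg_cst|exact: cvgM cvg_size_ratio harmonic0].
exists (fun u => 1 * (1 + 0) * k u + - (theta - 1) * (1 * 0) * g u).
  by rewrite Lfun2D ?Lfun2Z.
rewrite (_ : (fun N u => _) = fun N u =>
    size_ratio N * (size_ratio N + harmonic N) * wiener_martingale theta N (tree N u)
    + - (theta - 1) * (size_ratio N * harmonic N)
      * length_martingale theta N (tree N u)); last first.
  by apply/funext => N; apply/funext => u; rewrite normalized_wiener_martingale.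
apply: L2cvgD; rewrite ?Lfun2Z //; try by move=> N; rewrite Lfun2Z ?tree_Lfun2.
- by apply: L2cvgZ wiener_factor => // N; exact: tree_Lfun2.
- by apply: L2cvgZ length_factor => // N; exact: tree_Lfun2.
Qed.

Definition lipschitz_rate (mu : probability (R * R)%type R) (delta : nat -> R) : Prop :=
  forall L h N, L.-lipschitz h ->
    `|E N (fun b => h (normalized N b)) - \int[mu]_x h x| <= L * delta N.

Lemma cvg_hoppe_normE h (l : R) :
  (fun N => E N (fun b => h (normalized N b))) @ \oo --> l ->
  (fun n => (hoppe_normE theta n h)%:E) @ \oo --> l%:E.
Proof.
move=> hl; rewrite -(cvg_shiftS (fun n => (hoppe_normE theta n h)%:E)).
apply: cvg_EFin; first exact: nearW.
by under eq_fun do rewrite /= hoppe_normE_expect.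
Qed.

Lemma cvg_lipschitz_rate mu delta L h :
  lipschitz_rate mu delta -> delta @ \oo --> (0 : R) -> L.-lipschitz h ->
  (fun N => E N (fun b => h (normalized N b))) @ \oo --> \int[mu]_x h x.
Proof.
move=> mu_rate delta0 hL; apply/cvgrPdist_le => e e0.
have /cvgrPdist_le/(_ e e0) : (fun N => L * delta N) @ \oo --> (0 : R).
  by rewrite -(mulr0 L); apply: cvgM => //; exact: cvg_cst.
apply: filterS => N; rewrite sub0r normrN distrC => delta_le.
exact: le_trans (mu_rate L h N hL) (le_trans (ler_norm _) delta_le).
Qed.

Lemma cvg_hoppe_normE_bounded_continuous mu delta f :
  lipschitz_rate mu delta -> delta @ \oo --> (0 : R) -> bounded_continuous f ->
  (fun n => (hoppe_normE theta n f)%:E) @ \oo --> (\int[mu]_x (f x)%:E)%E.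
Proof.
move=> mu_rate delta0 f_bc; rewrite -EFin_Rintegral //; last first.
  exact: bounded_continuous_integrable.
apply: cvg_hoppe_normE.
apply: (@portmanteau R mu (fun N f => E N (fun b => f (normalized N b)))) => //.
- by move=> N g h gh; apply: le_hoppe_expect.
- by move=> N g; rewrite expectN.
- by move=> L h [hL _]; exact: cvg_lipschitz_rate mu_rate delta0 hL.
Qed.

Section limit.
Variables X Y : R -> R.
Hypotheses (X2 : X \in L2) (Y2 : Y \in L2).
Local Notation limit := (pair_law X2 Y2).

Definition L2_error N : R :=
  L2norm (unif01 R) (fun u => normalized_wiener N (tree N u) - X u)
  + L2norm (unif01 R) (fun u => normalized_length N (tree N u) - Y u).

Lemma lipschitz_rate_pair_law : lipschitz_rate limit L2_error.
Proof.
move=> L h N hL; have mh := lipschitz_measurable hL; have L0 := lipschitz_ge0 hL.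
set W := fun u => normalized_wiener N (tree N u).
set T := fun u => normalized_length N (tree N u).
have WX : (fun u => W u - X u) \in L2 := Lfun2B (tree_Lfun2 (normalized_wiener N) N) X2.
have TY : (fun u => T u - Y u) \in L2 := Lfun2B (tree_Lfun2 (normalized_length N) N) Y2.
have dist2 : (fun u => `|W u - X u| + `|T u - Y u|) \in L2.
  exact: Lfun2D (Lfun2_norm WX) (Lfun2_norm TY).
have int_hXY := lipschitz_pair_integrable X2 Y2 hL.
rewrite /Rintegral (integral_pair_law X2 Y2) //= -(Rintegral_tree _ N).
apply: (@le_trans _ _ (\int[unif01 R]_u (L * (`|W u - X u| + `|T u - Y u|)))).
  apply: le_norm_RintegralB => //.
  - exact: Lfun2_integrable (tree_Lfun2 (fun b => h (normalized N b)) N).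
  - exact: Lfun2_integrable (Lfun2Z L dist2).
  - move=> u _; have /lipschitzP/(_ (normalized N (tree N u)) (X u, Y u)) := hL.
    move=> /le_trans; apply; rewrite ler_wpM2l // prod_normE /=.
    by rewrite ge_max lerDl lerDr !normr_ge0.
rewrite RintegralZl ?Lfun2_integrable // ler_wpM2l //.
rewrite RintegralD ?Lfun2_integrable ?Lfun2_norm //.
by apply: lerD; exact: Rintegral_norm_le.
Qed.

Hypotheses
  (WX : L2cvg (unif01 R) (fun N u => normalized_wiener N (tree N u)) X)
  (TY : L2cvg (unif01 R) (fun N u => normalized_length N (tree N u)) Y).

Let X_sqr_integrable := ((Lfun2P (unif01 R) X).1 X2).2.
Let Y_sqr_integrable := ((Lfun2P (unif01 R) Y).1 Y2).2.

Lemma cvg_L2_error : L2_error @ \oo --> (0 : R).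
Proof. by rewrite -[X in _ --> X](addr0 0); exact: cvgD. Qed.

Lemma Rintegral_L2limit_eq0 (F : nat -> btree -> R) f : f \in L2 ->
  L2cvg (unif01 R) (fun N u => F N (tree N u)) f -> (forall N, E N (F N) = 0) ->
  \int[unif01 R]_u f u = 0.
Proof.
move=> f2 Ff F0; have := L2cvg_Rintegral (fun N => tree_Lfun2 (F N) N) f2 Ff.
under eq_fun do rewrite Rintegral_tree F0.
by move=> /(cvg_unique _ (cvg_cst _)) <-.
Qed.

Lemma finite_second_moments_pair_law : finite_second_moments limit.
Proof.
by split; [apply: (integrable_pair_law X2 Y2 _ X_sqr_integrable)
  |apply: (integrable_pair_law X2 Y2 _ Y_sqr_integrable)]; exact: measurable_funX.
Qed.

Lemma centered_pair_law : centered_L2 limit.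
Proof.
split; first exact: finite_second_moments_pair_law.
rewrite (integral_pair_law X2 Y2 (h := fst)) ?(Lfun2_integrable X2) //.
rewrite (integral_pair_law X2 Y2 (h := snd)) ?(Lfun2_integrable Y2) //=.
rewrite (Rintegral_L2limit_eq0 X2 WX expect_normalized_wiener).
by rewrite (Rintegral_L2limit_eq0 Y2 TY expect_normalized_length).
Qed.

Lemma cvg_second_moment h (F G : nat -> btree -> R) f g : f \in L2 -> g \in L2 ->
  L2cvg (unif01 R) (fun N u => F N (tree N u)) f ->
  L2cvg (unif01 R) (fun N u => G N (tree N u)) g -> measurable_fun setT h ->
  (forall N b, F N b * G N b = h (normalized N b)) ->
  (forall u, f u * g u = h (X u, Y u)) ->
  (fun n => (hoppe_normE theta n h)%:E) @ \oo --> (\int[limit]_x (h x)%:E)%E.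
Proof.
move=> f2 g2 Ff Gg mh FG fg; rewrite (integral_pair_law X2 Y2) //; last first.
  by have := Lfun2M_integrable f2 g2; under eq_fun do rewrite fg.
apply: cvg_hoppe_normE.
have := L2cvg_RintegralM (fun N => tree_Lfun2 (F N) N) f2
  (fun N => tree_Lfun2 (G N) N) g2 Ff Gg.
under [X in _ --> X -> _]eq_Rintegral do rewrite fg.
apply: cvg_trans; apply: near_eq_cvg; apply: nearW => N.
by rewrite -Rintegral_tree; apply: eq_Rintegral => u _; rewrite -FG.
Qed.

End limit.

Theorem hoppe_limit_law : exists mu : probability (R * R)%type R,
  [/\ cvg_dist_L2 (hoppe_normE theta) mu, centered_L2 mu &
   exists2 delta : nat -> R, delta @ \oo --> (0 : R) & lipschitz_rate mu delta].
Proof.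
have [X X2 WX] := normalized_wiener_L2cvg; have [Y Y2 TY] := normalized_length_L2cvg.
have mu_rate := lipschitz_rate_pair_law X2 Y2.
have delta0 := cvg_L2_error WX TY.
exists (pair_law X2 Y2); split; [|exact: centered_pair_law|by exists (L2_error X Y)].
split=> [f|]; first exact: cvg_hoppe_normE_bounded_continuous mu_rate delta0.
split; [exact: finite_second_moments_pair_law|split; [|split]].
- by apply: (cvg_second_moment (F := normalized_wiener)
    (G := normalized_wiener) X2 X2 WX WX) => //; exact: measurable_funX.
- by apply: (cvg_second_moment (F := normalized_length)
    (G := normalized_length) Y2 Y2 TY TY) => //; exact: measurable_funX.
- by apply: (cvg_second_moment (F := normalized_wiener)
    (G := normalized_length) X2 Y2 WX TY) => //; exact: measurable_funM.
Qed.

Lemma cvg_dist_L2_lipschitz_rate nu : cvg_dist_L2 (hoppe_normE theta) nu ->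
  exists2 delta : nat -> R, delta @ \oo --> (0 : R) & lipschitz_rate nu delta.
Proof.
move=> [nu_cvg _]; have [mu [[mu_cvg _] _ [delta delta0 mu_rate]]] := hoppe_limit_law.
exists delta => // L h N hL.
suff -> : \int[nu]_x h x = \int[mu]_x h x by exact: mu_rate.
congr fine; apply: eq_measure_integral => A mA _.
apply: (eq_probability_lipschitz _ mA) => K f fK; have f_bc := bounded_lipschitzW fK.
apply: EFin_inj; rewrite !EFin_Rintegral ?bounded_continuous_integrable //.
exact: cvg_unique (nu_cvg f f_bc) (mu_cvg f f_bc).
Qed.

End limit_law.

(** * Asymptotics of the means *)

Lemma ln_succ_bounds (R : realType) (n : nat) :
  (n.+2%:R^-1 : R) <= ln n.+2%:R - ln n.+1%:R <= (n.+1%:R^-1 : R).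
Proof.
have n1 : 0 < n.+1%:R :> R by []; have n2 : 0 < n.+2%:R :> R by [].
have succE : n.+2%:R = n.+1%:R + 1 :> R by rewrite natr1.
apply/andP; split.
  rewrite -lerN2 opprB -ln_div ?posrE //.
  rewrite (_ : n.+1%:R / n.+2%:R = 1 + - n.+2%:R^-1).
    by apply: le_ln1Dx; rewrite ltrN2 invf_lt1 // ltr1n.
  by rewrite succE; move: (n.+1%:R) n1 => x x0; field; rewrite gt_eqF //; lra.
rewrite -ln_div ?posrE // (_ : n.+2%:R / n.+1%:R = 1 + n.+1%:R^-1).
  by apply: le_ln1Dx; rewrite (lt_trans _ (_ : 0 < _)) ?ltrN10 // invr_gt0.
by rewrite succE; move: (n.+1%:R) n1 => x x0; field; rewrite gt_eqF.
Qed.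

Section mean_asymptotics.
Variables (R : realType) (theta : R).
Hypothesis theta_gt0 : 0 < theta.
Implicit Types (n N : nat).
Local Notation psi := (digamma (theta + 1)).
Local Notation H := (theta_harmonic theta).

Let log_minus_harmonic n : R := ln n.+1%:R - H n.+2.

Let log_minus_harmonicS n : log_minus_harmonic n.+1 - log_minus_harmonic n =
  ln n.+2%:R - ln n.+1%:R - (theta + n.+3%:R)^-1.
Proof. by rewrite /log_minus_harmonic (theta_harmonicS _ n.+2); lra. Qed.

Let log_minus_harmonic_nondecreasing : nondecreasing_seq log_minus_harmonic.
Proof.
apply/nondecreasing_seqP => n; rewrite -subr_ge0 log_minus_harmonicS subr_ge0.
have /andP[ln_ge _] := ln_succ_bounds R n; apply: le_trans ln_ge.
rewrite lef_pV2 ?posrE ?addr_theta_gt0 // -[n.+3%:R]natr1.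
by have := theta_gt0; lra.
Qed.

Let log_minus_harmonic_le n :
  log_minus_harmonic n <= log_minus_harmonic 0 + (theta + 2).
Proof.
have t0 := theta_gt0.
suff : log_minus_harmonic n + (theta + 2) / n.+1%:R <=
    log_minus_harmonic 0 + (theta + 2).
  by apply: le_trans; rewrite lerDl divr_ge0 //; lra.
elim: n => [|n IH]; first by rewrite divr1.
apply: le_trans IH; have /andP[_ ln_le] := ln_succ_bounds R n.
have incr_le : n.+1%:R^-1 - (theta + n.+3%:R)^-1 <=
    (theta + 2) / n.+1%:R - (theta + 2) / n.+2%:R.
  rewrite -subr_ge0 -[n.+3%:R]natr1 -[n.+2%:R]natr1.
  have := ltr0Sn R n; move: (n.+1%:R) => x x0.
  rewrite [X in 0 <= X](_ : _ = (theta + 2) * (theta + 1) /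
    (x * (x + 1) * (theta + (x + 1 + 1)))); last by field; rewrite !gt_eqF //; lra.
  by rewrite divr_ge0 ?mulr_ge0 //; lra.
move: (log_minus_harmonicS n) ln_le incr_le.
move: ((theta + 2) / n.+1%:R) ((theta + 2) / n.+2%:R) => p q.
move: (n.+1%:R^-1) ((theta + _)^-1) (log_minus_harmonic n) (log_minus_harmonic n.+1).
by move: (log_minus_harmonic 0) (ln _ - ln _) => *; lra.
Qed.

Lemma cvg_digamma : (fun n => ln n.+1%:R - H n.+2) @ \oo --> psi.
Proof.
have harmonicE n : \sum_(k < n.+1) (theta + 1 + k%:R)^-1 = H n.+1.
  by apply: eq_bigr => k _; rewrite -addrA nat1r.
have /cvg_ex[l cvg_l] : cvgn log_minus_harmonic.
  apply: nondecreasing_is_cvgn log_minus_harmonic_nondecreasing _.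
  by exists (log_minus_harmonic 0 + (theta + 2)) => _ [n _ <-];
    exact: log_minus_harmonic_le.
have cvg_shift : (fun n => ln n%:R - H n.+1) @ \oo --> l.
  by rewrite -(cvg_shiftS (fun n => ln n%:R - H n.+1)).
rewrite (_ : psi = l) //; apply: cvg_lim => //.
under eq_fun do rewrite harmonicE.
exact: cvg_shift.
Qed.

Lemma cvg_theta_harmonic_ln : (fun N => H N - ln N.+1%:R) @ \oo --> - psi.
Proof.
have t0 := theta_gt0; rewrite -(cvg_shiftS (fun N => H N - ln N.+1%:R)).
have ln_incr0 : (fun N => ln N.+2%:R - ln N.+1%:R) @ \oo --> (0 : R).
  apply: (@squeeze_cvgr _ _ _ _ (cst 0) (@harmonic R)); last exact: cvg_harmonic.
    apply: nearW => n; have /andP[ln_ge ->] := ln_succ_bounds R n.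
    by rewrite andbT; apply: le_trans ln_ge; rewrite invr_ge0.
  exact: cvg_cst.
have inv0 : (fun N => (theta + N.+2%:R)^-1) @ \oo --> (0 : R).
  apply: (@squeeze_cvgr _ _ _ _ (cst 0) (@harmonic R)); last exact: cvg_harmonic.
    apply: nearW => n; rewrite /= invr_ge0 ltW ?addr_theta_gt0 //=.
    by rewrite lef_pV2 ?posrE ?addr_theta_gt0 // -[n.+2%:R]natr1; lra.
  exact: cvg_cst.
have diffE N : H N.+1 - ln N.+2%:R = - (ln N.+1%:R - H N.+2)
    - (ln N.+2%:R - ln N.+1%:R) - (theta + N.+2%:R)^-1.
  by rewrite (theta_harmonicS _ N.+1); lra.
rewrite (funext diffE) (_ : - psi = - psi - 0 - 0); last by rewrite !subr0.
by apply: cvgB => //; apply: cvgB => //; apply: cvgN; exact: cvg_digamma.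
Qed.

Lemma cvg_theta_harmonic_div : (fun N => H N * harmonic N) @ \oo --> (0 : R).
Proof.
pose inv i : R := (theta + i.+1%:R)^-1.
have inv0 : inv @ \oo --> (0 : R).
  apply: (@squeeze_cvgr _ _ _ _ (cst 0) (@harmonic R)); last exact: cvg_harmonic.
    apply: nearW => n; rewrite /= invr_ge0 ltW ?addr_theta_gt0 //=.
    by rewrite lef_pV2 ?posrE ?addr_theta_gt0 // lerDr ltW.
  exact: cvg_cst.
apply: (@squeeze_cvgr _ _ _ _ (cst 0) (arithmetic_mean inv)); last exact: cesaro.
  apply: nearW => N; rewrite mulr_ge0 ?theta_harmonic_ge0 ?invr_ge0 //=.
  rewrite /arithmetic_mean /series /= mulrC ler_wpM2l ?invr_ge0 //.
  rewrite big_mkord -/(theta_harmonic theta N.+1) theta_harmonicS lerDl.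
  by rewrite invr_ge0 ltW ?addr_theta_gt0.
exact: cvg_cst.
Qed.

Definition mean_length_error N : R :=
  mean_path_length theta N / N.+1%:R - ln N.+1%:R + psi.
Definition mean_wiener_error N : R :=
  mean_wiener_index theta N / N.+1%:R ^+ 2 - ln N.+1%:R + psi + 2 / (theta + 1).

Lemma cvg_mean_length_error : mean_length_error @ \oo --> (0 : R).
Proof.
have errorE N : mean_length_error N = (H N - ln N.+1%:R + psi)
    + (theta - 1) * (H N * harmonic N).
  rewrite /mean_length_error /mean_path_length /harmonic /= -[N.+1%:R]natr1.
  have := ler0n R N; move: (N%:R) (ln _) (H N) (digamma _) => x l h p x0.
  by field; rewrite gt_eqF //; lra.
rewrite (funext errorE) (_ : 0 = (- psi + psi) + (theta - 1) * 0); last by ring.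
apply: cvgD; first by apply: cvgD; [exact: cvg_theta_harmonic_ln|exact: cvg_cst].
by apply: cvgM; [exact: cvg_cst|exact: cvg_theta_harmonic_div].
Qed.

Lemma cvg_mean_wiener_error : mean_wiener_error @ \oo --> (0 : R).
Proof.
pose k N : R := (2 * theta - 1) + theta * (theta - 1) * harmonic N.
pose a N : R := 1 + (theta - 1) * harmonic N.
have errorE N : mean_wiener_error N = (H N - ln N.+1%:R + psi)
    + (k N - (theta - 1) * a N) * (H N * harmonic N)
    + (2 * a N - 2 / (theta + 1) * k N) * harmonic N.
  rewrite /mean_wiener_error /mean_wiener_index /mean_adjusted_wiener.
  rewrite /mean_path_length /k /a /harmonic /= -[N.+1%:R]natr1.
  have t0 := theta_gt0; have := ler0n R N.
  move: (N%:R) (ln _) (H N) (digamma _) => x l h p x0.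
  by field; rewrite !gt_eqF //; lra.
have harmonic0 : @harmonic R @ \oo --> (0 : R) := cvg_harmonic.
have cvg_k : k @ \oo --> (2 * theta - 1) + theta * (theta - 1) * 0.
  by apply: cvgD; [exact: cvg_cst|apply: cvgM => //; exact: cvg_cst].
have cvg_a : a @ \oo --> 1 + (theta - 1) * 0.
  by apply: cvgD; [exact: cvg_cst|apply: cvgM => //; exact: cvg_cst].
rewrite (funext errorE) (_ : 0 = (- psi + psi)
   + ((2 * theta - 1) + theta * (theta - 1) * 0
      - (theta - 1) * (1 + (theta - 1) * 0)) * 0
   + (2 * (1 + (theta - 1) * 0)
      - 2 / (theta + 1) * ((2 * theta - 1) + theta * (theta - 1) * 0)) * 0); last first.
  by rewrite !mulr0 !addr0 addNr.
apply: cvgD.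
  apply: cvgD; first by apply: cvgD; [exact: cvg_theta_harmonic_ln|exact: cvg_cst].
  apply: cvgM cvg_theta_harmonic_div; apply: cvgB => //.
  by apply: cvgM => //; exact: cvg_cst.
by apply: cvgM => //; apply: cvgB; apply: cvgM => //; exact: cvg_cst.
Qed.

End mean_asymptotics.

(** * The subtree of vertex 1 *)

Section subtree_split.
Variables (R : realType) (theta : R).
Hypothesis theta_gt0 : 0 < theta.
Implicit Types (N p q : nat) (F : btree -> R).
Local Notation E := (hoppe_expect theta).
Local Notation moment := (beta1_moment theta_gt0).

Definition subtrees_expect p q (F : btree -> btree -> R) : R :=
  E q (fun r => hoppe_expect (1 : R) p (fun s => F r s)).

Lemma subtrees_expect_growth_sum p q F :
  subtrees_expect p q (fun r s => growth_sum theta F (Join r s)) =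
  (theta + q%:R) * subtrees_expect p q.+1 (fun r s => F (Join r s))
  + (1 + p%:R) * subtrees_expect p.+1 q (fun r s => F (Join r s)).
Proof.
rewrite /subtrees_expect -hoppe_expect_growth_sum // -expectZ -expectD.
apply: eq_hoppe_expect => r _; rewrite growth_sum_expect -hoppe_expect_growth_sum //.
by rewrite -expectD; apply: eq_hoppe_expect => s _; rewrite growth_sum_join.
Qed.

Lemma hoppe_expect_split_sum N F : E N.+1 F =
  \sum_(j < N.+1) 'C(N, j)%:R *
    (moment j (N - j) * subtrees_expect j (N - j) (fun r s => F (Join r s))).
Proof.
elim: N F => [|N IH] F.
  rewrite big_ord1 bin0 mul1r beta1_moment0n /subtrees_expect hoppe_expectS.
  by rewrite !expect0 growth_sum_leaf addr0 mulrAC.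
rewrite hoppe_expectS // IH big_distrl /= (sum_pascal N (fun j => moment j (N.+1 - j)
  * subtrees_expect j (N.+1 - j) (fun r s => F (Join r s)))).
apply: eq_bigr => j _; rewrite -mulrA; congr (_ * _).
have jN : (j <= N)%N by rewrite -ltnS.
have N0 : theta + N.+1%:R != 0 by rewrite gt_eqF ?addr_theta_gt0.
rewrite subSS subSn // subtrees_expect_growth_sum.
have -> : moment j (N - j).+1 = moment j (N - j) - moment j.+1 (N - j).
  by rewrite (beta1_moment_split theta_gt0 j (N - j)) addrC addKr.
have := beta1_momentS theta_gt0 j (N - j); rewrite subnKC // => recS.
have -> : moment j.+1 (N - j) = j.+1%:R * moment j (N - j) / (theta + N.+1%:R).
  by rewrite -recS mulrC mulKf.
have NE : N%:R = (N - j)%:R + j%:R :> R by rewrite -natrD subnK.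
move: N0; rewrite -[N.+1%:R]natr1 -[j.+1%:R]natr1 NE.
move: (subtrees_expect _ _ _) (subtrees_expect _ _ _) (moment _ _) (_%:R) (_%:R).
by move=> a b m y z N0; field.
Qed.

Lemma Rintegral_bernstein N (g : nat -> R) :
  \int[beta1_law theta_gt0]_(v in `]0, 1[) bernstein N g v =
  \sum_(j < N.+1) 'C(N, j)%:R * (moment j (N - j) * g j).
Proof.
have int_term (j : 'I_N.+1) : (beta1_law theta_gt0).-integrable `]0, 1[
    (fun v => ('C(N, j)%:R * g j)%:E * (XMonemX j (N - j) v)%:E)%E.
  by apply: integrableZl => //; exact: XMonemX_integrable.
rewrite {1}/Rintegral; under eq_integral => v _.
  rewrite /bernstein -sumEFin.
  under eq_bigr => j _ do rewrite mulrA mulrAC EFinM.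
  over.
rewrite integral_sum //=; under eq_bigr => j _.
  rewrite integralZl //; last exact: XMonemX_integrable.
  rewrite -EFin_Rintegral //; last exact: XMonemX_integrable.
  rewrite -EFinM -mulrA [g j * _]mulrC.
  over.
by rewrite sumEFin.
Qed.

Lemma hoppe_expect_split N F : E N.+1 F =
  \int[beta1_law theta_gt0]_(v in `]0, 1[) bernstein N
    (fun j => subtrees_expect j (N - j) (fun r s => F (Join r s))) v.
Proof. by rewrite hoppe_expect_split_sum Rintegral_bernstein. Qed.

End subtree_split.

Section split_frac.
Variable R : realType.
Implicit Types (N j : nat).

(* The tree has [N + 2] vertices, [j + 1] of them in the subtree of vertex 1. *)
Definition split_frac N j : R := j.+1%:R / N.+2%:R.

Lemma split_sizeE N j : (j <= N)%N -> N.+2%:R = (N - j).+1%:R + j.+1%:R :> R.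
Proof. by move=> jN; rewrite -natrD; congr (_%:R); lia. Qed.

Lemma onem_split_frac N j : (j <= N)%N ->
  1 - split_frac N j = (N - j).+1%:R / N.+2%:R.
Proof.
move=> jN; rewrite /split_frac (split_sizeE jN).
by field; rewrite gt_eqF // addr_gt0.
Qed.

Lemma split_frac_itv N j : (j <= N)%N -> 0 < split_frac N j < 1.
Proof.
move=> jN; rewrite /split_frac divr_gt0 //= -subr_gt0 -/(split_frac N j).
by rewrite onem_split_frac // divr_gt0.
Qed.

End split_frac.

Section toll.
Variables (R : realType) (theta : R).
Hypothesis theta_gt0 : 0 < theta.
Implicit Types (N j : nat).

Definition wiener_toll N j : R := let x := split_frac R N j in let q := (N - j)%N in
  (1 - x) ^+ 2 * (mean_wiener_index theta q / q.+1%:R ^+ 2)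
  + x ^+ 2 * (mean_wiener_index 1 j / j.+1%:R ^+ 2)
  + x * (1 - x) * (mean_path_length theta q / q.+1%:R)
  + x * (1 - x) * (mean_path_length 1 j / j.+1%:R)
  + x * (1 - x) - mean_wiener_index theta N.+1 / N.+2%:R ^+ 2.

Definition length_toll N j : R := let x := split_frac R N j in let q := (N - j)%N in
  (1 - x) * (mean_path_length theta q / q.+1%:R)
  + x * (mean_path_length 1 j / j.+1%:R)
  + x - mean_path_length theta N.+1 / N.+2%:R.

Definition toll N j : R * R := (wiener_toll N j, length_toll N j).

Lemma normalized_join N j r s : (j <= N)%N ->
  nverts r = (N - j).+1 -> nverts s = j.+1 ->
  normalized theta N.+1 (Join r s) =
  Mleft (split_frac R N j) (normalized theta (N - j) r)
  + Mright (split_frac R N j) (normalized 1 j s) + toll N j.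
Proof.
move=> jN rN sN; rewrite /normalized /normalized_wiener /normalized_length /toll.
rewrite /wiener_toll /length_toll /split_frac /= (split_sizeE R jN).
rewrite !natrD !natrM rN sN.
have := ltr0Sn R (N - j); have := ltr0Sn R j.
move: ((N - j).+1%:R) (j.+1%:R) (mean_wiener_index _ (N - j)) (mean_wiener_index _ j).
move=> p k wq wj k0 p0.
by apply: injective_projections => /=; field; rewrite !gt_eqF //; lra.
Qed.

Definition mean_error (t : R) N : R :=
  `|mean_wiener_error t N| + `|mean_length_error t N|.

Lemma mean_error_ge0 t N : 0 <= mean_error t N.
Proof. by rewrite addr_ge0. Qed.

Lemma cvg_mean_error (t : R) : 0 < t -> mean_error t @ \oo --> (0 : R).
Proof.
move=> t0; rewrite -[X in _ --> X](addr0 0).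
apply: cvgD; apply/norm_cvg0P; first exact: cvg_mean_wiener_error.
exact: cvg_mean_length_error.
Qed.

Section toll_error.
Variables N j : nat.
Hypothesis jN : (j <= N)%N.
Local Notation x := (split_frac R N j).
Local Notation q := (N - j)%N.

Let ln_frac : ln x = ln j.+1%:R - ln N.+2%:R.
Proof. by rewrite ln_div ?posrE. Qed.

Let ln_onem_frac : ln (1 - x) = ln q.+1%:R - ln N.+2%:R.
Proof. by rewrite onem_split_frac // ln_div ?posrE. Qed.

Let theta1_neq0 : theta + 1 != 0.
Proof. by rewrite gt_eqF // addr_gt0. Qed.

Lemma wiener_toll_error : wiener_toll N j - (b_hoppe theta x).1 =
  (1 - x) ^+ 2 * mean_wiener_error theta q + x ^+ 2 * mean_wiener_error 1 j
  + x * (1 - x) * mean_length_error theta q + x * (1 - x) * mean_length_error 1 j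
  - mean_wiener_error theta N.+1.
Proof.
rewrite /wiener_toll /mean_wiener_error /mean_length_error /b_hoppe /entropyE.
rewrite ln_frac ln_onem_frac (_ : 1 + 1 = 2 :> R) //=.
move: (mean_path_length _ _ / _) (mean_path_length _ _ / _).
move: (mean_wiener_index _ _ / _) (mean_wiener_index _ _ / _).
move: (mean_wiener_index _ _ / _).
move: x (ln _) (ln _) (ln _) (digamma _) (digamma _) => y *.
by field.
Qed.

Lemma length_toll_error : length_toll N j - (b_hoppe theta x).2 =
  (1 - x) * mean_length_error theta q + x * mean_length_error 1 j
  - mean_length_error theta N.+1.
Proof.
rewrite /length_toll /mean_length_error /b_hoppe /entropyE.
rewrite ln_frac ln_onem_frac (_ : 1 + 1 = 2 :> R) //=.
move: (mean_path_length _ _ / _) (mean_path_length _ _ / _) (mean_path_length _ _ / _).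
move: x (ln _) (ln _) (ln _) (digamma _) (digamma _) => y *.
by ring.
Qed.

Lemma toll_error_le : `|toll N j - b_hoppe theta x| <=
  mean_error theta q + mean_error 1 j + mean_error theta N.+1.
Proof.
have /andP[x0 x1] := split_frac_itv R jN.
have weight_le (w e : R) : 0 <= w <= 1 -> - `|e| <= w * e <= `|e|.
  by move=> /andP[w0 w1]; rewrite -ler_norml normrM ger0_norm // ler_piMl.
have norm_le (e : R) : - `|e| <= - e <= `|e| by rewrite -ler_norml normrN.
rewrite prod_normE ge_max /mean_error; apply/andP; split.
  rewrite [`|_|](_ : _ = `|wiener_toll N j - (b_hoppe theta x).1|) //.
  rewrite wiener_toll_error ler_norml.
  have onem_sqr_itv : 0 <= (1 - x) ^+ 2 <= 1 by apply/andP; split; nra.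
  have sqr_itv : 0 <= x ^+ 2 <= 1 by apply/andP; split; nra.
  have mul_itv : 0 <= x * (1 - x) <= 1 by apply/andP; split; nra.
  have := weight_le _ (mean_wiener_error theta q) onem_sqr_itv.
  have := weight_le _ (mean_wiener_error 1 j) sqr_itv.
  have := weight_le _ (mean_length_error theta q) mul_itv.
  have := weight_le _ (mean_length_error 1 j) mul_itv.
  have := norm_le (mean_wiener_error theta N.+1).
  by have := normr_ge0 (mean_length_error theta N.+1); lra.
rewrite [`|_|](_ : _ = `|length_toll N j - (b_hoppe theta x).2|) //.
rewrite length_toll_error ler_norml.
have onem_itv : 0 <= 1 - x <= 1 by lra.
have itv : 0 <= x <= 1 by lra.
have := weight_le _ (mean_length_error theta q) onem_itv.
have := weight_le _ (mean_length_error 1 j) itv.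
have := norm_le (mean_length_error theta N.+1).
have := normr_ge0 (mean_wiener_error theta N.+1).
have := normr_ge0 (mean_wiener_error theta q).
have := normr_ge0 (mean_wiener_error (1 : R) j).
by lra.
Qed.

End toll_error.

End toll.

(** * The smoothing transform *)

Section mixture_map.
Variable R : realType.
Implicit Types (u v : R) (x y c : R * R).

Definition mix v c x y : R * R := Mleft v x + Mright v y + c.

Lemma norm_triangular_le (a b d m : R) x : `|a| + `|b| <= m -> `|d| <= m ->
  `|(a * x.1 + b * x.2, d * x.2) : R * R| <= m * `|x|.
Proof.
move=> abm dm; have m0 : 0 <= m := le_trans (normr_ge0 d) dm.
have x1 : `|x.1| <= `|x| by rewrite prod_normE le_max lexx.
have x2 : `|x.2| <= `|x| by rewrite prod_normE le_max lexx orbT.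
rewrite prod_normE ge_max /=; apply/andP; split; last by rewrite normrM ler_pM.
apply: (le_trans (ler_normD _ _)); rewrite !normrM.
apply: (@le_trans _ _ ((`|a| + `|b|) * `|x|)); last by rewrite ler_wpM2r.
by rewrite mulrDl lerD // ler_wpM2l.
Qed.

Lemma norm_Mleft_le v x : 0 <= v <= 1 -> `|Mleft v x| <= (1 - v) * `|x|.
Proof.
move=> /andP[v0 v1]; apply: norm_triangular_le; last by rewrite ger0_norm ?subr_ge0.
by rewrite !ger0_norm ?sqr_ge0 ?mulr_ge0 ?subr_ge0 //; nra.
Qed.

Lemma norm_Mright_le v x : 0 <= v <= 1 -> `|Mright v x| <= v * `|x|.
Proof.
move=> /andP[v0 v1]; apply: norm_triangular_le; last by rewrite ger0_norm.
by rewrite !ger0_norm ?sqr_ge0 ?mulr_ge0 ?subr_ge0 //; nra.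
Qed.

Lemma norm_mixBl v c x x' y : 0 <= v <= 1 ->
  `|mix v c x y - mix v c x' y| <= (1 - v) * `|x - x'|.
Proof.
move=> v01; rewrite (_ : _ - _ = Mleft v (x - x')); first exact: norm_Mleft_le.
by rewrite /mix /Mleft /Mright; apply: injective_projections => /=; ring.
Qed.

Lemma norm_mixBr v c x y y' : 0 <= v <= 1 ->
  `|mix v c x y - mix v c x y'| <= v * `|y - y'|.
Proof.
move=> v01; rewrite (_ : _ - _ = Mright v (y - y')); first exact: norm_Mright_le.
by rewrite /mix /Mleft /Mright; apply: injective_projections => /=; ring.
Qed.

Lemma norm_mix_paramB u v c c' x y : 0 <= u <= 1 -> 0 <= v <= 1 ->
  `|mix u c x y - mix v c' x y| <= 3 * `|u - v| * (`|x| + `|y|) + `|c - c'|.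
Proof.
move=> u01 v01; rewrite (_ : _ - _ =
  (((u - v) * (u + v - 2) * x.1 + (u - v) * (1 - u - v) * x.2, (v - u) * x.2)
   + ((u - v) * (u + v) * y.1 + (u - v) * (1 - u - v) * y.2, (u - v) * y.2))
  + (c - c')); last first.
  by rewrite /mix /Mleft /Mright; apply: injective_projections => /=; ring.
apply: (le_trans (ler_normD _ _)); rewrite lerD2r.
apply: (le_trans (ler_normD _ _)); rewrite [leRHS]mulrDr; have uv0 := normr_ge0 (u - v).
have coef_le (k : R) : `|k| <= 2 -> `|(u - v) * k| + `|(u - v) * (1 - u - v)| <=
    3 * `|u - v|.
  move=> k2; rewrite !normrM -mulrDr mulrC ler_wpM2r //.
  have : `|1 - u - v| <= 1 by rewrite ler_norml; lra.
  by lra.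
have coef_le3 : `|u - v| <= 3 * `|u - v| by rewrite ler_peMl //; lra.
apply: lerD; apply: norm_triangular_le; rewrite -?[v - u]opprB ?normrN //.
- by apply: coef_le; rewrite ler_norml; lra.
- by apply: coef_le; rewrite ler_norml; lra.
Qed.

End mixture_map.

Section bounded_fubini.
Context d1 d2 (T1 : measurableType d1) (T2 : measurableType d2) (R : realType).
Variables (P : probability T1 R) (Q : probability T2 R).
Variables (f : T1 * T2 -> R) (M : R).
Hypotheses (mf : measurable_fun setT f) (fM : forall z, `|f z| <= M).

Let f_integrable : (P \x Q)%E.-integrable setT (EFin \o f).
Proof. exact: (@bounded_integrable _ _ _ (P \x Q)%E setT f M). Qed.

Let section_integrable x : Q.-integrable setT (EFin \o (fun y => f (x, y))).
Proof.
apply: (@bounded_integrable _ _ _ Q setT _ M) => //.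
exact: measurableT_comp mf (measurable_pair1 x).
Qed.

Lemma measurable_Rintegral_section : measurable_fun setT (fun x => \int[Q]_y f (x, y)).
Proof.
exact: measurableT_comp (measurable_fubini_F f_integrable).
Qed.

Lemma Rintegral_prod : \int[(P \x Q)%E]_z f z = \int[P]_x \int[Q]_y f (x, y).
Proof.
rewrite /Rintegral -(integral12_prod_meas1 f_integrable); congr fine.
apply: eq_integral => x _; rewrite fineK //.
exact: integrable_fin_num (section_integrable x).
Qed.

End bounded_fubini.

Section mixture_expect.
Variable R : realType.
Implicit Types (mu nu : probability (R * R)%type R) (f : R * R -> R) (L v : R).
Implicit Types (x y c : R * R).

Definition bounded_measurable f : Prop :=
  measurable_fun setT f /\ exists M, forall x, `|f x| <= M.

Lemma bounded_continuous_measurable f : bounded_continuous f -> bounded_measurable f.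
Proof. by move=> [cf fM]; split=> //; exact: continuous_measurable_plane. Qed.

Lemma bounded_lipschitz_measurable L f : bounded_lipschitz L f -> bounded_measurable f.
Proof. by move=> [fL fM]; split=> //; exact: lipschitz_measurable fL. Qed.

Lemma measurable_mix d (T : measurableType d) (v : T -> R) (c x y : T -> R * R) :
  measurable_fun setT v -> measurable_fun setT c -> measurable_fun setT x ->
  measurable_fun setT y -> measurable_fun setT (fun t => mix (v t) (c t) (x t) (y t)).
Proof.
move=> mv mc mx my.
have m_onem : measurable_fun setT (fun t => 1 - v t) by exact: measurable_funB.
have coord1 (z : T -> R * R) : measurable_fun setT z ->
    measurable_fun setT (fun t : T => (z t).1 : R).
  by move=> mz; exact: (measurableT_comp measurable_fst mz).
have coord2 (z : T -> R * R) : measurable_fun setT z ->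
    measurable_fun setT (fun t : T => (z t).2 : R).
  by move=> mz; exact: (measurableT_comp measurable_snd mz).
apply: measurable_fun_pair; apply: measurable_funD;
  try exact: coord1; try exact: coord2.
  apply: measurable_funD; apply: measurable_funD; apply: measurable_funM => //;
    try exact: coord1; try exact: coord2; try exact: measurable_funX;
    exact: measurable_funM.
by apply: measurable_funD; apply: measurable_funM => //; exact: coord2.
Qed.

Definition mix_right_expect nu f v c x : R := \int[nu]_y f (mix v c x y).
Definition mix_expect mu nu f v c : R := \int[mu]_x mix_right_expect nu f v c x.

Section bounded_measurable.
Variable f : R * R -> R.
Hypothesis f_bm : bounded_measurable f.

Lemma mix_bounded_measurable v c x : bounded_measurable (fun y => f (mix v c x y)).
Proof.
have [mf [M fM]] := f_bm; split; last by exists M.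
exact: (measurableT_comp mf (measurable_mix _ _ _ _)).
Qed.

Lemma mix_integrable nu v c x :
  nu.-integrable setT (EFin \o (fun y => f (mix v c x y))).
Proof.
have [mf [M fM]] := mix_bounded_measurable v c x.
exact: (@bounded_integrable _ _ _ nu setT _ M).
Qed.

Lemma mix_right_expect_bounded_measurable nu v c :
  bounded_measurable (mix_right_expect nu f v c).
Proof.
have [mf [M fM]] := f_bm; split.
  apply: (@measurable_Rintegral_section _ _ _ _ _ nu nu
    (fun z => f (mix v c z.1 z.2)) M) => //.
  exact: (measurableT_comp mf (measurable_mix _ _ _ _)).
exists M => x; apply: norm_Rintegral_le => //.
exact: (mix_bounded_measurable v c x).1.
Qed.

Lemma mix_right_expect_integrable mu nu v c :
  mu.-integrable setT (EFin \o mix_right_expect nu f v c).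
Proof.
have [mg [M gM]] := mix_right_expect_bounded_measurable nu v c.
exact: (@bounded_integrable _ _ _ mu setT _ M).
Qed.

Lemma mix_expect_prod mu nu v c :
  mix_expect mu nu f v c = \int[(mu \x nu)%E]_z f (mix v c z.1 z.2).
Proof.
have [mf [M fM]] := f_bm.
rewrite (@Rintegral_prod _ _ _ _ _ mu nu (fun z => f (mix v c z.1 z.2)) M) //.
exact: (measurableT_comp mf (measurable_mix _ _ _ _)).
Qed.

Lemma EFin_mix_expect mu nu v c : ((mix_expect mu nu f v c)%:E =
  \int[mu]_x \int[nu]_y (f (mix v c x y))%:E)%E.
Proof.
rewrite EFin_Rintegral //; last exact: mix_right_expect_integrable.
by apply: eq_integral => x _; rewrite EFin_Rintegral //; exact: mix_integrable.
Qed.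

End bounded_measurable.

Lemma mix_bounded_lipschitz L f v c x : 0 <= v <= 1 -> bounded_lipschitz L f ->
  bounded_lipschitz L (fun y => f (mix v c x y)).
Proof.
move=> v01 [fL [M fM]]; split; last by exists M.
apply/lipschitzP => y y'; have /lipschitzP/(_ (mix v c x y) (mix v c x y')) := fL.
move=> /le_trans; apply; rewrite ler_wpM2l ?(lipschitz_ge0 fL) //.
apply: (le_trans (norm_mixBr c x y y' v01)); rewrite ler_piMl //.
by case/andP: v01.
Qed.

Lemma mix_right_expect_bounded_lipschitz L f v c nu :
  0 <= v <= 1 -> bounded_lipschitz L f ->
  bounded_lipschitz (L * (1 - v)) (mix_right_expect nu f v c).
Proof.
move=> v01 fL; have [f_lip _] := fL; have f_bm := bounded_lipschitz_measurable fL.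
split; last exact: (mix_right_expect_bounded_measurable f_bm nu v c).2.
apply/lipschitzP => x x'; rewrite -(Rintegral_probability_cst nu (_ * `|x - x'|)).
apply: le_norm_RintegralB => //; try exact: mix_integrable.
  exact: cst_integrable.
move=> y _; have /lipschitzP/(_ (mix v c x y) (mix v c x' y)) := f_lip.
move=> /le_trans; apply; rewrite -mulrA ler_wpM2l ?(lipschitz_ge0 f_lip) //.
exact: norm_mixBl.
Qed.

Definition finite_first_moment mu : Prop :=
  mu.-integrable setT (EFin \o (fun x => `|x|)).

Lemma finite_second_first_moment mu :
  finite_second_moments mu -> finite_first_moment mu.
Proof.
move=> [int1 int2].
have fst2 : fst \in Lfun mu 2%:E by apply/Lfun2P; split.
have snd2 : snd \in Lfun mu 2%:E by apply/Lfun2P; split.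
have norm_cont : continuous (fun x : R * R => `|x|) by exact: norm_continuous.
have int_sum := Lfun2_integrable (Lfun2D (Lfun2_norm fst2) (Lfun2_norm snd2)).
apply: le_integrable int_sum => //.
  by apply/measurable_EFinP; exact: continuous_measurable_plane.
move=> x _; rewrite /= lee_fin normr_id prod_normE [leRHS]ger0_norm ?addr_ge0 //.
by rewrite ge_max lerDl lerDr !normr_ge0.
Qed.

Lemma Rintegral_affine_norm (rho : probability (R * R)%type R) (a b : R) :
  finite_first_moment rho ->
  rho.-integrable setT (EFin \o (fun x => a * `|x| + b)) /\
  \int[rho]_x (a * `|x| + b) = a * \int[rho]_x `|x| + b.
Proof.
move=> rho_moment; have int_a := integrable_EFinZ a measurableT rho_moment.
have int_b := cst_integrable rho b measurableT.
split; first exact: integrable_EFinD measurableT int_a int_b.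
by rewrite RintegralD // RintegralZl // Rintegral_probability_cst.
Qed.

Section parameter.
Variables mu nu : probability (R * R)%type R.
Hypotheses (mu_moment : finite_first_moment mu)
  (nu_moment : finite_first_moment nu).

Lemma mix_expect_paramB L f u v c c' : bounded_lipschitz L f ->
  0 <= u <= 1 -> 0 <= v <= 1 ->
  `|mix_expect mu nu f u c - mix_expect mu nu f v c'| <=
  L * (3 * `|u - v| * (\int[mu]_x `|x| + \int[nu]_x `|x|) + `|c - c'|).
Proof.
move=> fL u01 v01; have [f_lip _] := fL; have f_bm := bounded_lipschitz_measurable fL.
pose a := L * (3 * `|u - v|).
have [int_mu mu_affine] := Rintegral_affine_norm a
  (a * \int[nu]_x `|x| + L * `|c - c'|) mu_moment.
rewrite [leRHS](_ : _ = \int[mu]_x (a * `|x| + (a * \int[nu]_x `|x| + L * `|c - c'|))).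
  apply: le_norm_RintegralB => //; try exact: mix_right_expect_integrable.
  move=> x _.
  have [int_nu nu_affine] :=
    Rintegral_affine_norm a (a * `|x| + L * `|c - c'|) nu_moment.
  rewrite addrCA -nu_affine.
  apply: le_norm_RintegralB => //; try exact: mix_integrable.
  move=> y _; have /lipschitzP/(_ (mix u c x y) (mix v c' x y)) := f_lip.
  move=> /le_trans; apply.
  rewrite [leRHS](_ : _ = L * (3 * `|u - v| * (`|x| + `|y|) + `|c - c'|)); last first.
    by rewrite /a; ring.
  by rewrite ler_wpM2l ?(lipschitz_ge0 f_lip) // norm_mix_paramB.
by rewrite mu_affine /a; ring.
Qed.

End parameter.

End mixture_expect.

Section smoothing_law.
Variables (R : realType) (theta : R).
Hypothesis theta_gt0 : 0 < theta.
Implicit Types (mu nu : probability (R * R)%type R) (f : R * R -> R) (v : R).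
Local Notation B := (beta1_law theta_gt0).
Local Notation I01 := (`]0, 1[%classic : set R).
Local Notation b := (b_hoppe theta).

Lemma continuous_b_hoppe v : I01 v -> {for v, continuous b}.
Proof.
rewrite /= in_itv /= => /andP[v0 v1].
have cvg_onem : (fun t : R => 1 - t) t @[t --> v] --> 1 - v.
  by apply: cvgB; [exact: cvg_cst|exact: cvg_id].
have cvg_ln_onem : (fun t : R => ln (1 - t)) t @[t --> v] --> ln (1 - v).
  by apply: (cvg_comp _ _ cvg_onem); apply: continuous_ln; rewrite subr_gt0.
have cvg_v : (fun t : R => t) t @[t --> v] --> v by exact: cvg_id.
have cvg_entropy : (fun t : R => entropyE t) t @[t --> v] --> entropyE v.
  by apply: cvgD; apply: cvgM => //; exact: continuous_ln.
apply: (@cvg_pair _ _ _ _ (nbhs (b v).1) (nbhs (b v).2)).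
  apply: cvgD; last by apply: cvgM => //; exact: cvg_cst.
  apply: cvgD => //; apply: cvgM => //; apply: cvgB; first exact: cvg_cst.
  by apply: cvgM => //; exact: cvg_cst.
apply: cvgD; first exact: cvgD.
by apply: cvgM => //; exact: cvg_cst.
Qed.

Lemma measurable_b_hoppe : measurable_fun setT b.
Proof.
have m_entropy : measurable_fun setT (@entropyE R).
  apply: measurable_funD; apply: measurable_funM => //.
    exact: measurable_funB.
  by apply: measurableT_comp => //; exact: measurable_funB.
apply: measurable_fun_pair.
  apply: measurable_funD; last exact: measurable_funM.
  apply: measurable_funD => //; apply: measurable_funM => //.
  by apply: measurable_funB => //; exact: measurable_funM.
apply: measurable_funD; last exact: measurable_funM.
exact: measurable_funD.
Qed.

Lemma measurable_mix_b_hoppe : measurable_fun setT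
  (fun p : measurableTypeR R * ((R * R) * (R * R)) => mix p.1 (b p.1) p.2.1 p.2.2).
Proof.
have m1 : measurable_fun setT
    (fun p : measurableTypeR R * ((R * R) * (R * R)) => p.1 : R).
  exact: measurable_fst.
apply: measurable_mix => //; first exact: (measurableT_comp measurable_b_hoppe m1).
  exact: (measurableT_comp measurable_fst measurable_snd).
exact: (measurableT_comp measurable_snd measurable_snd).
Qed.

Definition smoothing_law mu nu : probability (R * R)%type R :=
  distribution (B \x (mu \x nu))%E (mfun_Sub (mem_set measurable_mix_b_hoppe)).

Section bounded_measurable.
Variables (f : R * R -> R) (mu nu : probability (R * R)%type R).
Hypothesis f_bm : bounded_measurable f.

Let F (p : measurableTypeR R * ((R * R) * (R * R))) : R :=
  f (mix p.1 (b p.1) p.2.1 p.2.2).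

Let measurable_F : measurable_fun setT F.
Proof. exact: (measurableT_comp f_bm.1 measurable_mix_b_hoppe). Qed.

Lemma mix_b_hoppe_bounded_measurable :
  measurable_fun setT (fun v : measurableTypeR R => mix_expect mu nu f v (b v)) /\
  exists M, forall v, `|mix_expect mu nu f v (b v)| <= M.
Proof.
have [_ [M fM]] := f_bm; split.
  under eq_fun do rewrite mix_expect_prod //.
  exact: (@measurable_Rintegral_section _ _ _ _ _ B (mu \x nu)%E F M
    measurable_F (fun p => fM _)).
exists M => v; have [mg [K gK]] := mix_right_expect_bounded_measurable f_bm nu v (b v).
apply: norm_Rintegral_le => // x; apply: norm_Rintegral_le => //.
exact: (mix_bounded_measurable f_bm _ _ _).1.
Qed.

Lemma mix_b_hoppe_integrable D : measurable D ->
  B.-integrable D (EFin \o (fun v => mix_expect mu nu f v (b v))).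
Proof.
have [mg [M gM]] := mix_b_hoppe_bounded_measurable => mD.
by apply: (@bounded_integrable _ _ _ B D _ M) => //; exact: measurable_funTS.
Qed.

Lemma Rintegral_smoothing_law : \int[smoothing_law mu nu]_x f x =
  \int[B]_(v in I01) mix_expect mu nu f v (b v).
Proof.
have [mf [M fM]] := f_bm.
pose joint : probability (measurableTypeR R * ((R * R) * (R * R)))%type R :=
  (B \x (mu \x nu))%E.
transitivity (\int[joint]_p F p).
  rewrite /Rintegral integral_distribution //; first exact/measurable_EFinP.
  exact: (@bounded_integrable _ _ _ joint setT F M measurableT measurable_F
    (fun p _ => fM _)).
rewrite (@Rintegral_prod _ _ _ _ _ B (mu \x nu)%E F M measurable_F (fun p => fM _)).
transitivity (\int[B]_v mix_expect mu nu f v (b v)).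
  by apply: eq_Rintegral => v _; rewrite mix_expect_prod.
by rewrite /Rintegral beta1_law_setT_itv //; exact: mix_b_hoppe_integrable.
Qed.

Lemma EFin_Rintegral_mix_expect :
  ((\int[B]_(v in I01) mix_expect mu nu f v (b v))%:E =
   \int[lebesgue_measure]_(v in `]0%R, 1%R[)
     ((beta1_dens theta v)%:E *
      \int[mu]_x \int[nu]_y (f (Mleft v x + Mright v y + b v)%R)%:E))%E.
Proof.
rewrite EFin_Rintegral //; last exact: mix_b_hoppe_integrable.
rewrite integral_beta1_law; last exact: mix_b_hoppe_integrable.
by apply: eq_integral => v _; rewrite /= EFin_mix_expect.
Qed.

End bounded_measurable.

Lemma fixed_point_eqP mu nu :
  fixed_point_eq (beta1_dens theta) b mu mu nu <->
  forall L f, bounded_lipschitz L f ->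
    \int[mu]_x f x = \int[B]_(v in I01) mix_expect mu nu f v (b v).
Proof.
split=> [mu_eq L f fL|mu_lip f f_bc].
  have f_bc := bounded_lipschitzW fL; have f_bm := bounded_lipschitz_measurable fL.
  apply: EFin_inj; rewrite EFin_Rintegral_mix_expect // -mu_eq // EFin_Rintegral //.
  exact: bounded_continuous_integrable.
have f_bm := bounded_continuous_measurable f_bc.
rewrite -EFin_Rintegral_mix_expect // -Rintegral_smoothing_law // EFin_Rintegral //.
  apply: eq_measure_integral => A mA _.
  apply: (eq_probability_lipschitz _ mA) => L h hL.
  rewrite Rintegral_smoothing_law; first exact: mu_lip hL.
  exact: bounded_lipschitz_measurable hL.
exact: bounded_continuous_integrable.
Qed.

End smoothing_law.

(** * Passing to the limit in the recursion *)

Lemma bernstein_split_frac_sqr (R : realType) N (v : R) : 0 <= v <= 1 ->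
  bernstein N (fun j => (split_frac R N j - v) ^+ 2) v <= N.+2%:R^-1.
Proof.
move=> /andP[v0 v1]; have -> : (fun j => (split_frac R N j - v) ^+ 2) =
    (fun j => N.+2%:R ^- 2 * (j%:R - (N.+2%:R * v - 1)) ^+ 2).
  apply/funext => j; rewrite /split_frac -[j.+1%:R]natr1.
  by have := ltr0Sn R N.+1; move: (N.+2%:R) => n n0; field; rewrite gt_eqF.
rewrite bernsteinZ bernstein_sqr (_ : N.+2%:R = N%:R + 2 :> R); last first.
  by rewrite -!natr1; ring.
have := ler0n R N; move: (N%:R) => n n0.
rewrite mulrC ler_pdivrMr ?exprn_gt0 //; last by lra.
rewrite (_ : (n + 2)^-1 * (n + 2) ^+ 2 = n + 2); last by field; rewrite gt_eqF //; lra.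
have : n * (v * (1 - v)) <= n * 1 by rewrite ler_wpM2l //; nra.
by nra.
Qed.

Lemma cvg_bernstein_split_frac_sqr (R : realType) (v : R) : 0 <= v <= 1 ->
  (fun N => bernstein N (fun j => (split_frac R N j - v) ^+ 2) v) @ \oo --> (0 : R).
Proof.
move=> v01; apply: (@squeeze_cvgr _ _ _ _ (cst 0) (@harmonic R)) => //.
- apply: nearW => N; apply/andP; split.
    rewrite -[leLHS](bernstein_cst N 0 v); apply: le_bernstein => // j _.
    exact: sqr_ge0.
  apply: (le_trans (bernstein_split_frac_sqr N v01)).
  by rewrite /= lef_pV2 ?posrE // ler_nat.
- exact: cvg_cst.
- exact: cvg_harmonic.
Qed.

Lemma split_sizes_large (R : realType) (v : R) (k : nat) : 0 < v < 1 ->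
  exists2 eta, 0 < eta & \forall N \near \oo, forall j, (j <= N)%N ->
    `|split_frac R N j - v| <= eta -> (k <= j)%N /\ (k <= N - j)%N.
Proof.
move=> /andP[v0 v1]; pose eta := Num.min (v / 2) ((1 - v) / 2).
have eta_v : eta <= v / 2 by rewrite ge_min lexx.
have eta_onem : eta <= (1 - v) / 2 by rewrite ge_min lexx orbT.
have eta0 : 0 < eta by rewrite lt_min !divr_gt0 // subr_gt0.
exists eta => //; near=> N => j jN; rewrite ler_distl => /andP[x_ge x_le].
have n0 := ltr0Sn R N.+1.
have kN : k.+1%:R <= eta * N.+2%:R.
  rewrite mulrC -ler_pdivrMr //.
  apply: (@le_trans _ _ N%:R); last by rewrite ler_nat; lia.
  by near: N; exact: nbhs_infty_ger.
have xE : split_frac R N j * N.+2%:R = j.+1%:R by rewrite divfK // gt_eqF.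
have onem_xE : (1 - split_frac R N j) * N.+2%:R = (N - j).+1%:R.
  by rewrite onem_split_frac // divfK // gt_eqF.
split; rewrite -ltnS -(ler_nat R) -?xE -?onem_xE; apply: (le_trans kN);
  by rewrite ler_wpM2r ?(ltW n0) //; lra.
Unshelve. all: by end_near. Qed.

Section recursion_limit.
Variables (R : realType) (theta : R) (mu nu : probability (R * R)%type R).
Variables (delta delta1 : nat -> R).
Hypotheses (theta_gt0 : 0 < theta)
  (mu_rate : lipschitz_rate theta mu delta) (nu_rate : lipschitz_rate 1 nu delta1)
  (delta0 : delta @ \oo --> (0 : R)) (delta10 : delta1 @ \oo --> (0 : R))
  (mu_moment : finite_first_moment mu)
  (nu_moment : finite_first_moment nu).
Variables (f : R * R -> R) (L : R).
Hypothesis fL : bounded_lipschitz L f.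
Local Notation b := (b_hoppe theta).
Local Notation x := (split_frac R).
Local Notation limit v := (mix_expect mu nu f v (b v)).

Definition split_value N j : R := subtrees_expect theta j (N - j)
  (fun r s => f (normalized theta N.+1 (Join r s))).

Lemma norm_split_value_le M N j : (forall z, `|f z| <= M) -> `|split_value N j| <= M.
Proof.
move=> fM; apply: norm_expect_le => r.
- exact: growth_kernel_ge0.
- exact: growth_kernel_mass.
by apply: norm_expect_le => // s; [exact: growth_kernel_ge0|exact: growth_kernel_mass].
Qed.

Lemma split_value_mix_le N j : (j <= N)%N ->
  `|split_value N j - mix_expect mu nu f (x N j) (toll theta N j)| <=
  L * (delta (N - j)%N + delta1 j).
Proof.
move=> jN; have x01 : 0 <= x N j <= 1.
  by have /andP[/ltW -> /ltW ->] := split_frac_itv R jN.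
set c := toll theta N j.
have splitE : split_value N j = hoppe_expect theta (N - j) (fun r =>
    hoppe_expect 1 j (fun s => f (mix (x N j) c (normalized theta (N - j) r)
      (normalized 1 j s)))).
  apply: eq_hoppe_expect => r rN; apply: eq_hoppe_expect => s sN.
  by rewrite (normalized_join theta jN rN sN).
pose right_expect r := mix_right_expect nu f (x N j) c (normalized theta (N - j) r).
rewrite splitE.
apply: (le_trans (ler_distD (hoppe_expect theta (N - j) right_expect) _ _)).
rewrite mulrDr addrC; apply: lerD.
  have [right_lip _] := mix_right_expect_bounded_lipschitz c nu x01 fL.
  apply: mu_rate; apply: lipschitz_le right_lip.
  by rewrite ler_piMr ?(lipschitz_ge0 fL.1) // gerBl; case/andP: x01.
rewrite -expectB.
apply: (le_trans (le_norm_expect (Leaf 0) (growth_kernel_ge0 theta_gt0) _ _)).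
rewrite -[leRHS](hoppe_expect_cst theta_gt0 (N - j)).
apply: le_hoppe_expect => // r _; apply: (nu_rate j).
exact: (mix_bounded_lipschitz c _ x01 fL).1.
Qed.

Definition split_error n : R :=
  `|delta n| + `|delta1 n| + mean_error theta n + mean_error 1 n.

Lemma cvg_split_error : split_error @ \oo --> (0 : R).
Proof.
rewrite -[X in _ --> X](_ : 0 + 0 + 0 + 0 = 0); last by rewrite !addr0.
apply: cvgD; last exact: cvg_mean_error.
apply: cvgD; last exact: cvg_mean_error.
by apply: cvgD; apply/norm_cvg0P.
Qed.

Local Notation K := (3 * (\int[mu]_x `|x| + \int[nu]_x `|x|)).

Lemma split_value_limit_le N j v : (j <= N)%N -> 0 <= v <= 1 ->
  `|split_value N j - limit v| <=
  L * (split_error (N - j) + split_error j + split_error N.+1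
       + K * `|x N j - v| + `|b (x N j) - b v|).
Proof.
move=> jN v01; have x01 : 0 <= x N j <= 1.
  by have /andP[/ltW -> /ltW ->] := split_frac_itv R jN.
apply: (le_trans (ler_distD (mix_expect mu nu f (x N j) (toll theta N j)) _ _)).
apply: (le_trans (lerD (split_value_mix_le jN)
  (mix_expect_paramB mu_moment nu_moment (toll theta N j) (b v) fL x01 v01))).
rewrite -mulrDr ler_wpM2l ?(lipschitz_ge0 fL.1) //.
have := toll_error_le theta_gt0 jN.
have := ler_distD (b (x N j)) (toll theta N j) (b v).
have := ler_norm (delta (N - j)%N); have := ler_norm (delta1 j).
rewrite /split_error.
have := normr_ge0 (delta N.+1); have := normr_ge0 (delta1 N.+1).
have := normr_ge0 (delta j); have := normr_ge0 (delta1 (N - j)%N).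
have := mean_error_ge0 theta j; have := mean_error_ge0 (1 : R) (N - j).
have := mean_error_ge0 (1 : R) N.+1.
rewrite [3 * _ * _]mulrAC.
move: `|toll theta N j - b v| `|toll theta N j - _| `|b (x N j) - b v|.
by move: (K * `|x N j - v|) => *; lra.
Qed.

Lemma split_value_near v e : 0 < v < 1 -> 0 < e ->
  exists2 eta, 0 < eta & \forall N \near \oo, forall j, (j <= N)%N ->
    `|x N j - v| <= eta -> `|split_value N j - limit v| <= e.
Proof.
move=> v01 e0; have /andP[v0 v1] := v01; have L0 := lipschitz_ge0 fL.1.
have K0 : 0 <= K by rewrite mulr_ge0 // addr_ge0 //; exact: Rintegral_ge0.
pose e1 := e / (5 * (L + 1)).
have e10 : 0 < e1 by rewrite divr_gt0 // mulr_gt0 //; lra.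
have /cvgrPdist_le/(_ e1 e10)[k _ error_near] := cvg_split_error.
have error_le n : (k <= n)%N -> split_error n <= e1.
  by move=> /error_near /=; rewrite sub0r normrN; apply: le_trans; exact: ler_norm.
have : {for v, continuous b} by apply: continuous_b_hoppe; rewrite /= in_itv.
move=> /cvgrPdist_le/(_ e1 e10)/nbhs_ballP[eta1 /= eta10 b_near].
have [eta2 eta20 sizes_large] := split_sizes_large k v01.
pose eta := Num.min (Num.min (eta1 / 2) (e1 / (K + 1))) eta2.
exists eta; first by rewrite !lt_min eta20 !divr_gt0 //; lra.
near=> N => j jN; rewrite !le_min => /andP[/andP[x_eta1 x_K] x_eta2].
have [] : (k <= j)%N /\ (k <= N - j)%N by move: j jN x_eta2 {x_eta1 x_K}; near: N.
move=> /error_le error_j /error_le error_q.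
have error_N : split_error N.+1 <= e1.
  by apply: error_le; apply: leqW; near: N; exact: nbhs_infty_ge.
have b_le : `|b (x N j) - b v| <= e1.
  rewrite distrC; apply: b_near; rewrite /ball /= distrC.
  by rewrite (le_lt_trans x_eta1) // gtr_pMr // invf_lt1 // ltr1n.
have K_le : K * `|x N j - v| <= e1.
  apply: (@le_trans _ _ (K * (e1 / (K + 1)))); first by rewrite ler_wpM2l.
  by rewrite mulrA ler_pdivrMr ?ltr_wpDl // mulrC ler_pM2l // lerDl.
apply: (le_trans (split_value_limit_le jN _)); first by rewrite !ltW.
apply: (@le_trans _ _ (L * (5 * e1))); first by rewrite ler_wpM2l //; lra.
rewrite /e1 (_ : L * _ = e * (L / (L + 1))); last by field; rewrite gt_eqF //; lra.
by rewrite ler_piMr ?(ltW e0) // ler_pdivrMr ?mul1r ?lerDl //; lra.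
Unshelve. all: by end_near. Qed.

Lemma cvg_bernstein_split_value v : 0 < v < 1 ->
  (fun N => bernstein N (split_value N) v) @ \oo --> limit v.
Proof.
move=> v01; have v01c : 0 <= v <= 1 by have /andP[/ltW -> /ltW ->] := v01.
have [_ [M fM]] := fL.
have [_ [M' limitM]] := mix_b_hoppe_bounded_measurable theta_gt0 mu nu
  (bounded_lipschitz_measurable fL).
apply: (cvg_bernstein v01c (cvg_bernstein_split_frac_sqr v01c) (M := M + M'))
  => [N j _|e e0].
  by apply: (le_trans (ler_normB _ _)); rewrite lerD ?norm_split_value_le.
exact: split_value_near.
Qed.

Lemma limit_fixed_point : \int[mu]_z f z =
  \int[beta1_law theta_gt0]_(v in `]0, 1[) limit v.
Proof.
have [f_lip [M fM]] := fL; set B := beta1_law theta_gt0.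
have cvg_split : (fun N => \int[B]_(v in `]0, 1[) bernstein N (split_value N) v) @ \oo
    --> \int[B]_(v in `]0, 1[) limit v.
  apply: (@bounded_cvg_Rintegral _ _ _ B _ _ _ M) => // [N|N v|v].
  - by apply: measurable_funTS; exact: measurable_bernstein.
  - rewrite /= in_itv /= => /andP[v0 v1]; rewrite -[leRHS](bernstein_cst N _ v).
    by apply: le_norm_bernstein => [|j _]; [lra|exact: norm_split_value_le].
  - by rewrite /= in_itv /=; exact: cvg_bernstein_split_value.
pose expectation N := hoppe_expect theta N (fun t => f (normalized theta N t)).
have cvg_mu : (fun N => expectation N.+1) @ \oo --> \int[mu]_z f z.
  by rewrite (cvg_shiftS expectation); exact: cvg_lipschitz_rate mu_rate delta0 f_lip.
move: cvg_split.
rewrite (_ : (fun N => \int[B]_(v in _) _) = fun N => expectation N.+1).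
  by move=> cvg_split; exact: cvg_unique cvg_mu cvg_split.
by apply/funext => N; rewrite /expectation (hoppe_expect_split theta_gt0).
Qed.

End recursion_limit.

(** * Uniqueness *)

Section uniqueness.
Variables (R : realType) (theta : R).
Hypothesis theta_gt0 : 0 < theta.
Implicit Types (f : R * R -> R) (L : R).
Local Notation B := (beta1_law theta_gt0).

Lemma Rintegral_lipschitz_origin (rho : probability (R * R)%type R) L f :
  finite_first_moment rho -> bounded_lipschitz L f ->
  `|\int[rho]_x f x - f 0| <= L * \int[rho]_x `|x|.
Proof.
move=> rho_moment fL; have [f_lip _] := fL; have L0 := lipschitz_ge0 f_lip.
rewrite -(Rintegral_probability_cst rho (f 0)).
have [int_norm] := Rintegral_affine_norm L 0 rho_moment; rewrite addr0 => <-.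
apply: le_norm_RintegralB => //.
- exact: bounded_continuous_integrable (bounded_lipschitzW fL).
- exact: cst_integrable.
- by move=> x _; rewrite addr0 -[in leRHS](subr0 x); exact: (lipschitzP _ _).1.
Qed.

Lemma Rintegral_onem_beta1_law :
  \int[B]_(v in `]0, 1[) (1 - v) = theta / (theta + 1).
Proof.
rewrite -(beta1_moment0n theta_gt0 1); apply: eq_Rintegral => v _.
by rewrite XMonemXE mul1r.
Qed.

Section contraction.
Variables mu mu' nu : probability (R * R)%type R.
Hypotheses (mu_moment : finite_first_moment mu)
  (mu'_moment : finite_first_moment mu')
  (mu_fix : fixed_point_eq (beta1_dens theta) (b_hoppe theta) mu mu nu)
  (mu'_fix : fixed_point_eq (beta1_dens theta) (b_hoppe theta) mu' mu' nu).

Lemma norm_fixed_pointB_le m L f : bounded_lipschitz L f ->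
  `|\int[mu]_x f x - \int[mu']_x f x| <=
  (theta / (theta + 1)) ^+ m * (L * (\int[mu]_x `|x| + \int[mu']_x `|x|)).
Proof.
set K := \int[mu]_x `|x| + _; elim: m L f => [|m IH] L f fL.
  rewrite expr0 mul1r mulrDr; apply: (le_trans (ler_distD (f 0) _ _)).
  by rewrite lerD ?[`|f 0 - _|]distrC ?Rintegral_lipschitz_origin.
have f_bm := bounded_lipschitz_measurable fL.
have /fixed_point_eqP mu_lip := mu_fix; have /fixed_point_eqP mu'_lip := mu'_fix.
rewrite (mu_lip theta_gt0 L f fL) (mu'_lip theta_gt0 L f fL).
set C := (theta / (theta + 1)) ^+ m * (L * K).
have int_onem : B.-integrable `]0, 1[ (EFin \o (fun v => 1 - v)).
  have := XMonemX_integrable theta_gt0 0 1.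
  by congr (integrable _ _ _); apply/funext => v; rewrite /= XMonemXE mul1r.
rewrite exprSr mulrAC -/C -Rintegral_onem_beta1_law -RintegralZl //.
apply: le_norm_RintegralB => //; try exact: mix_b_hoppe_integrable.
  exact: integrable_EFinZ.
move=> v; rewrite /= in_itv /= => /andP[v0 v1].
have v01 : 0 <= v <= 1 by rewrite !ltW.
have right_lip := mix_right_expect_bounded_lipschitz (b_hoppe theta v) nu v01 fL.
apply: (le_trans (IH _ _ right_lip)).
by rewrite /C; lra.
Qed.

Lemma fixed_point_unique A : measurable A -> mu' A = mu A.
Proof.
move=> mA; apply: (eq_probability_lipschitz _ mA) => L f fL.
apply/eqP; rewrite eq_sym -subr_eq0 -normr_le0.
set K := L * (\int[mu]_x `|x| + \int[mu']_x `|x|).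
have cvg0 : (fun m => (theta / (theta + 1)) ^+ m * K) @ \oo --> (0 : R).
  rewrite -(mul0r K); apply: cvgM; last exact: cvg_cst.
  have t0 := theta_gt0; apply: cvg_expr.
  by rewrite ger0_norm ?divr_ge0 ?ltr_pdivrMr ?mul1r ?ltrDl //; lra.
by apply: (cvgr_to_ge cvg0); apply: nearW => m; exact: norm_fixed_pointB_le.
Qed.

End contraction.

End uniqueness.

Theorem mainTheorem8 (R : realType) (theta : R)
  (nu : probability (R * R)%type R) :
  0 < theta ->
  (* nu = law of (W~, T~): the limit for the random recursive tree (theta = 1) *)
  cvg_dist_L2 (hoppe_normE 1) nu ->
  (* and (known input) the RRT fixed-point equation with U ~ U[0,1] *)
  centered_L2 nu ->
  fixed_point_eq (@unif_dens R) (@b_rrt R) nu nu nu ->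
  exists mu : probability (R * R)%type R,
    cvg_dist_L2 (hoppe_normE theta) mu /\
    centered_L2 mu /\
    fixed_point_eq (beta1_dens theta) (b_hoppe theta) mu mu nu /\
    (forall mu' : probability (R * R)%type R,
        centered_L2 mu' ->
        fixed_point_eq (beta1_dens theta) (b_hoppe theta) mu' mu' nu ->
        forall A, measurable A -> mu' A = mu A).
Proof.
move=> theta_gt0 nu_cvg nu_centered _.
have [delta1 delta10 nu_rate] := cvg_dist_L2_lipschitz_rate ltr01 nu_cvg.
have [mu [mu_cvg mu_centered [delta delta0 mu_rate]]] := hoppe_limit_law theta_gt0.
have mu_moment := finite_second_first_moment mu_centered.1.
have nu_moment := finite_second_first_moment nu_centered.1.
have mu_fix : fixed_point_eq (beta1_dens theta) (b_hoppe theta) mu mu nu.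
  apply/(fixed_point_eqP theta_gt0) => L f fL.
  exact: (limit_fixed_point theta_gt0 mu_rate nu_rate delta0 delta10
    mu_moment nu_moment fL).
exists mu; split=> //; split=> //; split=> // mu' mu'_centered mu'_fix A mA.
have mu'_moment := finite_second_first_moment mu'_centered.1.
exact: (fixed_point_unique theta_gt0 mu_moment mu'_moment mu_fix mu'_fix mA).
Qed.
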